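(* Let $u_0\in\mathcal{M}$. There exists a constant $C_\alpha\in(0,1]$, depending only on $\mathcal{D}$, $d$, $\beta$, $V$, $\Omega$ and $\|u_0\|_{H_0^1}$, such that for any sequence of step sizes with $0<\alpha_{\min}\le\alpha_n\le\alpha_{\max}\le C_\alpha$, the sequence $\{u_n\}_{n=0}^\infty$ generated from $u_0$ by the $H_0^1$ scheme $u_{n+1}=R\big(u_n-\alpha_n\nabla^{\mathcal{R}}_{H_0^1}E(u_n)\big)$ has the following property: every weak limit point $u^*$ of $\{u_n\}$ in $H_0^1(\mathcal{D})$ is a stationary point of the constrained problem $\min_{u\in\mathcal{M}}E(u)$, and $\{u_n\}$ has a subsequence that converges strongly to $u^*$ in the $H_0^1$ norm.
   Context: Setting: $\mathcal{D}\subseteq\mathbb{R}^d$ ($d=2,3$) is a bounded domain; points are written $r=(x,y)$ or $r=(x,y,z)$. $V\in L^\infty(\mathcal{D};\mathbb{R}_{\ge0})$, $\beta>0$, $\Omega\ge0$, $L_z=-\mathrm{i}(x\partial_y-y\partial_x)$. Standing assumption: there is a constant $K>0$ with $V(r)\ge\frac{1+K}{4}\Omega^2(x^2+y^2)$ for all $r\in\mathcal{D}$. All function spaces are complex valued; $(v,w)_{L^2}=\int_{\mathcal{D}}\overline{v}w\,dr$. $\Re$ denotes the real part. Energy: $E(u)=\int_{\mathcal{D}}\big(\frac12|\nabla u|^2+\frac12V|u|^2+\frac\beta4|u|^4-\frac\Omega2\overline{u}L_zu\big)dr$ for $u\in H_0^1(\mathcal{D})$. Constraint manifold: $\mathcal{M}=\{u\in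 H_0^1(\mathcal{D};\mathbb{C}):\|u\|_{L^2}=1\}$. The real Fréchet derivative is $\langle E'(u),v\rangle=\Re(\nabla u,\nabla v)_{L^2}+\Re(Vu+\beta|u|^2u-\Omega L_zu,v)_{L^2}$. A stationary point of the constrained problem is $u\in\mathcal{M}$ such that for some $\lambda\in\mathbb{R}$, $\langle E'(u),v\rangle=\lambda\Re(u,v)_{L^2}$ for all $v\in H_0^1(\mathcal{D})$ (equivalently, the projected gradient defined below vanishes at $u$). A weak limit point of a sequence is the weak limit in $H_0^1(\mathcal{D})$ of some subsequence. $H_0^1$ inner product: $(v,w)_{H_0^1}=(\nabla v,\nabla w)_{L^2}$, with norm $\|v\|_{H_0^1}=\|\nabla v\|_{L^2}$. With $X=H_0^1$: the Sobolev gradient $\nabla_XE(u)\in H_0^1(\mathcal{D})$ is the unique function with $\Re(\nabla_XE(u),h)_X=\langle E'(u),h\rangle$ for all $h\in H_0^1(\mathcal{D})$; $\mathcal{G}_X$ is defined by $(\mathcal{G}_Xw,h)_X=(w,h)_{L^2}$ for all $h\in H_0^1(\mathcal{D})$; the projected gradient is $\nabla^{\mathcal{R}}_XE(u)=\mathcal{P}_{u,X}(\nabla_XE(u))$, where $\mathcal{P}_{u,X}w=w-\frac{\Re(w,\mathcal{G}_Xu)_X}{\|\mathcal{G}_Xu\|_X^2}\mathcal{G}_Xu$ is the $X$-orthogonal projection onto $T_u\mathcal{M}=\{v\in H_0^1(\mathcal{D}):\Re(u,v)_{L^2}=0\}$. Retraction: $R(v)=v/\|v\|_{L^2}$ for $v\in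 H_0^1(\mathcal{D})\setminus\{0\}$. *)

(* Defs.v *)
From HB Require Import structures.
From mathcomp Require Import all_boot all_order all_algebra.
From mathcomp Require Import all_classical all_reals all_analysis.
From mathcomp Require Import complex.

Set Implicit Arguments.
Unset Strict Implicit.
Unset Printing Implicit Defensive.

Import Order.TTheory GRing.Theory Num.Theory.
Import numFieldNormedType.Exports.

Local Open Scope classical_set_scope.
Local Open Scope ring_scope.
Local Open Scope complex_scope.

(* real-valued parts, not the R[i]-valued ones of ssrnum *)
Local Notation Re := complex.Re.
Local Notation Im := complex.Im.

(* R^n is 'rV[R]_n, with the sigma-algebra generated by the coordinates (the
   Borel sigma-algebra). *)
Section rV_measurable.
Context (R : realType) (n : nat).

Let coords (i : 'I_n) (x : 'rV[R]_n) : R := x ord0 i.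

Let rV_set0 : g_sigma_preimage coords set0.
Proof. exact: sigma_algebra0. Qed.

Let rV_setC A : g_sigma_preimage coords A -> g_sigma_preimage coords (~` A).
Proof. exact: sigma_algebraC. Qed.

Let rV_bigcup (F : (set 'rV[R]_n)^nat) :
  (forall i, g_sigma_preimage coords (F i)) ->
  g_sigma_preimage coords (\bigcup_i F i).
Proof. exact: sigma_algebra_bigcup. Qed.

HB.instance Definition _ := @isMeasurable.Build default_measure_display
  'rV[R]_n (g_sigma_preimage coords) rV_set0 rV_setC rV_bigcup.

End rV_measurable.

Section lebesgue_rV.
Context (R : realType).

Lemma measurable_coord n (i : 'I_n) :
  measurable_fun [set: 'rV[R]_n] (fun x : 'rV[R]_n => x ord0 i).
Proof.
move=> _ Y mY; rewrite setTI; apply: sub_sigma_algebra => /=.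
rewrite -bigcup_seq/=; exists i => /=; first by rewrite mem_index_enum.
by exists Y => //; rewrite setTI.
Qed.

Lemma measurable_rVP d (T : measurableType d) n (f : T -> 'rV[R]_n) :
  (forall i, measurable_fun [set: T] (fun t => f t ord0 i)) ->
  measurable_fun [set: T] f.
Proof.
move=> mf _ A mA; rewrite setTI.
suff H : g_sigma_preimage (fun (i : 'I_n) (x : 'rV[R]_n) => x ord0 i) `<=`
    [set B | measurable (f @^-1` B)] by exact: H.
apply: smallest_sub.
  split=> [|B mB|F mF] /=.
  - by rewrite preimage_set0.
  - by rewrite setTD preimage_setC; exact: measurableC.
  - rewrite preimage_bigcup; apply: bigcup_measurable => k _.
    exact: mF.
rewrite -bigcup_seq => B /= [i _] [C mC] CB.
by rewrite -CB; have := mf i measurableT C mC; rewrite !setTI.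
Qed.

Definition cons_rV n (p : 'rV[R]_n * R) : 'rV[R]_n.+1 :=
  row_mx (const_mx p.2 : 'rV_1) p.1.

Lemma measurable_cons_rV n : measurable_fun [set: 'rV[R]_n * R] (@cons_rV n).
Proof.
apply: measurable_rVP => i; rewrite /cons_rV.
case: (@split_ordP 1 n i) => j ->.
  under eq_fun do rewrite (row_mxEl (const_mx _ : 'rV_1)) mxE.
  exact: measurable_snd.
under eq_fun do rewrite (row_mxEr (const_mx _ : 'rV_1)).
exact: measurableT_comp (measurable_coord j) measurable_fst.
Qed.

(* n-dimensional Lebesgue measure *)
Fixpoint leb n : {measure set 'rV[R]_n -> \bar R} :=
  match n with
  | 0 => \d_(0 : 'rV[R]_0)
  | n'.+1 =>
    measure_function_pushforward__canonical__measure_function_Measure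
      (leb n' \x @lebesgue_measure R)%E (@measurable_cons_rV n')
  end.

End lebesgue_rV.
Arguments leb {R n}.

Section spaces.
Context (R : realType) (n : nat).
Implicit Types (D : set 'rV[R]_n) (u v w : 'rV[R]_n -> R[i]).

Definition bounded_domain D :=
  [/\ D !=set0, open D, connected D & bounded_set D].

Definition Linfty D (V : 'rV[R]_n -> R) :=
  measurable_fun D V /\
  exists M : R, {ae leb, forall x, D x -> `|V x| <= M}.

Definition sqmod (z : R[i]) : R := Re z ^+ 2 + Im z ^+ 2.

Definition Cintegral D (f : 'rV[R]_n -> R[i]) : R[i] :=
  (\int[leb]_(x in D) Re (f x)) +i* (\int[leb]_(x in D) Im (f x)).

Definition L2 D : set ('rV[R]_n -> R[i]) := [set u |
  [/\ measurable_fun D (fun x => Re (u x)),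
      measurable_fun D (fun x => Im (u x)) &
      (\int[leb]_(x in D) (sqmod (u x))%:E < +oo)%E]].

Definition L2ip D v w : R[i] := Cintegral D (fun x => conjc (v x) * w x).

Definition L2norm D v : R := Num.sqrt (\int[leb]_(x in D) sqmod (v x)).

Definition partial (i : 'I_n) (f : 'rV[R]_n -> R) : 'rV[R]_n -> R :=
  fun x => 'D_(delta_mx ord0 i) f x.

Definition smooth (f : 'rV[R]_n -> R) := forall s : seq 'I_n,
  continuous (foldr partial f s) /\
  forall i x, derivable (foldr partial f s) x (delta_mx ord0 i).

(* C_c^oo(D; C), extended by 0 to R^n *)
Definition test_fun D : set ('rV[R]_n -> R[i]) := [set phi |
  [/\ smooth (fun x => Re (phi x)), smooth (fun x => Im (phi x)),
      compact (closure [set x | phi x != 0]) &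
      closure [set x | phi x != 0] `<=` D]].

Definition Cpartial (i : 'I_n) (phi : 'rV[R]_n -> R[i]) : 'rV[R]_n -> R[i] :=
  fun x => partial i (fun y => Re (phi y)) x +i*
           partial i (fun y => Im (phi y)) x.

Definition is_weak_grad D u (g : 'I_n -> 'rV[R]_n -> R[i]) := forall i,
  L2 D (g i) /\
  forall phi, test_fun D phi ->
    Cintegral D (fun x => u x * Cpartial i phi x) =
    - Cintegral D (fun x => g i x * phi x).

(* Functions are not quotiented by equality a.e. on D; the weak gradient and the
   Riesz representatives below are representatives picked by choice. They depend
   on the a.e. classes of their arguments only. *)
Definition wgrad D u : 'I_n -> 'rV[R]_n -> R[i] :=
  xget (fun _ _ => 0) [set g | is_weak_grad D u g].

Definition H1 D : set ('rV[R]_n -> R[i]) :=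
  [set u | L2 D u /\ exists g, is_weak_grad D u g].

Definition H1norm D u : R :=
  Num.sqrt (L2norm D u ^+ 2 + \sum_(i < n) L2norm D (wgrad D u i) ^+ 2).

(* closure of C_c^oo(D; C) in H^1(D; C) *)
Definition H01 D : set ('rV[R]_n -> R[i]) := [set u | H1 D u /\
  forall eps : R, 0 < eps ->
    exists2 phi, test_fun D phi & H1norm D (fun x => u x - phi x) < eps].

Definition H01ip D v w : R[i] := \sum_(i < n) L2ip D (wgrad D v i) (wgrad D w i).

Definition H01norm D v : R :=
  Num.sqrt (\sum_(i < n) L2norm D (wgrad D v i) ^+ 2).

Definition H01_weak_cvg D (v : nat -> 'rV[R]_n -> R[i]) w :=
  forall h, H01 D h ->
    ((fun k => Re (H01ip D h (v k))) @ \oo --> Re (H01ip D h w)) /\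
    ((fun k => Im (H01ip D h (v k))) @ \oo --> Im (H01ip D h w)).

Definition H01_strong_cvg D (v : nat -> 'rV[R]_n -> R[i]) w :=
  (fun k => H01norm D (fun x => v k x - w x)) @ \oo --> (0 : R).

Definition weak_limit_point D (v : nat -> 'rV[R]_n -> R[i]) w :=
  H01 D w /\
  exists2 k : nat -> nat, increasing_seq k & H01_weak_cvg D (v \o k) w.

Definition manifold D : set ('rV[R]_n -> R[i]) :=
  [set u | H01 D u /\ L2norm D u = 1].

Definition retraction D v : 'rV[R]_n -> R[i] :=
  fun x => (L2norm D v)^-1%:C * v x.

(* the Riesz representative in H_0^1(D) of h |-> (w, h)_{L^2} *)
Definition GX D w : 'rV[R]_n -> R[i] :=
  xget (fun=> 0) [set g | H01 D g /\
    forall h, H01 D h -> H01ip D g h = L2ip D w h].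

Definition tangent_proj D u w : 'rV[R]_n -> R[i] :=
  fun x => w x -
    (Re (H01ip D w (GX D u)) / H01norm D (GX D u) ^+ 2)%:C * GX D u x.

End spaces.

(* The ambient dimension is m.+2, so that x and y are coordinates 0 and 1. *)
Section gross_pitaevskii.
Context (R : realType) (m : nat) (D : set 'rV[R]_m.+2).
Context (V : 'rV[R]_m.+2 -> R) (beta Omega : R).
Implicit Types u v : 'rV[R]_m.+2 -> R[i].

Let ix : 'I_m.+2 := @Ordinal m.+2 0 isT.
Let iy : 'I_m.+2 := @Ordinal m.+2 1 isT.

Definition Lz u : 'rV[R]_m.+2 -> R[i] := fun r =>
  - (0 +i* 1) * ((r ord0 ix)%:C * wgrad D u iy r - (r ord0 iy)%:C * wgrad D u ix r).

(* a real number: the integral of conj(u) * Lz u is real for u in H_0^1(D) *)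
Definition energy u : R := Re (Cintegral D (fun r =>
  (2^-1 * (\sum_i sqmod (wgrad D u i r)) + 2^-1 * V r * sqmod (u r)
   + beta / 4 * sqmod (u r) ^+ 2)%:C
  - (Omega / 2)%:C * conjc (u r) * Lz u r)).

(* <E'(u), v>, the real Frechet derivative of energy *)
Definition denergy u v : R :=
  Re (H01ip D u v) +
  Re (L2ip D (fun r => (V r)%:C * u r + (beta * sqmod (u r))%:C * u r
                       - Omega%:C * Lz u r) v).

Definition trap_dominates_rotation (K : R) := {ae leb, forall r, D r ->
  (1 + K) / 4 * Omega ^+ 2 * (r ord0 ix ^+ 2 + r ord0 iy ^+ 2) <= V r}.

Definition stationary u := manifold D u /\
  exists lambda : R, forall v, H01 D v ->
    denergy u v = lambda * Re (L2ip D u v).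

Definition sobolev_grad u : 'rV[R]_m.+2 -> R[i] :=
  xget (fun=> 0) [set g | H01 D g /\
    forall h, H01 D h -> Re (H01ip D g h) = denergy u h].

Definition projected_grad u := tangent_proj D u (sobolev_grad u).

Fixpoint H01_scheme (u0 : 'rV[R]_m.+2 -> R[i]) (alpha : nat -> R) (n : nat) :=
  match n with
  | 0 => u0
  | k.+1 => let u := H01_scheme u0 alpha k in
      retraction D (fun r => u r - (alpha k)%:C * projected_grad u r)
  end.

End gross_pitaevskii.

(* Main.v *)
(** Write X for the norm of H_0^1. The quadratic part of E is a bounded symmetric
    form, and V >= (1+K)/4 Omega^2 (x^2+y^2) makes it coercive: the rotation
    term is absorbed with the fraction 1/(1+K) of the kinetic energy. The Sobolev
    inequality ||u||_4^4 <= C ||u||_2 X(u)^3 (Ladyzhenskaya; dimension 2 or 3)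
    controls the quartic part. The projected gradient p is L^2-orthogonal to u, so
    ||u - alpha p||_2 >= 1 and the retraction does not increase E; since
    <E'(u), p> = X(p)^2, expanding E(u - alpha p) gives
    E(u_{n+1}) <= E(u_n) - (alpha_n / 2) X(p_n)^2 for small alpha_n. By coercivity
    the u_n stay in a ball whose radius depends on X(u_0) only, and X(p_n) -> 0.
    A weakly convergent subsequence converges in L^2 (Rellich) and, by the Sobolev
    inequality, in L^4. Testing
    <E'(u_n), w> = (p_n, w)_X + mu_n (u_n, w)_2, with mu_n bounded, against
    w = u_n - u* gives strong convergence; testing against a fixed w then
    shows that u* is stationary.

    Rellich's theorem comes from
    ||f||_2^2 <= C sum_i (int q_i f)^2 + delta X(f)^2
    with finitely many q_i in L^2, proved by induction on the dimension: the
    integrals of q f(t, .) are Hoelder continuous in t, hence close to their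
    averages over the cells of a fine grid. *)
Require Import Defs.
From HB Require Import structures.
From mathcomp Require Import all_boot all_order all_algebra.
From mathcomp Require Import all_classical all_reals all_analysis.
From mathcomp Require Import measurable_realfun complex ring lra.

Set Implicit Arguments.
Unset Strict Implicit.
Unset Printing Implicit Defensive.

Import Order.TTheory GRing.Theory Num.Theory.
Import numFieldNormedType.Exports.

Local Open Scope classical_set_scope.
Local Open Scope ring_scope.

Local Notation Re := complex.Re.
Local Notation Im := complex.Im.

(** * Lebesgue measure on R^n *)

Section leb_tonelli.
Context (R : realType).

(** Functions are not quotiented by almost-everywhere equality, and weak gradients and Riesz
    representatives are picked by choice. Hilbert space arguments are therefore run for a semi-inner
    product on a set of functions with one operation, [lin c u v] standing for u + c v; identities
    between chosen gradients hold only almost everywhere. The energy is differentiated over the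
    reals, so all forms are real parts, and complex statements are recovered by testing with
    [mulI h], that is i h.

    The analytic inequalities are proved for smooth real functions supported in one cube, on
    coordinate lines and slices, where they reduce to the fundamental theorem of calculus and
    Tonelli. Density carries them to H_0^1: directly for norms, by Fatou's lemma for the L^4 bound.

    The step bound has to be fixed before u_0 is known, from its norm alone: it is computed from an
    upper bound of the energy over all functions of that norm. The multipliers mu_n are not shown to
    converge; testing with u* itself eliminates them. *)

Lemma cons_rV0 n (x : 'rV[R]_n) t : cons_rV (x, t) ord0 ord0 = t.
Proof.
rewrite /cons_rV (_ : ord0 = lshift n (ord0 : 'I_1)); last exact: val_inj.
by rewrite (row_mxEl (const_mx _ : 'rV_1)) mxE.
Qed.

Lemma cons_rVS n (x : 'rV[R]_n) t (i : 'I_n) :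
  cons_rV (x, t) ord0 (lift ord0 i) = x ord0 i.
Proof.
rewrite /cons_rV (_ : lift ord0 i = rshift 1 i); last exact: val_inj.
by rewrite (row_mxEr (const_mx _ : 'rV_1)).
Qed.

Definition cube n (r : R) : set 'rV[R]_n := [set x | forall i, `|x ord0 i| <= r].
Arguments cube : clear implicits.

Lemma measurable_cube n r : measurable (cube n r).
Proof.
have -> : cube n r = \bigcap_(i in [set: 'I_n])
    ((fun x : 'rV[R]_n => x ord0 i) @^-1` `[- r, r]).
  apply/seteqP; split=> x /= h i; first by move=> _; rewrite /= in_itv/= -ler_norml.
  by have := h i I; rewrite /= in_itv/= -ler_norml.
apply: fin_bigcap_measurable => // i _.
by rewrite -[X in measurable X]setTI; exact: measurable_coord.
Qed.

Lemma leb_cube_lty n r : (leb (cube n r) < +oo)%E.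
Proof.
elim: n => [|n IHn].
  by rewrite /= diracE; case: (_ \in _); rewrite ltry.
rewrite /= /pushforward /=.
have -> : @cons_rV R n @^-1` cube n.+1 r = cube n r `*` `[- r, r].
  apply/seteqP; split=> -[x t] /= h.
    split=> [i|]; first by have := h (lift ord0 i); rewrite cons_rVS.
    by have := h ord0; rewrite cons_rV0 in_itv/= -ler_norml.
  case: h => h1 h2 i; case: (unliftP ord0 i) => [j|] ->.
    by rewrite cons_rVS.
  by rewrite cons_rV0; move: h2; rewrite in_itv/= -ler_norml.
rewrite product_measure1E//; last exact: measurable_cube.
apply: lte_mul_pinfty => //; first by rewrite ge0_fin_numE.
suff h : (@lebesgue_measure R [set` `[(- r)%R, r]%R] < +oo)%E by exact: h.
by rewrite lebesgue_measure_itv/=; case: ifP; rewrite ?ltry.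
Qed.

Lemma cube_cover n : \bigcup_k cube n k%:R = setT.
Proof.
apply/seteqP; split=> // x _.
exists (Num.truncn (\sum_i `|x ord0 i|)).+1 => //= i.
apply: ltW; apply: le_lt_trans (truncnS_gt _).
by rewrite (bigD1 i)//= lerDl sumr_ge0.
Qed.

Lemma leb_sigma_finite n : sigma_finite setT (@leb R n).
Proof.
exists (fun k => cube n k%:R); first by rewrite cube_cover.
by move=> k; split; [exact: measurable_cube|exact: leb_cube_lty].
Qed.

(** A copy of [leb n] that carries a sigma-finite structure, which the Fubini-Tonelli theorems take
    from the measure itself. *)
Definition sleb n (A : set 'rV[R]_n) : \bar R := leb A.
Arguments sleb : clear implicits.

HB.instance Definition _ n := Measure.copy (sleb n) (@leb R n).
HB.instance Definition _ n :=
  @Measure_isSigmaFinite.Build _ _ _ (sleb n) (@leb_sigma_finite n).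

Local Open Scope ereal_scope.

Lemma measurable_consrV_l n d (T : measurableType d) (f : 'rV[R]_n.+1 -> T) :
  measurable_fun setT f -> measurable_fun setT (fun p => f (cons_rV p)).
Proof. by move=> mf; exact: measurableT_comp (@measurable_cons_rV R n). Qed.

Lemma leb_tonelli1 n (f : 'rV[R]_n.+1 -> \bar R) :
  measurable_fun [set: 'rV[R]_n.+1] f -> (forall x, 0 <= f x) ->
  \int[leb]_x f x =
  \int[leb]_x \int[lebesgue_measure]_t f (cons_rV (x, t)).
Proof.
move=> mf f0; rewrite /= ge0_integral_pushforward//=; last exact: measurable_cons_rV.
have := fubini_tonelli1 (m1 := sleb n) (m2 := @lebesgue_measure R) (fun p => f (cons_rV p)).
by rewrite /fubini_F; apply => //; exact: measurable_consrV_l.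
Qed.

Lemma leb_tonelli2 n (f : 'rV[R]_n.+1 -> \bar R) :
  measurable_fun [set: 'rV[R]_n.+1] f -> (forall x, 0 <= f x) ->
  \int[leb]_x f x =
  \int[lebesgue_measure]_t \int[leb]_x f (cons_rV (x, t)).
Proof.
move=> mf f0; rewrite leb_tonelli1//.
have := fubini_tonelli (m1 := sleb n) (m2 := @lebesgue_measure R) (fun p => f (cons_rV p)).
by apply => //; exact: measurable_consrV_l.
Qed.

Lemma measurable_tonelli1 n (f : 'rV[R]_n.+1 -> \bar R) :
  measurable_fun [set: 'rV[R]_n.+1] f -> (forall x, 0 <= f x) ->
  measurable_fun [set: 'rV[R]_n] (fun x => \int[lebesgue_measure]_t f (cons_rV (x, t))).
Proof.
move=> mf f0.
have := measurable_fun_fubini_tonelli_F (m2 := @lebesgue_measure R) (fun p => f (cons_rV p)).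
by apply => //; exact: measurable_consrV_l.
Qed.

Lemma measurable_tonelli2 n (f : 'rV[R]_n.+1 -> \bar R) :
  measurable_fun [set: 'rV[R]_n.+1] f -> (forall x, 0 <= f x) ->
  measurable_fun [set: R] (fun t => \int[leb]_x f (cons_rV (x, t))).
Proof.
move=> mf f0.
have := measurable_fun_fubini_tonelli_G (m1 := sleb n) (fun p => f (cons_rV p)).
by apply => //; exact: measurable_consrV_l.
Qed.

Definition upd n (i : 'I_n) (x : 'rV[R]_n) (t : R) : 'rV[R]_n :=
  \row_j (if j == i then t else x ord0 j).

Lemma upd_cons0 n (x : 'rV[R]_n) s t :
  upd ord0 (cons_rV (x, s)) t = cons_rV (x, t).
Proof.
apply/rowP => j; rewrite mxE; case: (unliftP ord0 j) => [k|] ->.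
  by rewrite eq_sym (negbTE (neq_lift _ _)) !cons_rVS.
by rewrite eqxx cons_rV0.
Qed.

Lemma upd_consS n (i : 'I_n) (x : 'rV[R]_n) s t :
  upd (lift ord0 i) (cons_rV (x, s)) t = cons_rV (upd i x t, s).
Proof.
apply/rowP => j; rewrite mxE; case: (unliftP ord0 j) => [k|] ->.
  by rewrite (inj_eq lift_inj) !cons_rVS mxE.
by rewrite (negbTE (neq_lift _ _)) !cons_rV0.
Qed.

Lemma measurable_upd n (i : 'I_n) (x : 'rV[R]_n) : measurable_fun [set: R] (upd i x).
Proof.
apply: measurable_rVP => j; rewrite /upd.
case: (eqVneq j i) => [->|ji].
  by under eq_fun do rewrite mxE eqxx; exact: measurable_id.
by under eq_fun do rewrite mxE (negbTE ji); exact: measurable_cst.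
Qed.

(* Fubini along the [i]-th coordinate, in the form of a comparison principle. *)
Lemma le_integral_lines n (i : 'I_n) (f g : 'rV[R]_n -> \bar R) :
  measurable_fun [set: 'rV[R]_n] f -> measurable_fun [set: 'rV[R]_n] g ->
  (forall x, 0 <= f x) -> (forall x, 0 <= g x) ->
  (forall x, \int[lebesgue_measure]_t f (upd i x t) <=
             \int[lebesgue_measure]_t g (upd i x t)) ->
  \int[leb]_x f x <= \int[leb]_x g x.
Proof.
elim: n => [|n IHn] in i f g *; first by case: i.
move=> mf mg f0 g0 fg.
have mc h t : measurable_fun [set: 'rV[R]_n.+1] h ->
    measurable_fun [set: 'rV[R]_n] (fun x : 'rV[R]_n => h (cons_rV (x, t)) : \bar R).
  move=> mh; apply: measurableT_comp mh _.
  by apply: measurableT_comp (@measurable_cons_rV R n) _; exact: measurable_pair2.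
(* For a direction other than the first, the induction hypothesis applies with the first coordinate
   frozen; for the first one, Tonelli with the lines as inner integrals is enough. *)
case: (unliftP ord0 i) => [j|] ij; rewrite ij in fg.
  rewrite (leb_tonelli2 mf f0) (leb_tonelli2 mg g0).
  apply: ge0_le_integral => //.
  - by move=> t _; exact: integral_ge0.
  - exact: measurable_tonelli2.
  - exact: measurable_tonelli2.
  move=> t _; apply: (IHn j); [exact: mc|exact: mc|by []|by []|] => x.
  have e (h : 'rV[R]_n.+1 -> \bar R) :
      \int[lebesgue_measure]_s h (upd (lift ord0 j) (cons_rV (x, t)) s) =
      \int[lebesgue_measure]_s h (cons_rV (upd j x s, t)).
    by apply: eq_integral => s _; rewrite upd_consS.
  by have := fg (cons_rV (x, t)); rewrite !e.
rewrite (leb_tonelli1 mf f0) (leb_tonelli1 mg g0).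
apply: ge0_le_integral => //.
- by move=> t _; exact: integral_ge0.
- exact: measurable_tonelli1.
- exact: measurable_tonelli1.
move=> x _.
have e (h : 'rV[R]_n.+1 -> \bar R) :
    \int[lebesgue_measure]_s h (upd ord0 (cons_rV (x, 0%R)) s) =
    \int[lebesgue_measure]_s h (cons_rV (x, s)).
  by apply: eq_integral => s _; rewrite upd_cons0.
by have := fg (cons_rV (x, 0%R)); rewrite !e.
Qed.

End leb_tonelli.
Arguments cube {R} n r.
Arguments sleb {R} n A.

(** * Boxes, open sets and coordinate lines *)

Section topology_rV.
Context (R : realType).

Definition box n (x : 'rV[R]_n) (r : R) : set 'rV[R]_n :=
  [set y | forall i, `|y ord0 i - x ord0 i| < r].

Lemma ball_rVE n (x y : 'rV[R]_n) r : 0 < r -> ball x r y <-> box x r y.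
Proof.
move=> r0; split=> [[_ h] i|h].
  by have := h ord0 i; rewrite /ball/= distrC.
split=> // i j; rewrite (ord1 i) /ball/= distrC; exact: h.
Qed.

Lemma measurable_box n (x : 'rV[R]_n) r : measurable (box x r).
Proof.
have -> : box x r = \bigcap_(i in [set: 'I_n])
    ((fun y : 'rV[R]_n => y ord0 i) @^-1` (ball (x ord0 i) r)).
  apply/seteqP; split=> y /= h i; first by move=> _; rewrite /= /ball/= distrC.
  by have := h i I; rewrite /= /ball/= distrC.
apply: fin_bigcap_measurable => // i _.
rewrite -[X in measurable X]setTI; apply: measurable_coord => //.
exact: measurable_ball.
Qed.

Lemma coord_le_norm n (x : 'rV[R]_n) i : `|x ord0 i| <= `|x|.
Proof.
rewrite [leRHS]/Num.norm/= mx_normrE; apply/bigmax_geP; right => /=.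
by exists (ord0, i).
Qed.

Definition ratv n (q : 'rV[rat]_n) : 'rV[R]_n := map_mx ratr q.

(** Rational centres and radii 1/(k+1) make the union countable, which gives the measurability of
    open sets. Closed balls are required to lie in [U], so that each box has its closure in [U] and
    can carry test functions. *)
Lemma open_bigcup_box n (U : set 'rV[R]_n) : open U ->
  U = \bigcup_(p in [set p : 'rV[rat]_n * nat |
        closed_ball (ratv p.1) (p.2.+1%:R^-1) `<=` U])
      box (ratv p.1) (p.2.+1%:R^-1).
Proof.
move=> oU; apply/seteqP; split=> [x Ux|x [[q k]/= h b]]; last first.
  by apply/h/subset_closed_ball/ball_rVE.
have /nbhs_ballP[e /= e0 xe] : nbhs x U by exact: open_nbhs_nbhs.
(* With [r < e / 3], a rational centre within [r] of [x] has its closed ball of radius [r] inside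
   the ball of radius [e] about [x]. *)
pose k := Num.truncn (e / 3)^-1; pose r : R := k.+1%:R^-1.
have r0 : 0 < r by rewrite invr_gt0.
have re : r < e / 3.
  by rewrite /r invf_plt ?posrE//; [exact: truncnS_gt|rewrite divr_gt0].
have qx i : exists q : rat, `|ratr q - x ord0 i| < r.
  have b0 : ball (x ord0 i) r !=set0 by exists (x ord0 i); exact: ballxx.
  have [y [] + [q _ qy]] := @dense_rat R _ b0 (ball_open (x ord0 i) r).
  by rewrite -qy /ball/= => ?; exists q; rewrite distrC.
pose q := \row_i xchoose (qx i).
have bq : box (ratv q) r x.
  by move=> i; rewrite !mxE distrC; exact: (xchooseP (qx i)).
exists (q, k) => //= y; rewrite closed_ballE// => yq.
apply: xe; apply/ball_rVE => // i.
have {}yq : `|y ord0 i - ratv q ord0 i| <= r.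
  rewrite distrC; apply: le_trans yq.
  by have := coord_le_norm (ratv q - y) i; rewrite !mxE.
have := bq i; rewrite distrC => bi.
have -> : y ord0 i - x ord0 i = (y ord0 i - ratv q ord0 i) + (ratv q ord0 i - x ord0 i) by ring.
by apply: le_lt_trans (ler_normD _ _) _; lra.
Qed.

Lemma open_measurable_rV n (U : set 'rV[R]_n) : open U -> measurable U.
Proof.
move=> /open_bigcup_box ->; rewrite bigcup_mkcond.
apply: countable_bigcupT_measurable => [|p]; first exact: countableP.
case: ifPn => // _.
exact: measurable_box.
Qed.

Lemma continuous_measurable_rV n (f : 'rV[R]_n -> R) :
  continuous f -> measurable_fun [set: 'rV[R]_n] f.
Proof.
move=> /continuousP cf; apply: (measurability _ (RGenOpens.measurableE R)).
move=> _ [_ [a [b ->] <-]]; rewrite setTI; apply: open_measurable_rV.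
exact/cf/interval_open.
Qed.

Lemma bounded_cube n (D : set 'rV[R]_n) : bounded_set D ->
  exists2 M, 0 < M & D `<=` cube n M.
Proof.
move=> [M [_ h]]; exists (`|M| + 1) => [|x Dx i]; first by rewrite ltr_wpDl.
apply: le_trans (h (`|M| + 1) _ x Dx); last first.
  by apply: le_lt_trans (ler_norm M) _; rewrite ltrDl.
exact: coord_le_norm.
Qed.

Lemma updE n (i : 'I_n) (x : 'rV[R]_n) t :
  upd i x t = (t - x ord0 i) *: delta_mx ord0 i + x.
Proof.
apply/rowP => j; rewrite !mxE eqxx/=; case: eqVneq => [->|_].
  by rewrite mulr1 subrK.
by rewrite mulr0 add0r.
Qed.

Lemma upd_id n (i : 'I_n) (x : 'rV[R]_n) : upd i x (x ord0 i) = x.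
Proof. by rewrite updE subrr scale0r add0r. Qed.

Lemma upd_coord n (i : 'I_n) (x : 'rV[R]_n) t : upd i x t ord0 i = t.
Proof. by rewrite mxE eqxx. Qed.

Lemma continuous_upd n (i : 'I_n) (x : 'rV[R]_n) : continuous (upd i x).
Proof.
move=> t; rewrite (_ : upd i x = fun t => (t - x ord0 i) *: delta_mx ord0 i + x); last first.
  by apply/funext => s; rewrite updE.
apply: cvgD; last exact: cvg_cst.
apply: cvgZr_tmp; apply: cvgB; [exact: cvg_id|exact: cvg_cst].
Qed.

Lemma is_derive_line n (i : 'I_n) (f : 'rV[R]_n -> R) x t :
  derivable f (upd i x t) (delta_mx ord0 i) ->
  is_derive t 1 (fun s => f (upd i x s)) (partial i f (upd i x t)).
Proof.
move=> df.
have e : (fun h => h^-1 *: (((fun s => f (upd i x s)) \o shift t) (h *: 1) - f (upd i x t))) =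
    (fun h : R => h^-1 *: ((f \o shift (upd i x t)) (h *: delta_mx ord0 i) - f (upd i x t))).
  apply/funext => h /=; congr (_ *: (f _ - _)).
  rewrite !updE addrA -scalerDl /shift; congr (_ *: _ + _).
  by rewrite /GRing.scale/= mulr1 addrA.
by split; rewrite /derivable /derive /partial ?e.
Qed.

End topology_rV.

(** * Smooth functions and test functions *)

Section smooth_algebra.
Context (R : realType) (n : nat).
Implicit Types (f g : 'rV[R]_n -> R) (B : set ('rV[R]_n -> R)).

Inductive alg B : ('rV[R]_n -> R) -> Prop :=
| alg_base f : B f -> alg B f
| alg_cst c : alg B (fun=> c)
| alg_add f g : alg B f -> alg B g -> alg B (fun x => f x + g x)
| alg_mul f g : alg B f -> alg B g -> alg B (fun x => f x * g x).

(** The partial derivatives only have to lie in the algebra generated by [B]: the derivative of a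
    generator is in general a combination of several generators, as for [bmp]. *)
Definition C1_in B f := continuous f /\
  forall i, (forall x, derivable f x (delta_mx ord0 i)) /\ alg B (partial i f).

(* Stability under partial derivatives has to be checked on generators only. *)
Lemma smooth_alg B f : (forall g, B g -> C1_in B g) -> alg B f -> smooth f.
Proof.
move=> hB.
have hA : forall g, alg B g -> C1_in B g.
  move=> g0; elim=> [g Bg|c|g h ag [cg hg] ah [ch hh]|g h ag [cg hg] ah [ch hh]].
  - exact: hB.
  - split=> [|i]; first exact: cst_continuous.
    split=> [x|]; first exact: derivable_cst.
    rewrite (_ : partial i _ = fun=> 0); first exact: alg_cst.
    by apply/funext => x; rewrite /partial derive_cst.
  - split=> [x|i]; first exact: (cvgD (cg x) (ch x)).
    have [dg pg] := hg i; have [dh ph] := hh i.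
    split=> [x|]; first by apply: derivableD.
    rewrite (_ : partial i _ = fun x => partial i g x + partial i h x).
      exact: alg_add.
    by apply/funext => x; rewrite /partial deriveD.
  - split=> [x|i]; first exact: (cvgM (cg x) (ch x)).
    have [dg pg] := hg i; have [dh ph] := hh i.
    split=> [x|]; first by apply: derivableM.
    rewrite (_ : partial i _ = fun x => g x * partial i h x + h x * partial i g x).
      by apply: alg_add; apply: alg_mul.
    by apply/funext => x; rewrite /partial deriveM.
move=> af s; suff [] : C1_in B (foldr (@partial R n) f s).
  by move=> cf df; split=> // i; exact: (df i).1.
apply: (hA); elim: s => //= i s ih; have [_ h] := hA _ ih.
exact: (h i).2.
Qed.

Lemma smooth_continuous f : smooth f -> continuous f.
Proof. by move=> /(_ [::])[]. Qed.

Lemma smooth_derivable f : smooth f -> forall i x, derivable f x (delta_mx ord0 i).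
Proof. by move=> /(_ [::])[]. Qed.

Lemma smooth_partial f i : smooth f -> smooth (partial i f).
Proof. by move=> sf s; have := sf (rcons s i); rewrite foldr_rcons. Qed.

Lemma smooth_C1 f : smooth f -> C1_in (@smooth R n) f.
Proof.
move=> sf; split=> [|i]; first exact: smooth_continuous.
by split=> [x|]; [exact: smooth_derivable|exact/alg_base/smooth_partial].
Qed.

Lemma smooth_cst c : smooth (fun _ : 'rV[R]_n => c).
Proof. exact: smooth_alg smooth_C1 (alg_cst _ c). Qed.

Lemma smoothD f g : smooth f -> smooth g -> smooth (fun x => f x + g x).
Proof. by move=> sf sg; apply: smooth_alg smooth_C1 (alg_add _ _); exact: alg_base. Qed.

Lemma smoothM f g : smooth f -> smooth g -> smooth (fun x => f x * g x).
Proof. by move=> sf sg; apply: smooth_alg smooth_C1 (alg_mul _ _); exact: alg_base. Qed.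

Lemma partialM i f g : smooth f -> smooth g ->
  partial i (fun x => f x * g x) = fun x => f x * partial i g x + g x * partial i f x.
Proof.
by move=> sf sg; apply/funext => x; rewrite /partial deriveM//; exact: smooth_derivable.
Qed.

Lemma partial_cst i c : partial i (fun _ : 'rV[R]_n => c) = fun=> 0.
Proof. by apply/funext => x; rewrite /partial derive_cst. Qed.

Lemma is_derive_along f (x v : 'rV[R]_n) df :
  is_derive (0 : R) (1 : R) (fun t => f (t *: v + x)) df -> is_derive x v f df.
Proof.
have e : (fun h : R => h^-1 *: (((fun t => f (t *: v + x)) \o shift 0) (h *: 1) - f (0 *: v + x)))
     = (fun h => h^-1 *: ((f \o shift x) (h *: v) - f x)).
  by apply/funext => h /=; rewrite scale0r add0r /shift /= addr0 /GRing.scale/= mulr1.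
by move=> [d1 d2]; split; [move: d1|move: d2]; rewrite /derivable /derive e.
Qed.

Lemma is_derive_coord (i j : 'I_n) (h : R -> R) (c a : R) dh (x : 'rV[R]_n) :
  is_derive (c * (x ord0 j - a)) 1 h dh ->
  is_derive x (delta_mx ord0 i) (fun y : 'rV[R]_n => h (c * (y ord0 j - a)))
    ((i == j)%:R * c * dh).
Proof.
move=> hd; apply: is_derive_along.
pose l (t : R) := c * (t * (i == j)%:R + (x ord0 j - a)).
have ld : is_derive (0 : R) (1 : R) l (c * (i == j)%:R).
  apply: is_derive_eq; rewrite /GRing.scale/=; ring.
have -> : (fun t : R => h (c * ((t *: delta_mx ord0 i + x) ord0 j - a))) = h \o l.
  apply/funext => t /=; rewrite /l !mxE eqxx/= [j == i]eq_sym.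
  by congr (h _); ring.
have e : (i == j)%:R * c * dh = dh * (c * (i == j)%:R) by ring.
rewrite e; apply: is_derive1_comp.
by rewrite /l mul0r add0r.
Qed.

End smooth_algebra.

(** * The flat function exp(-1/t) *)

Section bump.
Context (R : realType).

(* The derivative of [t^-k exp(-1/t)] is a combination of the functions of
   orders [k + 1] and [k + 2] of this family, and all of them are O(t^2) at 0. *)
Definition bmp (k : nat) (t : R) : R :=
  if 0 < t then (t^-1) ^+ k * expR (- t^-1) else 0.

Lemma bmp_le0 k t : t <= 0 -> bmp k t = 0.
Proof. by rewrite /bmp ltNge => ->. Qed.

Lemma bmp_ge0 k t : 0 <= bmp k t.
Proof.
rewrite /bmp; case: ifP => // t0.
by rewrite mulr_ge0 ?expR_ge0// exprn_ge0// invr_ge0 ltW.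
Qed.

(** The term of order [k + 2] of the exponential series at 1/t gives the bound. The square makes the
    difference quotients at 0 tend to 0. *)
Lemma bmp_le_sqr k t : bmp k t <= k.+2`!%:R * t ^+ 2.
Proof.
rewrite /bmp; case: ifPn => [t0|_]; last by rewrite mulr_ge0 ?sqr_ge0.
set s := t^-1; have s0 : 0 < s by rewrite invr_gt0.
rewrite expRN ler_pdivrMr ?expR_gt0//.
have -> : t = s^-1 by rewrite invrK.
have h := expR_ge1Dxn k.+1 (ltW s0).
have {h} : s ^+ k.+2 / k.+2`!%:R <= expR s by apply: le_trans h; rewrite lerDr.
rewrite ler_pdivrMr ?ltr0n ?fact_gt0// => h.
have -> : k.+2`!%:R * s^-1 ^+ 2 * expR s = (expR s * k.+2`!%:R) * s^-1 ^+ 2 by ring.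
rewrite exprVn ler_pdivlMr ?exprn_gt0//.
by rewrite -exprD addn2.
Qed.

Lemma is_derive_bmp k (t : R) :
  is_derive t 1 (bmp k) (bmp k.+2 t - k%:R * bmp k.+1 t).
Proof.
case: (ltrgtP 0 t) => t0.
- have e : \near t, (fun s => s^-1 ^+ k * expR (- s^-1)) t = bmp k t.
    by near=> s; rewrite /bmp ifT//; near: s; exact: lt_nbhsr.
  apply: near_eq_is_derive e _.
  rewrite /bmp t0.
  have d1 : is_derive t 1 (fun s : R => s^-1) (- t^-1 ^+ 2).
    have tn0 : t != 0 by rewrite gt_eqF.
    apply: is_derive_eq; first exact: (@is_deriveV _ id _ _ _ tn0 (is_derive_id t 1)).
    by rewrite /GRing.scale/= mulr1 exprVn.
  have d2 : is_derive t 1 (fun s : R => s^-1 ^+ k) (k%:R * t^-1 ^+ k.-1 * - t^-1 ^+ 2).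
    rewrite (_ : (fun s : R => s^-1 ^+ k) = (fun s : R => s^-1) ^+ k); last first.
      by apply/funext => s; rewrite exprfctE.
    by apply: is_derive_eq.
  have d3 : is_derive t 1 (fun s : R => expR (- s^-1)) (expR (- t^-1) * t^-1 ^+ 2).
    have d1' : is_derive t 1 (fun s : R => - s^-1) (t^-1 ^+ 2).
      by rewrite -[_ ^+ 2]opprK; exact: (is_deriveN d1).
    exact: (is_derive1_comp _ d1').
  rewrite (_ : _ - _ = t^-1 ^+ k *: (expR (- t^-1) * t^-1 ^+ 2) +
      expR (- t^-1) *: (k%:R * t^-1 ^+ k.-1 * - t^-1 ^+ 2)); last first.
    rewrite /GRing.scale/=; set z := t^-1; set w := expR _.
    by case: k {d2} => [|k] /=; rewrite ?mul0r ?exprS ?expr0; ring.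
  exact: (is_deriveM d2 d3).
- have e : \near t, (fun _ : R => 0) t = bmp k t.
    by near=> s; rewrite bmp_le0//; apply: ltW; near: s; exact: lt_nbhsl.
  apply: near_eq_is_derive e _.
  by rewrite !bmp_le0 ?ltW// mulr0 subr0; exact: is_derive_cst.
- rewrite -t0 !bmp_le0// mulr0 subr0.
  (* By [bmp_le_sqr] the quotient is at most (k+2)! |h|. *)
  have c0 : (fun h : R => h^-1 *: ((bmp k \o shift 0) (h *: 1) - bmp k 0)) @ 0^' --> 0.
    apply/cvgr0Pnorm_lt => e e0; near=> h.
    rewrite bmp_le0// subr0 /shift /= addr0 /GRing.scale/= mulr1.
    have h0 : h != 0 by near: h; exact: nbhs_dnbhs_neq.
    rewrite normrM normfV (ger0_norm (bmp_ge0 _ _)).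
    have hk : bmp k h <= k.+2`!%:R * `|h| ^+ 2 by rewrite real_normK ?num_real// bmp_le_sqr.
    rewrite mulrC ltr_pdivrMr ?normr_gt0//; apply: le_lt_trans hk _.
    rewrite expr2 mulrA ltr_pM2r ?normr_gt0// -ltr_pdivlMl ?ltr0n ?fact_gt0//.
    near: h; apply: dnbhs0_lt.
    by rewrite mulr_gt0// invr_gt0 ltr0n fact_gt0.
  by split; [exact: (cvgP 0)|exact: cvg_lim].
Unshelve. all: by end_near.
Qed.

End bump.

(** * Compactly supported smooth functions *)

Section test_functions.
Context (R : realType) (n : nat).
Implicit Types (f g : 'rV[R]_n -> R) (D : set 'rV[R]_n).

Lemma smooth_coord (j : 'I_n) : smooth (fun x : 'rV[R]_n => x ord0 j).
Proof.
pose B f := exists j : 'I_n, f = (fun x : 'rV[R]_n => x ord0 j).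
apply: (@smooth_alg _ _ B); last by apply: alg_base; exists j.
move=> g [{}j ->]; split=> [|i]; first exact: coord_continuous.
have d (x : 'rV[R]_n) : is_derive x (delta_mx ord0 i) (fun x : 'rV[R]_n => x ord0 j) (i == j)%:R.
  have := @is_derive_coord R n i j id 1 0 1 x (is_derive_id _ _).
  rewrite !mulr1; congr is_derive; apply/funext => y /=; ring.
split=> [x|]; first by case: (d x).
rewrite (_ : partial i _ = fun=> (i == j)%:R); first exact: alg_cst.
by apply/funext => x; rewrite /partial derive_val.
Qed.

Lemma partial_coord (i j : 'I_n) :
  partial i (fun x : 'rV[R]_n => x ord0 j) = fun=> (i == j)%:R.
Proof.
apply/funext => x; rewrite /partial.
have := @is_derive_coord R n i j id 1 0 1 x (is_derive_id _ _).
rewrite (_ : (fun y : 'rV[R]_n => _) = (fun x => x ord0 j)); last by apply/funext => y /=; ring.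
by move=> [_ ->]; rewrite !mulr1.
Qed.

(** The generating family has to contain all orders [k], since differentiation raises the order by
    one or two. *)
Lemma smooth_bmp k c a (j : 'I_n) : smooth (fun x : 'rV[R]_n => bmp k (c * (x ord0 j - a))).
Proof.
pose B f := exists j k c a, f = (fun x : 'rV[R]_n => bmp k (c * (x ord0 j - a))).
apply: (@smooth_alg _ _ B); last by apply: alg_base; exists j, k, c, a.
move=> g [{}j [{}k [{}c [{}a ->]]]]; split=> [x|i].
  have cb (t : R) : {for t, continuous (bmp k)}.
    apply/differentiable_continuous/derivable1_diffP.
    by case: (is_derive_bmp k t).
  have cc : continuous (fun y : 'rV[R]_n => y ord0 j) by exact: coord_continuous.
  have cl : continuous (fun y : 'rV[R]_n => c * (y ord0 j - a)).
    move=> y; apply: (@continuousM _ _ (cst c) (fun y : 'rV[R]_n => y ord0 j - a)).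
      exact: cst_continuous.
    by apply: continuousB; [exact: cc|exact: cst_continuous].
  exact: (@continuous_comp _ _ _ (fun y : 'rV[R]_n => c * (y ord0 j - a)) (bmp k) x (cl x) (cb _)).
have d (x : 'rV[R]_n) := @is_derive_coord R n i j _ c a _ x (is_derive_bmp k _).
split=> [x|]; first by case: (d x).
rewrite (_ : partial i _ = fun x => ((i == j)%:R * c) *
    (bmp k.+2 (c * (x ord0 j - a)) + (- k%:R) * bmp k.+1 (c * (x ord0 j - a)))).
  apply: alg_mul; first exact: alg_cst.
  apply: alg_add; first by apply: alg_base; exists j, k.+2, c, a.
  by apply: alg_mul; [exact: alg_cst|apply: alg_base; exists j, k.+1, c, a].
by apply/funext => x; rewrite /partial; case: (d x) => _ ->; rewrite mulNr.
Qed.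

Lemma smooth_prod (I : finType) (F : I -> 'rV[R]_n -> R) :
  (forall i, smooth (F i)) -> smooth (fun x => \prod_i F i x).
Proof.
move=> sF; elim: (index_enum I) => [|i s ih].
  by under eq_fun do rewrite big_nil; exact: smooth_cst.
by under eq_fun do rewrite big_cons; exact: (smoothM (sF i) ih).
Qed.

(** Real-valued test functions. Some compact set outside which [f] vanishes replaces the closure of
    the support, so that sums and products are immediate; [test_funP] relates this to the complex
    test functions. *)
Definition ctest D f := smooth f /\
  exists K, [/\ compact K, K `<=` D & forall x, ~ K x -> f x = 0].

Lemma ctest_smooth D f : ctest D f -> smooth f. Proof. by case. Qed.

Lemma ctest_out D f x : ctest D f -> ~ D x -> f x = 0.
Proof. by move=> [_ [K [_ KD h]]] nD; apply: h => /KD. Qed.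

Lemma ctestD D f g : ctest D f -> ctest D g -> ctest D (fun x => f x + g x).
Proof.
move=> [sf [K [cK KD f0]]] [sg [L [cL LD g0]]]; split; first exact: smoothD.
exists (K `|` L); split; [exact: compactU|by rewrite subUset|move=> x nKL].
by rewrite f0 ?g0 ?addr0// => h; apply: nKL; [right|left].
Qed.

Lemma ctestM D f g : ctest D f -> smooth g -> ctest D (fun x => f x * g x).
Proof.
move=> [sf [K [cK KD f0]]] sg; split; first exact: smoothM.
by exists K; split=> // x /f0 ->; rewrite mul0r.
Qed.

Lemma ctestMl D f g : ctest D f -> smooth g -> ctest D (fun x => g x * f x).
Proof.
move=> cf sg; rewrite (_ : (fun _ => _) = fun x => f x * g x); first exact: ctestM.
by apply/funext => x; rewrite mulrC.
Qed.

Lemma ctestZ D c f : ctest D f -> ctest D (fun x => c * f x).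
Proof. by move=> cf; apply: ctestMl => //; exact: smooth_cst. Qed.

Lemma ctest0 D : ctest D (fun=> 0).
Proof.
split; first exact: smooth_cst.
by exists set0; split=> //; exact: compact0.
Qed.

Lemma ctest_partial D f i : ctest D f -> ctest D (partial i f).
Proof.
move=> [sf [K [cK KD f0]]]; split; first exact: smooth_partial.
exists K; split=> // x nK.
have oK : open (~` K) by rewrite openC; exact: compact_closed (@norm_hausdorff _ _) cK.
rewrite /partial (@near_eq_derive _ _ _ f (fun=> 0)) ?derive_cst//.
have : nbhs x (~` K) by exact: open_nbhs_nbhs.
by apply: filterS => y /f0.
Qed.

Lemma test_funP D (phi : 'rV[R]_n -> R[i]) : test_fun D phi <->
  ctest D (fun x => Re (phi x)) /\ ctest D (fun x => Im (phi x)).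
Proof.
split=> [[s1 s2 cp sD]|[[s1 [K [cK KD h1]]] [s2 [L [cL LD h2]]]]].
  have h x : ~ closure [set x | phi x != 0] x -> phi x = 0.
    move=> nx; apply: contrapT => /eqP px; apply: nx.
    exact: subset_closure.
  by split; split=> //; exists (closure [set x | phi x != 0]); split=> // x /h ->.
have cKL : compact (K `|` L) by exact: compactU.
have clKL : closed (K `|` L) by exact: compact_closed (@norm_hausdorff _ _) cKL.
have sub : closure [set x | phi x != 0] `<=` K `|` L.
  have -> : K `|` L = closure (K `|` L) by exact/closure_id.
  apply: closureS => x /= px.
  apply: contrapT => nKL; case/negP: px; apply/eqP.
  have : Re (phi x) = 0 by apply: h1 => Kx; apply: nKL; left.
  have : Im (phi x) = 0 by apply: h2 => Kx; apply: nKL; right.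
  by case: (phi x) => a b /= -> ->.
split=> //.
  by apply: subclosed_compact sub => //; exact: closed_closure.
by apply: subset_trans sub _; rewrite subUset.
Qed.

End test_functions.

(** * Integration by parts *)

Section one_variable.
Context (R : realType) (g dg : R -> R).
Hypotheses (gd : forall t, is_derive t (1 : R) g (dg t)) (cdg : continuous dg).
Local Notation mu := (@lebesgue_measure R).

Let cg : continuous g.
Proof.
by move=> t; apply/differentiable_continuous/derivable1_diffP; case: (gd t).
Qed.

Let mdg : measurable_fun [set: R] dg.
Proof. exact: continuous_measurable_fun. Qed.

Lemma integral_deriv a b : a <= b ->
  (\int[mu]_(x in `[a, b]) (dg x)%:E = (g b - g a)%:E)%E.
Proof.
rewrite le_eqVlt => /predU1P[->|ab].
  by rewrite set_itv1 integral_set1 subrr.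
rewrite EFinB; apply: continuous_FTC2 => //.
- exact: continuous_subspaceT.
- split; first by move=> x _; case: (gd x).
    exact/cvg_at_right_filter/cg.
  exact/cvg_at_left_filter/cg.
- by move=> x _; rewrite derive1E derive_val.
Qed.

Lemma le_integral_abs_deriv a b s t : s \in `[a, b] -> t \in `[a, b] ->
  ((`|g s - g t|)%:E <= \int[mu]_(x in `[a, b]) `|dg x|%:E)%E.
Proof.
wlog st : s t / s <= t.
  by move=> h si ti; have [/h|/ltW/h] := leP s t; [|rewrite distrC]; exact.
move=> si ti; rewrite distrC.
apply: (@le_trans _ _ (\int[mu]_(x in `[s, t]) `|dg x|%:E)%E).
  rewrite -abse_EFin -integral_deriv//; apply: le_abse_integral => //.
  by apply/measurable_EFinP; exact: measurable_funTS.
apply: ge0_subset_integral => //.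
  apply/measurable_EFinP; apply: measurableT_comp => //; exact: measurable_funTS.
by apply: subset_itvScc; rewrite bnd_simp; [move: si|move: ti]; rewrite in_itv/= => /andP[].
Qed.

Variable M : R.
Hypothesis g0 : forall t, M < `|t| -> g t = 0.

(** Nonnegative and larger than [M], whatever the sign of [M]. *)
Let N := `|M| + 1.
Let NN : - N <= N. Proof. by rewrite ge0_cp// /N addr_ge0. Qed.
Let MN t : t \notin `[(- N)%R, N] -> M < `|t|.
Proof.
rewrite in_itv/= -ler_norml -ltNge; apply: le_lt_trans.
by rewrite /N (le_trans (ler_norm M))// lerDl.
Qed.

Lemma le_integral_abs_derivT t : ((`|g t|)%:E <= \int[mu]_x `|dg x|%:E)%E.
Proof.
have [tN|tN] := boolP (t \in `[(- N)%R, N]); last first.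
  by rewrite g0 ?MN// normr0; exact: integral_ge0.
apply: (@le_trans _ _ (\int[mu]_(x in `[(- N)%R, N]) `|dg x|%:E)%E); last first.
  apply: ge0_subset_integral => //.
  by apply/measurable_EFinP; exact: measurableT_comp.
have gN : g N = 0 by apply: g0; rewrite /N ger0_norm ?addr_ge0// (le_lt_trans (ler_norm M))// ltrDl.
rewrite -[g t]subr0 -gN; apply: le_integral_abs_deriv => //.
by rewrite in_itv/= lexx NN.
Qed.

(** The integral of [dg] is zero because [g] vanishes at both ends. The splitting into positive and
    negative parts suits [le_integral_lines], which compares nonnegative functions. *)
Lemma integral_deriv_pos_neg :
  (\int[mu]_x (EFin \o dg)^\+ x = \int[mu]_x (EFin \o dg)^\- x)%E.
Proof.
have dg0 t : t \notin `[(- N)%R, N] -> dg t = 0.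
  move=> tN; rewrite -(@derive_val _ _ _ _ _ _ _ (gd t)).
  have oN : open (~` `[(- N)%R, N]) by rewrite openC; exact: itv_closed.
  rewrite (@near_eq_derive _ _ _ g (fun=> 0)) ?derive_cst//.
  have : nbhs t (~` `[(- N)%R, N]) by apply: open_nbhs_nbhs; split=> //=; exact/negP.
  by apply: filterS => y /negP/MN/g0.
have restr (h : R -> \bar R) : (forall t, t \notin `[(- N)%R, N] -> h t = 0) ->
    (\int[mu]_x h x = \int[mu]_(x in `[(- N)%R, N]) h x)%E.
  move=> h0; rewrite [RHS]integral_mkcond; apply: eq_integral => x _.
  by rewrite patchE; case: ifPn => //; rewrite notin_setE /= => /negP/h0.
have idg : mu.-integrable `[(- N)%R, N] (EFin \o dg).
  apply: continuous_compact_integrable; first exact: segment_compact.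
  exact: continuous_subspaceT.
rewrite !restr; last 2 first.
- by move=> t /dg0 d0; rewrite funenegE /= d0 ?oppe0 ?oppr0 ?maxxx.
- by move=> t /dg0 d0; rewrite funeposE /= d0 maxxx.
have := integral_deriv NN.
have gN s : `|s| = N -> g s = 0.
  by move=> sN; apply: g0; rewrite sN /N (le_lt_trans (ler_norm M))// ltrDl.
have N0 : 0 <= N by rewrite /N addr_ge0.
rewrite !gN ?normrN ?ger0_norm// subrr integralE => /eqP.
by rewrite sube_eq ?add0e => [/eqP//||]; [exact: integrable_pos_fin_num|rewrite fin_num_adde_defr//; exact: integrable_neg_fin_num].
Qed.

End one_variable.

(** * Integration by parts on a bounded domain; bumps on boxes *)

Section domain.
Context (R : realType) (n : nat) (D : set 'rV[R]_n).
Hypotheses (oD : open D) (bD : bounded_set D).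
Implicit Types f g : 'rV[R]_n -> R.

Lemma mD : measurable D. Proof. exact: open_measurable_rV. Qed.

Lemma leb_domain_lty : (leb D < +oo)%E.
Proof.
have [M _ DM] := bounded_cube bD.
apply: le_lt_trans (leb_cube_lty n M).
apply: le_measure => //; rewrite inE.
  exact: mD.
exact: measurable_cube.
Qed.

Lemma smooth_measurable f (A : set 'rV[R]_n) : smooth f -> measurable_fun A f.
Proof.
move=> sf; apply: measurable_funTS; apply: continuous_measurable_rV.
exact: smooth_continuous.
Qed.

Lemma ctest_bounded f : ctest D f -> exists C, forall x, `|f x| <= C.
Proof.
move=> [sf [K [cK KD f0]]].
have /compact_bounded[M [_ h]] : compact (f @` K).
  apply: continuous_compact => //; apply: continuous_subspaceT.
  exact: smooth_continuous.
exists (`|M| + 1) => x; have [Kx|/f0 ->] := pselect (K x); last first.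
  by rewrite normr0 addr_ge0.
apply: h; last by exists x.
by apply: le_lt_trans (ler_norm M) _; rewrite ltrDl.
Qed.

Lemma ctest_integrable f : ctest D f -> leb.-integrable D (EFin \o f).
Proof.
move=> tf; apply: measurable_bounded_integrable.
- exact: mD.
- exact: leb_domain_lty.
- exact: smooth_measurable (ctest_smooth tf).
- have [C hC] := ctest_bounded tf; exists C; split; first exact: num_real.
  by move=> y Cy x _; apply: le_trans (hC x) (ltW Cy).
Qed.

Lemma ctest_line f (i : 'I_n) x : ctest D f ->
  [/\ forall t, is_derive t (1:R) (fun s => f (upd i x s)) (partial i f (upd i x t)),
    continuous (fun s => partial i f (upd i x s)) &
    forall M, D `<=` cube n M -> forall t, M < `|t| -> f (upd i x t) = 0].
Proof.
move=> tf; have sf := ctest_smooth tf; split.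
- by move=> t; apply: is_derive_line; exact: smooth_derivable.
- move=> t; apply: (@continuous_comp _ _ _ (upd i x) (partial i f)).
    exact: continuous_upd.
  exact/smooth_continuous/smooth_partial.
- move=> M DM t Mt; apply: (ctest_out tf) => /DM /(_ i).
  by rewrite upd_coord leNgt Mt.
Qed.

(** On every line in direction [i] the positive and negative parts of the derivative have the same
    integral; comparing along lines in both directions transfers this equality to the whole
    space. *)
Lemma integral_partial0 f i : ctest D f -> \int[leb]_(x in D) partial i f x = 0.
Proof.
move=> tf; have [M _ DM] := bounded_cube bD.
have tpf := ctest_partial i tf.
have mp : measurable_fun [set: 'rV[R]_n] (EFin \o partial i f).
  by apply/measurable_EFinP; exact: smooth_measurable (ctest_smooth tpf).
rewrite Rintegral_mkcond (_ : _ \_ _ = partial i f); last first.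
  apply/funext => x; rewrite patchE; case: ifPn => //; rewrite notin_setE => nD.
  by rewrite (ctest_out tpf).
have pn h x t : (EFin \o (fun s : R => h (upd i x s : 'rV[R]_n)))^\+%E t = (EFin \o h)^\+%E (upd i x t).
  by rewrite !funeposE.
have nn h x t : (EFin \o (fun s : R => h (upd i x s : 'rV[R]_n)))^\-%E t = (EFin \o h)^\-%E (upd i x t).
  by rewrite !funenegE.
have e x : (\int[lebesgue_measure]_t (EFin \o partial i f)^\+ (upd i x t) =
            \int[lebesgue_measure]_t (EFin \o partial i f)^\- (upd i x t))%E.
  have [h1 h2 h3] := ctest_line i x tf.
  have := integral_deriv_pos_neg h1 h2 (h3 _ DM).
  by under eq_integral do rewrite pn; under [in RHS]eq_integral do rewrite nn.
have {}e : (\int[leb]_t (EFin \o partial i f)^\+ t =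
            \int[leb]_t (EFin \o partial i f)^\- t)%E.
  apply/eqP; rewrite eq_le; apply/andP; split; apply: (le_integral_lines (i := i)) => //.
  - exact: measurable_funepos.
  - exact: measurable_funeneg.
  - by move=> x; rewrite e.
  - exact: measurable_funeneg.
  - exact: measurable_funepos.
  - by move=> x; rewrite e.
(* Were the common value infinite, the difference would be -oo, whose [fine] is 0. *)
rewrite /Rintegral integralE e; case: (integral _ _ _) => //= r.
by rewrite subrr.
Qed.

Lemma integral_by_parts f g i : smooth f -> ctest D g ->
  \int[leb]_(x in D) (f x * partial i g x) = - \int[leb]_(x in D) (partial i f x * g x).
Proof.
move=> sf tg; have sg := ctest_smooth tg.
apply/eqP; rewrite -addr_eq0; apply/eqP.
rewrite -(integral_partial0 i (ctestMl tg sf)) partialM// -RintegralD.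
- by apply: eq_Rintegral => x _; rewrite [g x * _]mulrC.
- exact: mD.
- exact: ctest_integrable (ctestMl (ctest_partial i tg) sf).
- exact: ctest_integrable (ctestMl tg (smooth_partial i sf)).
Qed.

Definition obox (a b : 'rV[R]_n) : set 'rV[R]_n :=
  [set y | forall i, a ord0 i < y ord0 i < b ord0 i].
Definition cbox (a b : 'rV[R]_n) : set 'rV[R]_n :=
  [set y | forall i, a ord0 i <= y ord0 i <= b ord0 i].

Lemma measurable_obox a b : measurable (obox a b).
Proof.
have -> : obox a b = \bigcap_(i in [set: 'I_n])
    ((fun x : 'rV[R]_n => x ord0 i) @^-1` `]a ord0 i, b ord0 i[).
  apply/seteqP; split=> x /= h i; first by move=> _; rewrite /= in_itv/=.
  by have := h i I; rewrite /= in_itv/=.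
apply: fin_bigcap_measurable => // i _.
by rewrite -[X in measurable X]setTI; exact: measurable_coord.
Qed.

(** Smooth approximation of the indicator of [obox a b]: inside the box a factor is
    exp(-1/((k+1)s)), with [s] the distance to a face, and tends to 1 as [k] grows. *)
Definition tbump (a b : 'rV[R]_n) (k : nat) (x : 'rV[R]_n) : R :=
  \prod_i (bmp 0 (k.+1%:R * (x ord0 i - a ord0 i)) *
           bmp 0 (- k.+1%:R * (x ord0 i - b ord0 i))).

Lemma bmp0_le1 (t : R) : bmp 0 t <= 1.
Proof.
rewrite /bmp; case: ifP => // t0; rewrite expr0 mul1r -[leRHS]expR0 ler_expR.
by rewrite oppr_le0 invr_ge0 ltW.
Qed.

Lemma bump_ge0_le1 a b k x : 0 <= tbump a b k x <= 1.
Proof.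
rewrite /tbump prodr_ge0 => [|i _]; last by rewrite mulr_ge0// bmp_ge0.
apply: prodr_ile1 => i _; rewrite mulr_ge0 ?bmp_ge0//=.
by rewrite mulr_ile1 ?bmp_ge0// bmp0_le1.
Qed.

Lemma bump_out a b k x : ~ obox a b x -> tbump a b k x = 0.
Proof.
move=> /existsNP[i /negP]; rewrite negb_and -!leNgt => h.
rewrite /tbump (bigD1 i)//=; case/orP: h => h.
  by rewrite bmp_le0 ?mul0r// pmulr_rle0// subr_le0.
by rewrite [X in _ * X * _]bmp_le0 ?mulr0 ?mul0r// mulNr oppr_le0 pmulr_rge0// subr_ge0.
Qed.

Lemma ctest_bump a b k : cbox a b `<=` D -> ctest D (tbump a b k).
Proof.
move=> abD; split.
  by apply: smooth_prod => i; apply: smoothM; exact: smooth_bmp.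
exists (cbox a b); split=> // [|x nab].
  have -> : cbox a b = [set v : 'rV[R]_n | forall i, `[a ord0 i, b ord0 i]%classic (v ord0 i)].
    by apply/seteqP; split=> x /= h i; have := h i; rewrite /= in_itv.
  apply: (@rV_compact R n (fun i => `[a ord0 i, b ord0 i]%classic)) => i.
  exact: segment_compact.
apply: bump_out => ab; apply: nab => i.
by have /andP[/ltW -> /ltW ->] := ab i.
Qed.

Lemma cvg_bmp0 (s : R) : 0 < s -> bmp 0 (k.+1%:R * s) @[k --> \oo] --> (1 : R).
Proof.
move=> s0.
have -> : (fun k : nat => bmp 0 (k.+1%:R * s)) = (fun k : nat => expR (- (s^-1 * k.+1%:R^-1))).
  by apply/funext => k; rewrite /bmp pmulr_rgt0// s0 expr0 mul1r invfM mulrC.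
have h : (s^-1 * k.+1%:R^-1) @[k --> \oo] --> s^-1 * 0.
  by apply: cvgM; [exact: cvg_cst|exact: (@cvg_harmonic R)].
have {h} h : (- (s^-1 * k.+1%:R^-1)) @[k --> \oo] --> (0 : R).
  by move: h => /cvgN; rewrite mulr0 oppr0.
have := continuous_cvg _ (@continuous_expR R 0) h; rewrite expR0; exact.
Qed.

Lemma cvg_bump a b x : tbump a b k x @[k --> \oo] --> (\1_(obox a b) x : R).
Proof.
have [ab|nab] := pselect (obox a b x); last first.
  rewrite indicE memNset//.
  by under eq_fun do rewrite bump_out//; exact: cvg_cst.
rewrite indicE mem_set//= /tbump.
elim: (index_enum _) => [|i s ih].
  by under eq_fun do rewrite big_nil; exact: cvg_cst.
under eq_fun do rewrite big_cons.
rewrite -[1%:R]mulr1; apply: cvgM ih.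
rewrite -[1%:R]mulr1; have /andP[h1 h2] := ab i; apply: cvgM.
  by apply: cvg_bmp0; rewrite subr_gt0.
under eq_fun do rewrite mulNr -mulrN opprB.
by apply: cvg_bmp0; rewrite subr_gt0.
Qed.

(** The sigma-algebra is defined through coordinates. Boxes form a generating family stable under
    intersection, as [dynkin_induction] requires. *)
Lemma rV_borel_boxes :
  @measurable _ 'rV[R]_n = <<s [set A | exists a b, A = obox a b] >>.
Proof.
apply/seteqP; split; last first.
  apply: smallest_sub; first exact: sigma_algebra_measurable.
  by move=> _ [a [b ->]]; exact: measurable_obox.
pose T := g_sigma_algebraType [set A : set 'rV[R]_n | exists a b, A = obox a b].
apply: smallest_sub; first exact: smallest_sigma_algebra.
rewrite -bigcup_seq => _ /= [i _] [Y mY <-]; rewrite setTI.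
suff : measurable_fun [set: T] (fun x : T => (x : 'rV[R]_n) ord0 i).
  by move=> /(_ measurableT Y mY); rewrite setTI.
apply: (measurability _ (RGenOpens.measurableE R)).
move=> _ [_ [a [b ->] <-]]; rewrite setTI.
(* A slab is exhausted by boxes whose other sides are ]-k, k[. *)
have -> : (fun x : 'rV[R]_n => x ord0 i) @^-1` `]a, b[ = \bigcup_k
    obox (\row_j (if j == i then a else - k%:R)) (\row_j (if j == i then b else k%:R)).
  apply/seteqP; split=> [x|x [k _ /(_ i)]]; last by rewrite /= !mxE eqxx in_itv.
  rewrite /= in_itv/= => xab.
  exists (Num.truncn (\sum_j `|x ord0 j|)).+1 => // j; rewrite !mxE.
  case: eqVneq => [->//|_]; rewrite -ltr_norml.
  by apply: le_lt_trans (truncnS_gt _); rewrite (bigD1 j)//= lerDl sumr_ge0.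
apply: bigcupT_measurable => k; apply: sub_sigma_algebra.
by eexists; eexists.
Qed.

End domain.

(** * The fundamental lemma of the calculus of variations *)

Section fundamental_lemma.
Context (R : realType) (n : nat) (D : set 'rV[R]_n).
Hypotheses (oD : open D) (bD : bounded_set D).
Variable f : 'rV[R]_n -> R.
Hypothesis fi : leb.-integrable D (EFin \o f).
Hypothesis f0 : forall phi, ctest D phi -> \int[leb]_(x in D) (f x * phi x) = 0.
Let mD := mD oD.

Let mf : measurable_fun D f.
Proof. by apply/measurable_EFinP; exact: measurable_int fi. Qed.

(** Dominated convergence along the bumps [tbump a b k], with [|f|] as dominating function. *)
Let box0 a b : cbox a b `<=` D -> (\int[leb]_(x in obox a b) (f x)%:E = 0)%E.
Proof.
move=> abD.
have oab : obox a b `<=` D.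
  apply: subset_trans abD => x h i.
  by have /andP[/ltW -> /ltW ->] := h i.
have sb k : smooth (tbump a b k) := ctest_smooth (ctest_bump k abD).
have mfb k : measurable_fun D (EFin \o (fun x => f x * tbump a b k x)).
  by apply/measurable_EFinP; apply: measurable_funM => //; exact: smooth_measurable.
have fb k : leb.-integrable D (EFin \o (fun x => f x * tbump a b k x)).
  apply: (le_integrable _ _ _ fi) => //= x Dx.
  have /andP[b0 b1] := bump_ge0_le1 a b k x.
  by rewrite lee_fin normrM (ger0_norm b0) ler_piMr.
have int0 k : (\int[leb]_(x in D) (f x * tbump a b k x)%:E = 0)%E.
  rewrite -(fineK (integrable_fin_num mD (fb k))); congr (_%:E).
  exact: f0 (ctest_bump k abD).
have /= := @dominated_cvg _ _ R leb D mD
  (fun k x => (f x * tbump a b k x)%:E) (fun x => (f x * \1_(obox a b) x)%:E)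
  (fun x => `|f x|%:E) mfb.
have -> : (fun k => \int[leb]_(x in D) (f x * tbump a b k x)%:E)%E = fun=> 0%E.
  by apply/funext => k; rewrite int0.
move=> h.
have {h} : (cst 0%E : nat -> \bar R) @ \oo --> (\int[leb]_(x in D) (f x * \1_(obox a b) x)%:E)%E.
  apply: h.
  - move=> x _; apply: cvg_EFin; first exact: nearW.
    by apply: cvgM; [exact: cvg_cst|exact: cvg_bump].
  - by [].
  - exact: integrable_norm.
  - move=> k x _; rewrite lee_fin.
    have /andP[b0 b1] := bump_ge0_le1 a b k x.
    by rewrite normrM (ger0_norm b0) ler_piMr.
move=> /(cvg_unique _ (@cvg_cst _ 0%E _ _ _)) h.
rewrite -(setIidr oab) integral_mkcondr [RHS]h//; apply: eq_integral => x _.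
by rewrite patchE indicE; case: (_ \in _); rewrite ?mulr1 ?mulr0.
Qed.

(** The integrals over boxes inside [obox p q] vanish, and a Dynkin argument extends this to all
    measurable subsets, so [f] is zero almost everywhere there. *)
Let inner0 p q : cbox p q `<=` D -> {ae leb, forall x, obox p q x -> f x = 0}.
Proof.
move=> pqD.
have mpq := measurable_obox p q.
have opq : obox p q `<=` D.
  apply: subset_trans pqD => x h i.
  by have /andP[/ltW -> /ltW ->] := h i.
have ifpq : leb.-integrable (obox p q) (EFin \o f) by exact: integrableS fi.
have all0 : forall A, measurable A -> (\int[leb]_(x in obox p q `&` A) (f x)%:E = 0)%E.
  rewrite rV_borel_boxes; apply: dynkin_induction.
  - exact: rV_borel_boxes.
  - move=> _ _ [a [b ->]] [c [d ->]].
    exists (\row_i Num.max (a ord0 i) (c ord0 i)), (\row_i Num.min (b ord0 i) (d ord0 i)).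
    apply/seteqP; split=> x /=.
      move=> [h1 h2] i; rewrite !mxE gt_max lt_min.
      by have /andP[-> ->] := h1 i; have /andP[-> ->] := h2 i.
    by move=> h; split=> i; have := h i; rewrite !mxE gt_max lt_min => /andP[/andP[h1 h2] /andP[h3 h4]]; apply/andP.
  - by rewrite setIT; exact: box0.
  - move=> _ [a [b ->]].
    have -> : obox p q `&` obox a b =
        obox (\row_i Num.max (p ord0 i) (a ord0 i)) (\row_i Num.min (q ord0 i) (b ord0 i)).
      apply/seteqP; split=> x /=.
        move=> [h1 h2] i; rewrite !mxE gt_max lt_min.
        by have /andP[-> ->] := h1 i; have /andP[-> ->] := h2 i.
      by move=> h; split=> i; have := h i; rewrite !mxE gt_max lt_min => /andP[/andP[h1 h2] /andP[h3 h4]]; apply/andP.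
    apply: box0; apply: subset_trans pqD => x /= h i; have := h i.
    by rewrite !mxE ge_max le_min => /andP[/andP[-> _] /andP[-> _]].
  - move=> S mS S0.
    have : (\int[leb]_(x in obox p q) (f x)%:E = 0)%E by exact: box0.
    rewrite -{1}(setIT (obox p q)) -(setUv S) setIUr integral_setU//.
    + by rewrite S0 add0e.
    + exact: measurableI.
    + by apply: measurableI => //; exact: measurableC.
    + rewrite -setIUr setUv setIT; exact: measurable_int ifpq.
    + by apply/disj_setPS => x /= [[_ Sx] [_]].
  - move=> F mF tF F0; rewrite setI_bigcupr integral_bigcup.
    + by apply: eseries0 => k _ _; rewrite F0.
    + exact: trivIset_setIl.
    + by move=> k; exact: measurableI.
    + by rewrite -setI_bigcupr; apply: integrableS ifpq => //; apply: measurableI => //; exact: bigcup_measurable.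
have := @integral_ae_eq _ _ R leb (obox p q) mpq (cst 0%E) (EFin \o f) ifpq.
move=> /(_ (@measurable_cst _ _ _ _ _ _)) h.
have {h} : ae_eq leb (obox p q) (EFin \o f) (cst 0%E).
  apply: h => E Epq mE; rewrite -(setIidr Epq) all0//.
  by rewrite integral0.
by apply: filterS => x h /h[].
Qed.

(** Countably many rational boxes with closure in [D] cover [D], so the exceptional null sets can be
    united. *)
Lemma fundamental_lemma : {ae leb, forall x, D x -> f x = 0}.
Proof.
pose P (p : 'rV[rat]_n * nat) := `[< closed_ball (ratv R p.1 : 'rV[R]_n) (p.2.+1%:R^-1) `<=` D >].
have h (p : 'rV[rat]_n * nat) : P p ->
    {ae leb, forall x, box (ratv R p.1 : 'rV[R]_n) (p.2.+1%:R^-1) x -> f x = 0}.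
  move=> /asboolP pD; set r := p.2.+1%:R^-1 in pD *; set c := ratv _ _ in pD *.
  have r0 : 0 < r by rewrite invr_gt0.
  have := @inner0 (\row_i (c ord0 i - r)) (\row_i (c ord0 i + r)).
  have sub : cbox (\row_i (c ord0 i - r)) (\row_i (c ord0 i + r)) `<=` D.
    apply: subset_trans pD => x h; rewrite closed_ballE//.
    rewrite /closed_ball_ /= /Num.norm/= mx_normrE; apply/bigmax_leP; split; first exact: ltW.
    move=> [i j] _ /=; rewrite (ord1 i) !mxE.
    by have := h j; rewrite !mxE distrC ler_norml; lra.
  move=> /(_ sub); apply: filterS => x hx bx; apply: hx => i.
  by have := bx i; rewrite !mxE ltr_norml; lra.
(* The boxes are numbered through [pickle], so that the countable family of almost-everywhere
   statements can be merged by [ae_foralln]. *)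
have {h} h k : {ae leb, forall x, forall p : 'rV[rat]_n * nat, unpickle k = Some p -> P p ->
    box (ratv R p.1 : 'rV[R]_n) (p.2.+1%:R^-1) x -> f x = 0}.
  case: (unpickle k) => [p|]; last exact: aeW.
  have [Pp|nP] := boolP (P p); last by apply: aeW => x q [<-]; rewrite (negbTE nP).
  by have := h p Pp; apply: filterS => x hx q [<-] _.
have := ae_foralln h; apply: filterS => x hx Dx.
have := Dx; rewrite {1}(open_bigcup_box oD) => -[p /= pD bx].
apply: (hx (pickle p) p) => //; first by rewrite pickleK.
exact/asboolP.
Qed.

End fundamental_lemma.

(** * Semi-inner products *)

Section semi_inner_product.
Context (R : realType) (T : Type) (H : set T).
Variables (lin : R -> T -> T -> T) (a : T -> T -> R).
Hypotheses (linH : forall c u v, H u -> H v -> H (lin c u v))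
  (aC : forall u v, H u -> H v -> a u v = a v u)
  (alin : forall c u v w, H u -> H v -> H w -> a (lin c u v) w = a u w + c * a v w)
  (a_ge0 : forall u, H u -> 0 <= a u u).

Let nrm u := Num.sqrt (a u u).

Lemma sip_linr c u v w : H u -> H v -> H w -> a w (lin c u v) = a w u + c * a w v.
Proof. by move=> hu hv hw; rewrite aC ?alin//; [rewrite !(aC hw)|exact: linH]. Qed.

Lemma sip_sqr c u v : H u -> H v ->
  a (lin c u v) (lin c u v) = a u u + 2 * c * a u v + c ^+ 2 * a v v.
Proof.
move=> hu hv; rewrite alin ?sip_linr//; last exact: linH.
by rewrite (aC hv hu); ring.
Qed.

Lemma sip_nrm_sqr u : H u -> nrm u ^+ 2 = a u u.
Proof. by move=> hu; rewrite sqr_sqrtr// a_ge0. Qed.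

Lemma sip_cauchy_schwarz u v : H u -> H v -> `|a u v| <= nrm u * nrm v.
Proof.
move=> hu hv; rewrite -sqrtrM ?a_ge0// -sqrtr_sqr ler_sqrt ?mulr_ge0 ?a_ge0//.
have pos c : 0 <= a u u + 2 * c * a u v + c ^+ 2 * a v v.
  by rewrite -sip_sqr// a_ge0//; exact: linH.
have := a_ge0 hv; rewrite le_eqVlt => /predU1P[vv0|vv0].
  have [->|uv0] := eqVneq (a u v) 0; first by rewrite expr0n/= -vv0 mulr0.
  (* For [a v v = 0] the polynomial is affine in [c]; this [c] would give it the value -1. *)
  have := pos (- (a u u + 1) / (2 * a u v)); rewrite -vv0 mulr0 addr0.
  have -> : 2 * (- (a u u + 1) / (2 * a u v)) * a u v = - (a u u + 1) by field.
  by lra.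
have := pos (- a u v / a v v).
have -> : a u u + 2 * (- a u v / a v v) * a u v + (- a u v / a v v) ^+ 2 * a v v
   = (a u u * a v v - a u v ^+ 2) / a v v by field; rewrite gt_eqF.
by rewrite pmulr_lge0 ?invr_gt0// subr_ge0.
Qed.

Lemma sip_nrm_lin c u v : H u -> H v -> nrm (lin c u v) <= nrm u + `|c| * nrm v.
Proof.
move=> hu hv; rewrite -(@ler_pXn2r _ 2)// ?nnegrE ?sqrtr_ge0 ?addr_ge0 ?mulr_ge0 ?sqrtr_ge0//.
rewrite sip_nrm_sqr; last exact: linH.
rewrite sip_sqr// sqrrD exprMn real_normK ?num_real// !sip_nrm_sqr//.
rewrite lerD2r lerD2l.
suff : c * a u v <= nrm u * (`|c| * nrm v) by lra.
apply: le_trans (ler_norm _) _; rewrite normrM mulrCA ler_wpM2l//.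
exact: sip_cauchy_schwarz.
Qed.

Definition sip_complete := forall u : nat -> T, (forall k, H (u k)) ->
  (forall e, 0 < e -> exists N, forall p q, (N <= p)%N -> (N <= q)%N ->
     nrm (lin (-1) (u p) (u q)) <= e) ->
  exists2 v, H v & forall e, 0 < e -> exists N, forall p, (N <= p)%N ->
     nrm (lin (-1) (u p) v) <= e.

(* Riesz: a minimizing sequence of [1/2 a u u - F u] is Cauchy by the
   parallelogram identity. *)
Lemma sip_riesz (F : T -> R) C z : sip_complete -> H z ->
  (forall c u v, H u -> H v -> F (lin c u v) = F u + c * F v) ->
  (forall u, H u -> `|F u| <= C * nrm u) ->
  exists2 g, H g & forall h, H h -> a g h = F h.
Proof.
move=> cH Hz Flin FC; pose J u := a u u / 2 - F u.
pose S := [set J u | u in H].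
have J_ge u : H u -> - (C ^+ 2 / 2) <= J u.
  move=> hu; rewrite /J -sip_nrm_sqr//.
  have : F u <= C * nrm u by apply: le_trans (ler_norm _) (FC _ hu).
  have : 0 <= (nrm u - C) ^+ 2 by exact: sqr_ge0.
  by rewrite sqrrB; lra.
have hS : has_inf S.
  split; first by exists (J z), z.
  by exists (- (C ^+ 2 / 2)) => _ [u hu <-]; exact: J_ge.
pose m := inf S.
have m_le u : H u -> m <= J u by move=> hu; apply: ge_inf; [exact: hS.2|exists u].
have ex k : exists u, H u /\ J u <= m + k.+1%:R^-1.
  have k0 : 0 < k.+1%:R^-1 :> R by rewrite invr_gt0.
  have [_ [u hu <-] ltu] := inf_adherent k0 hS.
  by exists u; split=> //; exact: ltW.
have [u hu] := choice ex.
have Hu k : H (u k) by have [] := hu k.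
have Ju k : J (u k) <= m + k.+1%:R^-1 by have [] := hu k.
have J_lin c x y : H x -> H y ->
    J (lin c x y) = J x + c * (a x y - F y) + c ^+ 2 / 2 * a y y.
  by move=> hx hy; rewrite /J sip_sqr// Flin//; field.
(* [J] is at least [m] at the midpoint of [u p] and [u q], while its values at both ends are close
   to [m]. *)
have dist p q : a (lin (-1) (u p) (u q)) (lin (-1) (u p) (u q)) <=
    4 * (p.+1%:R^-1 + q.+1%:R^-1).
  set d := lin _ _ _; have hd : H d by exact: linH.
  have := m_le _ (linH (1 / 2) (Hu q) hd); rewrite J_lin//.
  have := Ju p; have := Ju q.
  have -> : J (u p) = J (u q) + (a (u q) d - F d) + a d d / 2.
    rewrite /J /d Flin// sip_sqr// sip_linr// (aC (Hu q) (Hu p)).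
    by field.
  move: (p.+1%:R^-1) (q.+1%:R^-1) (J (u q)) (a d d) (a (u q) d - F d) => ip iq Jq dd X.
  by lra.
have [g hg gu] : exists2 v, H v & forall e, 0 < e -> exists N, forall p, (N <= p)%N ->
     nrm (lin (-1) (u p) v) <= e.
  apply: cH => // e e0.
  (* From this rank on both inverses are at most [e^2 / 8], so [dist] bounds the squared norm by
     [e^2]. *)
  exists (Num.truncn (e ^+ 2 / 8)^-1) => p q Np Nq.
  rewrite -[leRHS]gtr0_norm// -sqrtr_sqr ler_sqrt ?sqr_ge0//.
  apply: le_trans (dist p q) _.
  have inv k : (Num.truncn (e ^+ 2 / 8)^-1 <= k)%N -> k.+1%:R^-1 <= e ^+ 2 / 8.
    move=> hk; rewrite invf_ple ?posrE ?ltr0n ?divr_gt0 ?exprn_gt0//.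
    by apply: le_trans (ltW (truncnS_gt _)) _; rewrite ler_nat ltnS.
  have := inv _ Np; have := inv _ Nq.
  by move: (p.+1%:R^-1) (q.+1%:R^-1) (e ^+ 2) => *; lra.
exists g => // h hh.
(* Near-minimality of [u k] in the direction [h] passes to the limit: replacing [J (u k)] by [m] and
   [u k] by [g] costs [e / 2] each. *)
have key t : 0 <= t * (a g h - F h) + t ^+ 2 / 2 * a h h.
  apply/ler_addgt0Pl => e e0.
  have th0 : 0 < `|t| * nrm h + 1 by rewrite ltr_wpDl// mulr_ge0// sqrtr_ge0.
  have e2 : 0 < e / 2 / (`|t| * nrm h + 1) by rewrite !divr_gt0.
  have [N hN] := gu _ e2.
  pose k := maxn N (Num.truncn (e / 2)^-1).
  have k1 : k.+1%:R^-1 <= e / 2.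
    rewrite invf_ple ?posrE ?ltr0n ?divr_gt0//.
    by apply: le_trans (ltW (truncnS_gt _)) _; rewrite ler_nat ltnS leq_maxr.
  have := m_le _ (linH t (Hu k) hh); rewrite J_lin// => h1.
  have := Ju k => h2.
  have h3 : t * (a (u k) h - a g h) <= e / 2.
    have -> : a (u k) h - a g h = a (lin (-1) (u k) g) h by rewrite alin// mulN1r.
    apply: le_trans (ler_norm _) _; rewrite normrM.
    apply: (@le_trans _ _ (`|t| * (nrm (lin (-1) (u k) g) * nrm h))).
      by rewrite ler_wpM2l// sip_cauchy_schwarz//; exact: linH.
    rewrite mulrCA; apply: (@le_trans _ _ (nrm (lin (-1) (u k) g) * (`|t| * nrm h + 1))).
      by rewrite ler_wpM2l ?sqrtr_ge0// lerDl.
    by rewrite -ler_pdivlMr//; apply: hN; rewrite leq_maxl.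
  by move: h1 h2 h3 k1; move: (k.+1%:R^-1) (t ^+ 2) => *; lra.
set b := a g h - F h in key.
have := a_ge0 hh => q0.
(* The vertex of the parabola is at [- b / a h h]; the added 1 avoids a division by zero and the
   inequality still forces [b = 0]. *)
have := key (- b / (a h h + 1)).
have q1 : 0 < a h h + 1 by lra.
have -> : - b / (a h h + 1) * b + (- b / (a h h + 1)) ^+ 2 / 2 * a h h =
   - (b ^+ 2 * (a h h + 2) / (2 * (a h h + 1) ^+ 2)) by field; rewrite gt_eqF.
rewrite oppr_ge0 => h1.
have : b ^+ 2 * (a h h + 2) / (2 * (a h h + 1) ^+ 2) == 0.
  rewrite eq_le h1/= divr_ge0 ?(mulr_ge0 _ (sqr_ge0 _))//.
  by rewrite mulr_ge0 ?sqr_ge0//; lra.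
have q2 : (a h h + 2) / (2 * (a h h + 1) ^+ 2) != 0.
  by rewrite gt_eqF// divr_gt0 ?mulr_gt0 ?exprn_gt0//; lra.
rewrite -mulrA mulf_eq0 (negbTE q2) orbF expf_eq0/= subr_eq0.
by move/eqP.
Qed.

End semi_inner_product.

(** * Square-integrable functions *)

Section L2_completeness.
Context d (T : measurableType d) (R : realType).
Variables (mu : {measure set T -> \bar R}) (D : set T) (mD : measurable D).
Local Open Scope ereal_scope.

Lemma fatou_bound (F : (T -> \bar R)^nat) (G : T -> \bar R) c :
  (forall n, measurable_fun D (F n)) -> measurable_fun D G ->
  (forall n x, D x -> 0 <= F n x) -> (forall x, D x -> 0 <= G x) ->
  {ae mu, forall x, D x -> F ^~ x @ \oo --> G x} ->
  (forall n, \int[mu]_(x in D) F n x <= c) -> \int[mu]_(x in D) G x <= c.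
Proof.
move=> mF mG F0 G0 FG Fc.
have ml : measurable_fun D (fun x => limn_einf (F ^~ x)).
  apply: measurableT_comp => //.
  by apply: (@measurable_fun_limn_esup _ _ _ _ (fun n x => - F n x)) => n; exact: measurableT_comp.
have l0 x : D x -> 0 <= limn_einf (F ^~ x).
  move=> Dx; rewrite limn_einf_lim; apply: lime_ge; first exact: is_cvg_einfs.
  apply: nearW => n; apply: le_ereal_inf_tmp => _ [k /= _ <-]; exact: F0.
rewrite (@ge0_ae_eq_integral _ _ _ mu D _ (fun x => limn_einf (F ^~ x)))//; last first.
  by apply: filterS FG => x h /h /cvg_limn_einf_sup[-> _].
apply: le_trans (fatou mu mD mF F0) _.
rewrite limn_einf_lim; apply: lime_le; first exact: is_cvg_einfs.
apply: nearW => n; apply: le_trans (Fc n).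
by apply: ereal_inf_lbound; exists n => /=.
Qed.

(** After multiplication by 4^j the integrals still have a finite sum, so the series of weighted
    squares is finite almost everywhere and bounds each of its terms. *)
Lemma fast_decay_ae (h : nat -> T -> R) : (forall j, measurable_fun D (h j)) ->
  (forall j, \int[mu]_(x in D) (h j x ^+ 2)%:E <= ((1 / 8) ^+ j)%:E) ->
  {ae mu, forall x, D x -> exists C, forall j, (h j x ^+ 2 <= C * (1 / 4) ^+ j)%R}.
Proof.
move=> mh hj; pose F j x := (4 ^+ j * h j x ^+ 2)%:E : \bar R.
have mh2 j : measurable_fun D (fun x => (h j x ^+ 2)%:E).
  by apply/measurable_EFinP; exact: measurable_funX.
have mF j : measurable_fun D (F j).
  by apply/measurable_EFinP; apply: measurable_funM => //; exact: measurable_funX.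
have F0 j x : D x -> 0 <= F j x.
  by move=> _; rewrite /F lee_fin mulr_ge0 ?sqr_ge0 ?exprn_ge0.
have S_fin : \int[mu]_(x in D) (\sum_(j <oo) F j x) < +oo.
  rewrite integral_nneseries//.
  apply: (@le_lt_trans _ _ (\sum_(j <oo) (2 / (2 ^ (j + 1))%:R)%:E)).
    apply: lee_nneseries => [j _ _|j _]; first by apply: integral_ge0 => x; exact: F0.
    rewrite /F; under eq_integral do rewrite EFinM.
    rewrite ge0_integralZl_EFin ?exprn_ge0//; last by move=> x _; rewrite lee_fin sqr_ge0.
    apply: le_trans (lee_wpmul2l _ (hj j)) _; first by rewrite lee_fin exprn_ge0.
    have -> : (2 / (2 ^ (j + 1))%:R = (1 / 2) ^+ j :> R)%R.
      by rewrite addn1 natrX exprS div1r exprVn; field; rewrite expf_neq0.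
    rewrite -EFinM lee_fin -exprMn lerXn2r ?nnegrE//; lra.
  have /cvg_lim -> // := @cvg_geometric_eseries_half R 2 0.
  by rewrite ltry.
have : mu.-integrable D (fun x => \sum_(j <oo) F j x).
  apply/integrableP; split; first by apply: ge0_emeasurable_sum => // j x Dx _; exact: F0.
  apply: le_lt_trans S_fin; rewrite le_eqVlt; apply/orP; left; apply/eqP.
  apply: eq_integral => x /[1!inE] Dx; rewrite gee0_abs//.
  by apply: nneseries_ge0 => j _ _; exact: F0.
move=> /(integrable_ae mD); apply: filterS => x h0 Dx; have {}h0 := h0 Dx.
exists (fine (\sum_(j <oo) F j x)) => j.
have : F j x <= \sum_(j <oo) F j x.
  apply: le_trans (nneseries_lim_ge j.+1 _); last by move=> *; exact: F0.
  by rewrite big_nat_recr//= leeDr//; apply: sume_ge0 => *; exact: F0.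
rewrite -(fineK h0) /F lee_fin => h1.
by rewrite div1r exprVn ler_pdivlMr ?exprn_gt0// mulrC.
Qed.

(** The increments are at most sqrt(C) / 2^j, so the telescoping series converges absolutely. *)
Lemma cvg_fast (s : nat -> R) (C : R) :
  (forall j, (s j.+1 - s j) ^+ 2 <= C * (1 / 4) ^+ j)%R -> cvgn s.
Proof.
move=> h; pose K := Num.sqrt C.
have tb j : (`|telescope s j| <= K * (1 / 2) ^+ j)%R.
  have e4 : ((1 / 4) ^+ j = ((1 / 2) ^+ j) ^+ 2 :> R)%R.
    by rewrite exprAC; congr (_ ^+ _)%R; field.
  have C0 : (0 <= C)%R.
    have := h j; have p : (0 < (1 / 4) ^+ j :> R)%R by rewrite exprn_gt0.
    by move=> /(le_trans (sqr_ge0 _)); rewrite pmulr_lge0.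
  rewrite -(@ler_pXn2r _ 2)// ?nnegrE ?mulr_ge0 ?sqrtr_ge0 ?exprn_ge0//.
  by rewrite real_normK ?num_real// exprMn sqr_sqrtr// -e4; exact: h.
have : cvgn (series (telescope s)).
  apply: normed_cvg; apply: (@series_le_cvg _ _ (geometric K (1 / 2)%R)) => [j|j|j|].
  - exact: normr_ge0.
  - by rewrite /geometric/= (le_trans (normr_ge0 _) (tb j)).
  - exact: tb.
  by apply: is_cvg_geometric_series; rewrite ger0_norm; lra.
rewrite telescopeK => hc.
have -> : s = (fun j => (s j - s 0%N) + s 0%N)%R by apply/funext => j; rewrite subrK.
by apply: is_cvgD => //; exact: is_cvg_cst.
Qed.

(** The Riesz-Fischer argument: a subsequence with rapidly decaying increments converges almost
    everywhere, and Fatou's lemma turns the Cauchy condition into convergence of the whole sequence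
    to that limit. *)
Lemma L2_complete_real (f : nat -> T -> R) : (forall k, measurable_fun D (f k)) ->
  (forall e : R, (0 < e)%R -> exists N, forall p q, (N <= p)%N -> (N <= q)%N ->
     \int[mu]_(x in D) ((f p x - f q x) ^+ 2)%:E <= e%:E) ->
  exists2 g : T -> R, measurable_fun D g & forall e : R, (0 < e)%R -> exists N, forall p, (N <= p)%N ->
     \int[mu]_(x in D) ((f p x - g x) ^+ 2)%:E <= e%:E.
Proof.
move=> mf cf.
have [N hN] := choice (fun j => cf ((1 / 8) ^+ j)%R (exprn_gt0 j (divr_gt0 ltr01 (ltr0Sn R 7)))).
(* [k j] is at least [j] and at least every [N i] with [i <= j]; hence the functions of indices
   [k j] and [k (j + 1)] are within 8^-j in squared norm. *)
pose k j := (j + \max_(i < j.+1) N i)%N.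
have kN j i : (i <= j)%N -> (N i <= k j)%N.
  rewrite -ltnS => ij; rewrite /k; apply: leq_trans (leq_addl _ _).
  exact: (leq_bigmax (Ordinal ij)).
have mB p q : measurable_fun D (fun x => f p x - f q x)%R by exact: measurable_funB.
have := fast_decay_ae (h := fun j x => (f (k j.+1) x - f (k j) x)%R) (fun j => mB _ _) _.
have dec j : \int[mu]_(x in D) ((f (k j.+1) x - f (k j) x) ^+ 2)%:E <= ((1 / 8) ^+ j)%:E.
  by apply: hN; apply: kN.
move=> /(_ dec) [B [mBB B0 Bsub]].
(* Cutting off the null set [B] makes the subsequence converge everywhere on [D], hence to a
   measurable limit. *)
pose F j x := (f (k j) x * \1_(~` B) x)%R.
have mF j : measurable_fun D (F j).
  apply: measurable_funM => //; apply: measurable_funTS.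
  by apply: measurable_indic; exact: measurableC.
have cF x : D x -> cvgn (F ^~ x).
  move=> Dx; have [nB|Bx] := pselect ((~` B) x); last first.
    rewrite (_ : F ^~ x = cst 0%R); first exact: is_cvg_cst.
    by apply/funext => j; rewrite /F indicE memNset//= mulr0.
  rewrite (_ : F ^~ x = fun j => f (k j) x); last first.
    by apply/funext => j; rewrite /F indicE mem_set//= mulr1.
  have : ~ ~ (D x -> exists C, forall j, ((f (k j.+1) x - f (k j) x) ^+ 2 <= C * (1 / 4) ^+ j)%R).
    by move=> h; apply: nB; exact: Bsub.
  by move=> /contrapT /(_ Dx)[C]; exact: cvg_fast.
pose g x := limn (F ^~ x).
have mg : measurable_fun D g.
  by apply: (measurable_fun_cvg mF) => x Dx; exact: cF.
have aeg : {ae mu, forall x, D x -> (fun j => f (k j) x) @ \oo --> g x}.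
  exists B; split=> // x /= h; apply: contrapT => nB; apply: h => Dx.
  have := cF x Dx; rewrite /g (_ : F ^~ x = fun j => f (k j) x)//.
  by apply/funext => j; rewrite /F indicE mem_set//= mulr1.
exists g => // e e0; have [M hM] := cf e e0.
exists M => p Mp.
(* The shift by [M] puts all indices [k (j + M)] beyond [M]. *)
apply: (@fatou_bound (fun j x => ((f p x - f (k (j + M)%N) x) ^+ 2)%:E)).
- by move=> j; apply/measurable_EFinP; exact: measurable_funX.
- by apply/measurable_EFinP; apply: measurable_funX; exact: measurable_funB.
- by move=> j x _; rewrite lee_fin sqr_ge0.
- by move=> x _; rewrite lee_fin sqr_ge0.
- apply: filterS aeg => x h Dx; apply: cvg_EFin; first exact: nearW.
  have := h Dx; rewrite -(cvg_shiftn M) => h1.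
  by apply: (@cvgM _ _ _ _ (fun j => f p x - _)%R (fun j => f p x - _)%R); apply: cvgB => //; exact: cvg_cst.
- move=> j; apply: hM => //.
  by rewrite /k -addnA addnC -addnA leq_addr.
Qed.

End L2_completeness.

(** * Real and imaginary parts *)

Section complex_parts.
Context (R : realType).
Implicit Types z w : R[i].

Lemma ReDc z w : Re (z + w) = Re z + Re w. Proof. by case: z w => [a b] [c d]. Qed.
Lemma ImDc z w : Im (z + w) = Im z + Im w. Proof. by case: z w => [a b] [c d]. Qed.
Lemma ReNc z : Re (- z) = - Re z. Proof. by case: z. Qed.
Lemma ImNc z : Im (- z) = - Im z. Proof. by case: z. Qed.
Lemma ReMc z w : Re (z * w) = Re z * Re w - Im z * Im w.
Proof. by case: z w => [a b] [c d]. Qed.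
Lemma ImMc z w : Im (z * w) = Re z * Im w + Im z * Re w.
Proof. by case: z w => [a b] [c d]. Qed.
Lemma Re_conj z : Re (conjc z) = Re z. Proof. by case: z. Qed.
Lemma Im_conj z : Im (conjc z) = - Im z. Proof. by case: z. Qed.
Lemma complex_ext z w : Re z = Re w -> Im z = Im w -> z = w.
Proof. by case: z w => [a b] [c d] /= -> ->. Qed.

Lemma Re_sum (I : Type) (s : seq I) (F : I -> R[i]) :
  Re (\sum_(i <- s) F i) = \sum_(i <- s) Re (F i).
Proof. by elim/big_rec2: _ => // i y1 y2 _ <-; rewrite ReDc. Qed.
Lemma Im_sum (I : Type) (s : seq I) (F : I -> R[i]) :
  Im (\sum_(i <- s) F i) = \sum_(i <- s) Im (F i).
Proof. by elim/big_rec2: _ => // i y1 y2 _ <-; rewrite ImDc. Qed.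

Definition dot z w := Re z * Re w + Im z * Im w.

Lemma dotC z w : dot z w = dot w z. Proof. by rewrite /dot; ring. Qed.
Lemma dot_sqmod z : dot z z = sqmod z. Proof. by rewrite /dot /sqmod !expr2. Qed.
Lemma sqmod_ge0 z : 0 <= sqmod z. Proof. by rewrite addr_ge0 ?sqr_ge0. Qed.

End complex_parts.

Definition partsE := (ReDc, ImDc, ReNc, ImNc, ReMc, ImMc, Re_conj, Im_conj).

(** * Integrable and square-integrable functions on a domain *)

Section L2_domain.
Context (R : realType) (n : nat) (D : set 'rV[R]_n).
Hypotheses (oD : open D) (bD : bounded_set D).
Implicit Types (f g h : 'rV[R]_n -> R) (u v w : 'rV[R]_n -> R[i]).
Let mD := mD oD.
Let Dfin := leb_domain_lty oD bD.

Definition ig f := leb.-integrable D (EFin \o f).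
Definition sq f := measurable_fun D f /\ ig (fun x => f x ^+ 2).

Lemma ig_meas f : ig f -> measurable_fun D f.
Proof. by move=> h; apply/measurable_EFinP; exact: measurable_int h. Qed.

Lemma eq_ig f g : (forall x, D x -> f x = g x) -> ig f -> ig g.
Proof.
move=> fg; apply: eq_integrable => // x; rewrite inE => Dx /=.
by rewrite fg.
Qed.

Lemma igD f g : ig f -> ig g -> ig (fun x => f x + g x).
Proof.
by move=> hf hg; have := integrableD mD hf hg; apply: eq_integrable.
Qed.

Lemma igZ c f : ig f -> ig (fun x => c * f x).
Proof. by move=> hf; have := integrableZl mD c hf; apply: eq_integrable. Qed.

Lemma ig_norm f : ig f -> ig (fun x => `|f x|).
Proof. exact: integrable_norm. Qed.

Lemma ig_le f g : measurable_fun D f -> ig g ->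
  (forall x, D x -> `|f x| <= g x) -> ig f.
Proof.
move=> mf hg fg; apply: (le_integrable mD _ _ hg); first exact/measurable_EFinP.
by move=> x Dx /=; rewrite lee_fin (le_trans (fg _ Dx))// ler_norm.
Qed.

Lemma ig_ae_le f g : measurable_fun D f -> ig g ->
  {ae leb, forall x, D x -> `|f x| <= g x} -> ig f.
Proof.
move=> mf hg fg; apply/integrableP; split; first exact/measurable_EFinP.
case/integrableP: (ig_norm hg) => mg; apply: le_lt_trans.
apply: ae_ge0_le_integral => //.
- by apply: measurableT_comp => //; exact/measurable_EFinP.
- by apply: measurableT_comp => //; exact/measurable_EFinP/ig_meas.
by apply: filterS fg => x h Dx /=; rewrite lee_fin normr_id (le_trans (h Dx))// ler_norm.
Qed.

Lemma sq_meas f : sq f -> measurable_fun D f. Proof. by case. Qed.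

Lemma sqM f g : sq f -> sq g -> ig (fun x => f x * g x).
Proof.
move=> [mf hf] [mg hg]; apply: (ig_le _ (igD hf hg)); first exact: measurable_funM.
move=> x _; rewrite normrM -(real_normK (num_real (f x))) -(real_normK (num_real (g x))).
have : 0 <= (`|f x| - `|g x|) ^+ 2 by exact: sqr_ge0.
have : 0 <= `|f x| * `|g x| by rewrite mulr_ge0.
by rewrite sqrrB -mulr_natr; lra.
Qed.

Lemma sqD f g : sq f -> sq g -> sq (fun x => f x + g x).
Proof.
move=> hf hg; split; first by apply: measurable_funD; [case: hf|case: hg].
apply: eq_ig (igD (igD (proj2 hf) (proj2 hg)) (igZ 2 (sqM hf hg))) => x _.
by rewrite sqrrD; ring.
Qed.

Lemma sqZ c f : sq f -> sq (fun x => c * f x).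
Proof.
move=> hf; split; first by apply: measurable_funM => //; case: hf.
by apply: eq_ig (igZ (c ^+ 2) (proj2 hf)) => x _; rewrite exprMn.
Qed.

Lemma sqN f : sq f -> sq (fun x => - f x).
Proof.
by move=> /(sqZ (-1)); rewrite (_ : (fun _ => _) = fun x => - f x)//; apply/funext => x; rewrite mulN1r.
Qed.

Lemma sq_ae_le f g : measurable_fun D f -> sq g ->
  {ae leb, forall x, D x -> `|f x| <= `|g x|} -> sq f.
Proof.
move=> mf [mg hg] fg; split=> //; apply: (ig_ae_le _ hg); first exact: measurable_funX.
apply: filterS fg => x h Dx; rewrite normrX -[leRHS]ger0_norm ?sqr_ge0// normrX.
by rewrite lerXn2r ?nnegrE//; exact: h.
Qed.

Lemma sq_ae_bounded (b : 'rV[R]_n -> R) f M : measurable_fun D b ->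
  {ae leb, forall x, D x -> `|b x| <= M} -> sq f -> sq (fun x => b x * f x).
Proof.
move=> mb bM hf; apply: (sq_ae_le _ (sqZ M hf)).
  by apply: measurable_funM => //; case: hf.
apply: filterS bM => x h Dx; rewrite !normrM ler_wpM2r//.
by apply: le_trans (h Dx) _; exact: ler_norm.
Qed.

Lemma ig_bounded f M : measurable_fun D f -> (forall x, D x -> `|f x| <= M) -> ig f.
Proof.
move=> mf fM; apply: measurable_bounded_integrable => //.
exists M; split; first exact: num_real.
by move=> y My x Dx; apply: le_trans (fM x Dx) (ltW My).
Qed.

Lemma sq_bounded f M : measurable_fun D f -> (forall x, D x -> `|f x| <= M) -> sq f.
Proof.
move=> mf fM; split=> //; apply: (@ig_bounded _ (M ^+ 2)); first exact: measurable_funX.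
move=> x Dx; rewrite normrX lerXn2r ?nnegrE//; last exact: fM.
exact: le_trans (fM x Dx).
Qed.

Lemma sq_ig f : sq f -> ig f.
Proof.
move=> hf; have h1 : sq (fun=> 1) by apply: (@sq_bounded _ 1) => // x _; rewrite normr1.
by apply: eq_ig (sqM hf h1) => x _; rewrite mulr1.
Qed.

Lemma ctest_sq f : ctest D f -> sq f.
Proof.
move=> tf; have [C hC] := ctest_bounded tf.
by apply: (@sq_bounded _ C) => // ; apply: smooth_measurable; exact: ctest_smooth tf.
Qed.

Lemma Rint_ae_eq f g : measurable_fun D f -> measurable_fun D g ->
  {ae leb, forall x, D x -> f x = g x} ->
  \int[leb]_(x in D) f x = \int[leb]_(x in D) g x.
Proof.
move=> mf mg fg; congr fine; apply: ae_eq_integral => //.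
- exact/measurable_EFinP.
- exact/measurable_EFinP.
by apply: filterS fg => x h Dx /=; rewrite h.
Qed.

Lemma L2P u : L2 D u <-> sq (fun x => Re (u x)) /\ sq (fun x => Im (u x)).
Proof.
split=> [[m1 m2 fin]|[[m1 h1] [m2 h2]]]; last first.
  split=> //; have /integrableP[_] := igD h1 h2; apply: le_lt_trans.
  apply: ge0_le_integral => //.
  - by move=> x _; rewrite lee_fin sqmod_ge0.
  - by apply/measurable_EFinP; apply: measurable_funD; exact: measurable_funX.
  - by apply: measurableT_comp => //; apply/measurable_EFinP; apply: measurable_funD; exact: measurable_funX.
  - by move=> x _ /=; rewrite lee_fin ler_norm.
have isq : ig (fun x => sqmod (u x)).
  apply/integrableP; split.
    by apply/measurable_EFinP; apply: measurable_funD; exact: measurable_funX.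
  apply: le_lt_trans fin; rewrite le_eqVlt; apply/orP; left; apply/eqP.
  by apply: eq_integral => x _ /=; rewrite ger0_norm// sqmod_ge0.
split; split=> //; apply: ig_le isq _; try exact: measurable_funX.
- by move=> x _; rewrite normrX real_normK ?num_real// lerDl sqr_ge0.
- by move=> x _; rewrite normrX real_normK ?num_real// lerDr sqr_ge0.
Qed.

End L2_domain.

(** * L^2 as a complete real semi-inner product space *)

Section L2_hilbert.
Context (R : realType) (n : nat) (D : set 'rV[R]_n).
Hypotheses (oD : open D) (bD : bounded_set D).
Implicit Types (f g h : 'rV[R]_n -> R) (u v w : 'rV[R]_n -> R[i]).
Let mD := mD oD.

(** The factor is real, in accordance with real differentiation of the energy; multiplication by i
    is the separate map [mulI]. *)
Definition lin (c : R) u v : 'rV[R]_n -> R[i] := fun x => u x + (c%:C)%C * v x.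
Definition linr (c : R) f g : 'rV[R]_n -> R := fun x => f x + c * g x.
Definition dotL u v : R := \int[leb]_(x in D) dot (u x) (v x).
Definition ipr f g : R := \int[leb]_(x in D) (f x * g x).
Definition mulI u : 'rV[R]_n -> R[i] := fun x => (0 +i* 1)%C * u x.

Lemma Re_lin c u v x : Re (lin c u v x) = Re (u x) + c * Re (v x).
Proof. by rewrite /lin !partsE /= mul0r subr0. Qed.
Lemma Im_lin c u v x : Im (lin c u v x) = Im (u x) + c * Im (v x).
Proof. by rewrite /lin !partsE /= mul0r addr0. Qed.
Lemma Re_mulI u x : Re (mulI u x) = - Im (u x).
Proof. by rewrite /mulI !partsE /= mul0r mul1r sub0r. Qed.
Lemma Im_mulI u x : Im (mulI u x) = Re (u x).
Proof. by rewrite /mulI !partsE /= mul0r mul1r add0r. Qed.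

Lemma sub_lin u v : (fun x => u x - v x) = lin (-1) u v.
Proof. by apply/funext => x; apply: complex_ext; rewrite ?Re_lin ?Im_lin !partsE mulN1r. Qed.

Lemma sq_linr c f g : sq D f -> sq D g -> sq D (linr c f g).
Proof. by move=> hf hg; apply: sqD => //; exact: sqZ. Qed.

Lemma ipr_linr c f g h : sq D f -> sq D g -> sq D h ->
  ipr (linr c f g) h = ipr f h + c * ipr g h.
Proof.
move=> hf hg hh; rewrite /ipr -RintegralZl//; last exact: sqM.
rewrite -RintegralD//; [|exact: sqM|by apply: igZ => //; exact: sqM].
by apply: eq_Rintegral => x _; rewrite /linr mulrDl mulrA.
Qed.

Lemma iprC f g : ipr f g = ipr g f.
Proof. by apply: eq_Rintegral => x _; rewrite mulrC. Qed.

Lemma ipr_ge0 f : 0 <= ipr f f.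
Proof. by apply: Rintegral_ge0 => x _; rewrite -expr2 sqr_ge0. Qed.

Lemma ipr_cs f g : sq D f -> sq D g ->
  `|ipr f g| <= Num.sqrt (ipr f f) * Num.sqrt (ipr g g).
Proof.
apply: (sip_cauchy_schwarz sq_linr) => *; [exact: iprC|exact: ipr_linr|exact: ipr_ge0].
Qed.

Lemma L2_lin c u v : L2 D u -> L2 D v -> L2 D (lin c u v).
Proof.
move=> /(L2P oD)[u1 u2] /(L2P oD)[v1 v2]; apply/(L2P oD).
split; [under eq_fun do rewrite Re_lin|under eq_fun do rewrite Im_lin]; exact: sq_linr.
Qed.

Lemma L2_mulI u : L2 D u -> L2 D (mulI u).
Proof.
move=> /(L2P oD)[u1 u2]; apply/(L2P oD).
by split; [under eq_fun do rewrite Re_mulI; exact: sqN|under eq_fun do rewrite Im_mulI].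
Qed.

Lemma ig_dot u v : L2 D u -> L2 D v -> ig D (fun x => dot (u x) (v x)).
Proof. by move=> /(L2P oD)[u1 u2] /(L2P oD)[v1 v2]; apply: igD => //; exact: sqM. Qed.

Lemma dotL_parts u v : L2 D u -> L2 D v ->
  dotL u v = ipr (fun x => Re (u x)) (fun x => Re (v x)) +
             ipr (fun x => Im (u x)) (fun x => Im (v x)).
Proof.
by move=> /(L2P oD)[u1 u2] /(L2P oD)[v1 v2]; rewrite /ipr -RintegralD//; exact: sqM.
Qed.

Lemma dotLC u v : dotL u v = dotL v u.
Proof. by apply: eq_Rintegral => x _; rewrite dotC. Qed.

Lemma dotL_mulI u v : dotL (mulI u) (mulI v) = dotL u v.
Proof.
by apply: eq_Rintegral => x _; rewrite /dot !Re_mulI !Im_mulI mulrNN addrC.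
Qed.

Lemma dotL_lin c u v w : L2 D u -> L2 D v -> L2 D w ->
  dotL (lin c u v) w = dotL u w + c * dotL v w.
Proof.
move=> hu hv hw; rewrite /dotL -RintegralZl//; last exact: ig_dot.
rewrite -RintegralD//; [|exact: ig_dot|by apply: igZ => //; exact: ig_dot].
by apply: eq_Rintegral => x _; rewrite /dot Re_lin Im_lin; ring.
Qed.

Lemma dotL_ge0 u : 0 <= dotL u u.
Proof. by apply: Rintegral_ge0 => x _; rewrite dot_sqmod sqmod_ge0. Qed.

Lemma L2normE u : L2norm D u = Num.sqrt (dotL u u).
Proof. by congr Num.sqrt; apply: eq_Rintegral => x _; rewrite dot_sqmod. Qed.

Lemma L2norm_sqr u : L2norm D u ^+ 2 = dotL u u.
Proof. by rewrite L2normE sqr_sqrtr// dotL_ge0. Qed.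

Lemma dotL_cs u v : L2 D u -> L2 D v -> `|dotL u v| <= L2norm D u * L2norm D v.
Proof.
rewrite !L2normE; apply: (sip_cauchy_schwarz L2_lin) => *.
- exact: dotLC.
- exact: dotL_lin.
- exact: dotL_ge0.
Qed.

Lemma Re_L2ip u v : Re (L2ip D u v) = dotL u v.
Proof. by apply: eq_Rintegral => x _; rewrite !partsE /dot mulNr opprK. Qed.

Lemma Im_L2ip u v : Im (L2ip D u v) = dotL (mulI u) v.
Proof. by apply: eq_Rintegral => x _; rewrite !partsE /dot Re_mulI Im_mulI; ring. Qed.

Lemma ae_eq_dotL u u' v v' : L2 D u -> L2 D u' -> L2 D v -> L2 D v' ->
  {ae leb, forall x, D x -> u x = u' x} -> {ae leb, forall x, D x -> v x = v' x} ->
  dotL u v = dotL u' v'.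
Proof.
move=> hu hu' hv hv' eu ev; apply: Rint_ae_eq => //.
- exact: ig_meas (ig_dot hu hv).
- exact: ig_meas (ig_dot hu' hv').
by apply: filterS2 eu ev => x h1 h2 Dx; rewrite h1// h2.
Qed.

Lemma ipr_EFin f : sq D f -> (\int[leb]_(x in D) (f x ^+ 2)%:E = (ipr f f)%:E)%E.
Proof.
by move=> [mf hf]; rewrite -(fineK (integrable_fin_num mD hf)).
Qed.

Lemma sq_complete : sip_complete (sq D) linr ipr.
Proof.
move=> f hf cf.
have mf k : measurable_fun D (f k) by case: (hf k).
have hB p q : sq D (fun x => f p x - f q x) by apply: sqD => //; exact: sqN.
have eB f1 f2 : (fun x => f1 x - f2 x) = linr (-1) f1 f2 :> ('rV[R]_n -> R).
  by apply/funext => x; rewrite /linr mulN1r.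
have dE f1 f2 : sq D f1 -> sq D f2 ->
    (\int[leb]_(x in D) ((f1 x - f2 x) ^+ 2)%:E = (ipr (linr (-1) f1 f2) (linr (-1) f1 f2))%:E)%E.
  by move=> h1 h2; rewrite -ipr_EFin -?eB//; rewrite eB; exact: sq_linr.
have [|g mg hg] := L2_complete_real (mu := @leb R n) mD mf.
  move=> e e0; have se : 0 < Num.sqrt e by rewrite sqrtr_gt0.
  have [N hN] := cf _ se; exists N => p q Np Nq.
  by rewrite dE// lee_fin -ler_sqrt; [exact: hN|exact: ltW].
have sg : sq D g.
  have [N /(_ N (leqnn N)) hN] := hg 1 ltr01.
  have sd : sq D (fun x => f N x - g x).
    split; first exact: measurable_funB.
    apply/integrableP; split; first by apply/measurable_EFinP; apply: measurable_funX; exact: measurable_funB.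
    apply: le_lt_trans (ltry 1); apply: le_trans hN; rewrite le_eqVlt; apply/orP; left; apply/eqP.
    by apply: eq_integral => x _ /=; rewrite ger0_norm// sqr_ge0.
  have -> : g = linr (-1) (f N) (fun x => f N x - g x).
    by apply/funext => x; rewrite /linr; ring.
  exact: sq_linr.
exists g => // e e0; have [N hN] := hg (e ^+ 2) (exprn_gt0 2 e0).
exists N => p Np; have := hN p Np; rewrite dE// lee_fin => h.
rewrite -[leRHS]gtr0_norm// -sqrtr_sqr ler_sqrt//; exact: sqr_ge0.
Qed.

Lemma dotL_sub_parts v w : L2 D v -> L2 D w ->
  dotL (lin (-1) v w) (lin (-1) v w) =
  ipr (linr (-1) (fun x => Re (v x)) (fun x => Re (w x))) (linr (-1) (fun x => Re (v x)) (fun x => Re (w x))) +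
  ipr (linr (-1) (fun x => Im (v x)) (fun x => Im (w x))) (linr (-1) (fun x => Im (v x)) (fun x => Im (w x))).
Proof.
move=> hv hw; rewrite dotL_parts; [|exact: L2_lin|exact: L2_lin].
by congr (_ + _); apply: eq_Rintegral => x _; rewrite /linr ?Re_lin ?Im_lin.
Qed.

Lemma ipr_Re_le v w : L2 D v -> L2 D w ->
  Num.sqrt (ipr (linr (-1) (fun x => Re (v x)) (fun x => Re (w x)))
                (linr (-1) (fun x => Re (v x)) (fun x => Re (w x)))) <=
  Num.sqrt (dotL (lin (-1) v w) (lin (-1) v w)).
Proof.
by move=> hv hw; rewrite dotL_sub_parts// ler_sqrt ?addr_ge0 ?ipr_ge0// lerDl ipr_ge0.
Qed.

Lemma ipr_Im_le v w : L2 D v -> L2 D w ->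
  Num.sqrt (ipr (linr (-1) (fun x => Im (v x)) (fun x => Im (w x)))
                (linr (-1) (fun x => Im (v x)) (fun x => Im (w x)))) <=
  Num.sqrt (dotL (lin (-1) v w) (lin (-1) v w)).
Proof.
by move=> hv hw; rewrite dotL_sub_parts// ler_sqrt ?addr_ge0 ?ipr_ge0// lerDr ipr_ge0.
Qed.

Lemma L2_complete : sip_complete (L2 D) lin dotL.
Proof.
move=> u hu cu.
have hR k : sq D (fun x => Re (u k x)) by have /(L2P oD)[] := hu k.
have hI k : sq D (fun x => Im (u k x)) by have /(L2P oD)[] := hu k.
have [|r sr hr] := sq_complete hR.
  move=> e e0; have [N hN] := cu e e0; exists N => p q Np Nq.
  by apply: le_trans (hN p q Np Nq); exact: ipr_Re_le.
have [|i si hi] := sq_complete hI.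
  move=> e e0; have [N hN] := cu e e0; exists N => p q Np Nq.
  by apply: le_trans (hN p q Np Nq); exact: ipr_Im_le.
exists (fun x => (r x +i* i x)%C); first exact/(L2P oD).
move=> e e0; have e2 : 0 < e / 2 by rewrite divr_gt0.
have [N hN] := hr _ e2; have [M hM] := hi _ e2.
exists (maxn N M) => p; rewrite geq_max => /andP[/hN + /hM].
rewrite dotL_sub_parts//; last exact/(L2P oD).
set x := ipr _ _; set y := ipr _ _ => hx hy.
have x0 : 0 <= x by exact: ipr_ge0.
have y0 : 0 <= y by exact: ipr_ge0.
have tri : Num.sqrt (x + y) <= Num.sqrt x + Num.sqrt y.
  rewrite -(@ler_pXn2r _ 2)// ?nnegrE ?addr_ge0 ?sqrtr_ge0//.
  rewrite sqrrD !sqr_sqrtr ?addr_ge0// lerD2r lerDl.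
  by rewrite -mulr_natr !mulr_ge0 ?sqrtr_ge0.
by apply: le_trans tri _; lra.
Qed.

End L2_hilbert.

(** * Weak derivatives and Sobolev spaces *)

Section weak_gradient.
Context (R : realType) (n : nat) (D : set 'rV[R]_n).
Hypotheses (oD : open D) (bD : bounded_set D).
Implicit Types (f g h : 'rV[R]_n -> R) (u v w : 'rV[R]_n -> R[i]).
Let mD := mD oD.

Definition weak_partial (i : 'I_n) f g :=
  forall phi, ctest D phi -> ipr D f (partial i phi) = - ipr D g phi.

Lemma weak_partial_lin i c f f' g g' : sq D f -> sq D f' -> sq D g -> sq D g' ->
  weak_partial i f f' -> weak_partial i g g' ->
  weak_partial i (linr c f g) (linr c f' g').
Proof.
move=> sf sf' sg sg' hf hg phi tphi.
have s1 := ctest_sq oD bD tphi; have s2 := ctest_sq oD bD (ctest_partial i tphi).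
by rewrite !ipr_linr// hf// hg//; ring.
Qed.

Lemma weak_partial_unique i f g g' : sq D g -> sq D g' ->
  weak_partial i f g -> weak_partial i f g' -> {ae leb, forall x, D x -> g x = g' x}.
Proof.
move=> sg sg' hg hg'.
have sd : sq D (linr (-1) g g') by exact: sq_linr.
have : {ae leb, forall x, D x -> linr (-1) g g' x = 0}.
  apply: (fundamental_lemma oD (sq_ig oD bD sd)) => phi tphi.
  have s1 := ctest_sq oD bD tphi.
  have -> : \int[leb]_(x in D) (linr (-1) g g' x * phi x) = ipr D (linr (-1) g g') phi by [].
  have := hg _ tphi; rewrite hg'// => /oppr_inj e.
  by rewrite ipr_linr// e mulN1r subrr.
apply: filterS => x h Dx; have := h Dx; rewrite /linr mulN1r => /eqP.
by rewrite subr_eq0 => /eqP.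
Qed.

(** For a fixed test function both sides of the defining identity are continuous in L^2, by
    Cauchy-Schwarz. The completeness of H^1 rests on this. *)
Lemma weak_partial_limit i (f g : nat -> 'rV[R]_n -> R) f0 g0 :
  (forall k, sq D (f k)) -> (forall k, sq D (g k)) -> sq D f0 -> sq D g0 ->
  (forall k, weak_partial i (f k) (g k)) ->
  (forall e, 0 < e -> exists N, forall p, (N <= p)%N ->
     Num.sqrt (ipr D (linr (-1) (f p) f0) (linr (-1) (f p) f0)) <= e) ->
  (forall e, 0 < e -> exists N, forall p, (N <= p)%N ->
     Num.sqrt (ipr D (linr (-1) (g p) g0) (linr (-1) (g p) g0)) <= e) ->
  weak_partial i f0 g0.
Proof.
move=> sf sg sf0 sg0 hw hf hg phi tphi.
have s1 := ctest_sq oD bD tphi; have s2 := ctest_sq oD bD (ctest_partial i tphi).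
set n1 := Num.sqrt (ipr D phi phi).
set n2 := Num.sqrt (ipr D (partial i phi) (partial i phi)).
have n10 : 0 <= n1 by exact: sqrtr_ge0.
have n20 : 0 <= n2 by exact: sqrtr_ge0.
apply/eqP; rewrite -subr_eq0 opprK -normr_le0; apply/ler_addgt0Pl => e e0.
have e1 : 0 < e / 2 / (n1 + n2 + 1) by rewrite !divr_gt0//; lra.
have [N hN] := hf _ e1; have [M hM] := hg _ e1.
set p := maxn N M; have {}hN := hN p (leq_maxl _ _); have {}hM := hM p (leq_maxr _ _).
have := hw p phi tphi => hwp.
have -> : ipr D f0 (partial i phi) + ipr D g0 phi =
    - ipr D (linr (-1) (f p) f0) (partial i phi) - ipr D (linr (-1) (g p) g0) phi.
  by rewrite !ipr_linr// hwp; ring.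
rewrite addr0; apply: le_trans (ler_normB _ _) _; rewrite normrN.
have h1 := ipr_cs oD (sq_linr oD (-1) (sf p) sf0) s2.
have h2 := ipr_cs oD (sq_linr oD (-1) (sg p) sg0) s1.
rewrite -/n2 in h1; rewrite -/n1 in h2.
have b1 : Num.sqrt (ipr D (linr (-1) (f p) f0) (linr (-1) (f p) f0)) * n2 <= e / 2 / (n1 + n2 + 1) * n2.
  by rewrite ler_wpM2r.
have b2 : Num.sqrt (ipr D (linr (-1) (g p) g0) (linr (-1) (g p) g0)) * n1 <= e / 2 / (n1 + n2 + 1) * n1.
  by rewrite ler_wpM2r.
have b3 : e / 2 / (n1 + n2 + 1) * n1 + e / 2 / (n1 + n2 + 1) * n2 <= e.
  rewrite -mulrDr; set s := n1 + n2.
  have s0 : 0 <= s by rewrite addr_ge0.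
  have es : 0 <= e * s by rewrite mulr_ge0// ltW.
  rewrite mulrAC ler_pdivrMr; last by lra.
  by lra.
by lra.
Qed.

Lemma weak_partial_ctest i f : ctest D f -> weak_partial i f (partial i f).
Proof. by move=> tf phi tphi; apply: integral_by_parts => //; exact: ctest_smooth tf. Qed.

Definition cplx f : 'rV[R]_n -> R[i] := fun x => (f x)%:C%C.

Lemma test_fun_cplx f : ctest D f -> test_fun D (cplx f).
Proof. by move=> tf; apply/test_funP; split=> //=; exact: ctest0. Qed.

Lemma Re_Cpartial i (phi : 'rV[R]_n -> R[i]) x :
  Re (Cpartial i phi x) = partial i (fun y => Re (phi y)) x.
Proof. by []. Qed.

Lemma Im_Cpartial i (phi : 'rV[R]_n -> R[i]) x :
  Im (Cpartial i phi x) = partial i (fun y => Im (phi y)) x.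
Proof. by []. Qed.

(** Testing with the real functions [cplx f] separates the complex identity into its real and
    imaginary parts; conversely the parts recombine by linearity. *)
Lemma is_weak_gradP u (g : 'I_n -> 'rV[R]_n -> R[i]) : L2 D u ->
  is_weak_grad D u g <-> forall i, [/\ L2 D (g i),
    weak_partial i (fun x => Re (u x)) (fun x => Re (g i x)) &
    weak_partial i (fun x => Im (u x)) (fun x => Im (g i x))].
Proof.
move=> /(L2P oD)[u1 u2]; split=> h i.
  have [Lg hg] := h i; split=> // f tf.
  - have := congr1 (@Re R) (hg _ (test_fun_cplx tf)); rewrite ReNc /=.
    rewrite /ipr => e; apply: etrans (etrans e _).
      by apply: eq_Rintegral => x _; rewrite !partsE /= partial_cst mulr0 subr0.
    by congr -%R; apply: eq_Rintegral => x _; rewrite !partsE /= mulr0 subr0.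
  - have := congr1 (@Im R) (hg _ (test_fun_cplx tf)); rewrite ImNc /=.
    rewrite /ipr => e; apply: etrans (etrans e _).
      by apply: eq_Rintegral => x _; rewrite !partsE /= partial_cst mulr0 add0r.
    by congr -%R; apply: eq_Rintegral => x _; rewrite !partsE /= mulr0 add0r.
have [Lg hr hi] := h i; have /(L2P oD)[g1 g2] := Lg; split=> // phi /test_funP[t1 t2].
have [p1 p2] := (ctest_partial i t1, ctest_partial i t2).
have s f : ctest D f -> sq D f by exact: ctest_sq.
apply: complex_ext; rewrite ?ReNc ?ImNc /=.
  under eq_Rintegral do rewrite ReMc Re_Cpartial Im_Cpartial.
  under [in RHS]eq_Rintegral do rewrite ReMc.
  rewrite !RintegralB ?ig_sqM//; try by apply: sqM => //; exact: s.
  have := hr _ t1; have := hi _ t2; rewrite /ipr => -> ->.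
  by ring.
under eq_Rintegral do rewrite ImMc Re_Cpartial Im_Cpartial.
under [in RHS]eq_Rintegral do rewrite ImMc.
rewrite !RintegralD//; try by apply: sqM => //; exact: s.
have := hr _ t2; have := hi _ t1; rewrite /ipr => -> ->.
by ring.
Qed.

Lemma is_weak_grad_L2 u (g : 'I_n -> 'rV[R]_n -> R[i]) i : is_weak_grad D u g -> L2 D (g i).
Proof. by move=> /(_ i)[]. Qed.

Lemma weak_grad_lin c u v (g h : 'I_n -> 'rV[R]_n -> R[i]) : L2 D u -> L2 D v ->
  is_weak_grad D u g -> is_weak_grad D v h ->
  is_weak_grad D (lin c u v) (fun i => lin c (g i) (h i)).
Proof.
move=> hu hv /(is_weak_gradP _ hu) wg /(is_weak_gradP _ hv) wh.
apply/is_weak_gradP; first exact: L2_lin.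
move=> i; have [g1 g2 g3] := wg i; have [h1 h2 h3] := wh i.
have /(L2P oD)[u1 u2] := hu; have /(L2P oD)[v1 v2] := hv.
have /(L2P oD)[g4 g5] := g1; have /(L2P oD)[h4 h5] := h1.
split; first exact: L2_lin.
  have := weak_partial_lin c u1 g4 v1 h4 g2 h2.
  by congr weak_partial; apply/funext => x; rewrite Re_lin.
have := weak_partial_lin c u2 g5 v2 h5 g3 h3.
by congr weak_partial; apply/funext => x; rewrite Im_lin.
Qed.

Lemma weak_grad_mulI u (g : 'I_n -> 'rV[R]_n -> R[i]) : L2 D u -> is_weak_grad D u g ->
  is_weak_grad D (mulI u) (fun i => mulI (g i)).
Proof.
move=> hu /(is_weak_gradP _ hu) wg; apply/is_weak_gradP; first exact: L2_mulI.
move=> i; have [g1 g2 g3] := wg i.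
have /(L2P oD)[u1 u2] := hu; have /(L2P oD)[g4 g5] := g1.
have z0 : sq D (fun=> 0) by exact: ctest_sq (ctest0 D).
have w0 : weak_partial i (fun=> 0) (fun=> 0).
  have z f : ipr D (fun=> 0) f = 0.
    by rewrite /ipr; under eq_Rintegral do rewrite mul0r; rewrite Rintegral_cst// mul0r.
  by move=> phi _; rewrite !z oppr0.
split; first exact: L2_mulI.
  have := weak_partial_lin (-1) z0 z0 u2 g5 w0 g3.
  by congr weak_partial; apply/funext => x; rewrite Re_mulI /linr; ring.
move: g2; congr weak_partial; apply/funext => x; rewrite Im_mulI//.
Qed.

Lemma weak_grad_unique u (g g' : 'I_n -> 'rV[R]_n -> R[i]) : L2 D u -> is_weak_grad D u g -> is_weak_grad D u g' ->
  forall i, {ae leb, forall x, D x -> g i x = g' i x}.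
Proof.
move=> hu /(is_weak_gradP _ hu) wg /(is_weak_gradP _ hu) wg' i.
have [/(L2P oD)[g1 g2] g3 g4] := wg i; have [/(L2P oD)[h1 h2] h3 h4] := wg' i.
have e1 := weak_partial_unique g1 h1 g3 h3.
have e2 := weak_partial_unique g2 h2 g4 h4.
apply: filterS2 e1 e2 => x k1 k2 Dx.
by apply: complex_ext; [exact: k1|exact: k2].
Qed.

Lemma test_fun_L2 phi : test_fun D phi -> L2 D phi.
Proof. by move=> /test_funP[t1 t2]; apply/(L2P oD); split; exact: ctest_sq. Qed.

Lemma test_fun_Cpartial i phi : test_fun D phi -> test_fun D (Cpartial i phi).
Proof. by move=> /test_funP[t1 t2]; apply/test_funP; split; exact: ctest_partial. Qed.

Lemma weak_grad_test phi : test_fun D phi -> is_weak_grad D phi (fun i => Cpartial i phi).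
Proof.
move=> tphi; apply/is_weak_gradP; first exact: test_fun_L2.
move=> i; split; first exact/test_fun_L2/test_fun_Cpartial.
  by apply: weak_partial_ctest; have /test_funP[] := tphi.
by apply: weak_partial_ctest; have /test_funP[] := tphi.
Qed.

End weak_gradient.

(** * The spaces H^1 and H_0^1 *)

Section sobolev_space.
Context (R : realType) (n : nat) (D : set 'rV[R]_n).
Hypotheses (oD : open D) (bD : bounded_set D).
Implicit Types (u v w : 'rV[R]_n -> R[i]).
Let mD := mD oD.
Local Notation lin := (@lin R n).

Definition gradip u v : R := \sum_i dotL D (wgrad D u i) (wgrad D v i).
Definition h1ip u v : R := dotL D u v + gradip u v.

Lemma H1_L2 u : H1 D u -> L2 D u. Proof. by case. Qed.

Lemma H1_wgrad u : H1 D u -> is_weak_grad D u (wgrad D u).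
Proof. by move=> [_ h]; exact: xgetPex h. Qed.

Opaque dotL ipr wgrad.

Lemma wgrad_L2 u i : H1 D u -> L2 D (wgrad D u i).
Proof. by move=> /H1_wgrad /(_ i)[]. Qed.

(** [wgrad] is a representative picked by choice, so it is compared with an explicit weak gradient
    almost everywhere only; linearity, compatibility with i and the values on test functions all
    come from here. *)
Lemma wgrad_ae u (g : 'I_n -> 'rV[R]_n -> R[i]) i : L2 D u -> is_weak_grad D u g ->
  {ae leb, forall x, D x -> wgrad D u i x = g i x}.
Proof.
move=> hu hg; apply: (weak_grad_unique oD bD hu _ hg).
by apply: H1_wgrad; split=> //; exists g.
Qed.

Lemma H1_lin c u v : H1 D u -> H1 D v -> H1 D (lin c u v).
Proof.
move=> hu hv; split; first by apply: L2_lin => //; exact: H1_L2.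
eexists; apply: (weak_grad_lin oD bD c) (H1_wgrad hu) (H1_wgrad hv); exact: H1_L2.
Qed.

Lemma wgrad_lin_ae c u v i : H1 D u -> H1 D v -> {ae leb, forall x, D x ->
  wgrad D (lin c u v) i x = lin c (wgrad D u i) (wgrad D v i) x}.
Proof.
move=> hu hv; apply: (wgrad_ae (g := fun i => lin c (wgrad D u i) (wgrad D v i))).
  by apply: L2_lin => //; exact: H1_L2.
apply: (weak_grad_lin oD bD c) (H1_wgrad hu) (H1_wgrad hv); exact: H1_L2.
Qed.

Lemma H1_mulI u : H1 D u -> H1 D (mulI u).
Proof.
move=> hu; split; first by apply: L2_mulI => //; exact: H1_L2.
eexists; apply: (weak_grad_mulI oD bD) (H1_wgrad hu); exact: H1_L2.
Qed.

Lemma wgrad_mulI_ae u i : H1 D u -> {ae leb, forall x, D x ->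
  wgrad D (mulI u) i x = mulI (wgrad D u i) x}.
Proof.
move=> hu; apply: (wgrad_ae (g := fun i => mulI (wgrad D u i))).
  by apply: L2_mulI => //; exact: H1_L2.
apply: (weak_grad_mulI oD bD) (H1_wgrad hu); exact: H1_L2.
Qed.

Lemma H1_test phi : test_fun D phi -> H1 D phi.
Proof.
move=> tphi; split; first exact: test_fun_L2.
by eexists; exact: weak_grad_test.
Qed.

Lemma wgrad_test_ae phi i : test_fun D phi ->
  {ae leb, forall x, D x -> wgrad D phi i x = Cpartial i phi x}.
Proof.
move=> tphi; apply: (wgrad_ae (g := fun i => Cpartial i phi)); first exact: test_fun_L2.
exact: weak_grad_test.
Qed.

Lemma gradipC u v : gradip u v = gradip v u.
Proof. by apply: eq_bigr => i _; rewrite dotLC. Qed.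

Lemma gradip_lin c u v w : H1 D u -> H1 D v -> H1 D w ->
  gradip (lin c u v) w = gradip u w + c * gradip v w.
Proof.
move=> hu hv hw; rewrite /gradip mulr_sumr -big_split/=; apply: eq_bigr => i _.
rewrite -(dotL_lin oD); try exact: wgrad_L2.
apply: ae_eq_dotL => //; try exact: wgrad_L2.
- by apply: wgrad_L2; exact: H1_lin.
- by apply: L2_lin => //; exact: wgrad_L2.
- exact: wgrad_lin_ae.
- exact: aeW.
Qed.

Lemma gradip_ge0 u : 0 <= gradip u u.
Proof. by apply: sumr_ge0 => i _; exact: dotL_ge0. Qed.

Lemma h1ipC u v : h1ip u v = h1ip v u.
Proof. by rewrite /h1ip dotLC gradipC. Qed.

Lemma h1ip_lin c u v w : H1 D u -> H1 D v -> H1 D w ->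
  h1ip (lin c u v) w = h1ip u w + c * h1ip v w.
Proof.
move=> hu hv hw; rewrite /h1ip gradip_lin// dotL_lin//; try exact: H1_L2.
by rewrite mulrDr addrACA.
Qed.

Lemma h1ip_ge0 u : 0 <= h1ip u u.
Proof. by rewrite addr_ge0 ?dotL_ge0 ?gradip_ge0. Qed.

Lemma H01normE u : H01norm D u = Num.sqrt (gradip u u).
Proof. by congr Num.sqrt; apply: eq_bigr => i _; rewrite L2norm_sqr. Qed.

Lemma H1normE u : H1norm D u = Num.sqrt (h1ip u u).
Proof.
by congr Num.sqrt; rewrite L2norm_sqr; congr (_ + _); apply: eq_bigr => i _; rewrite L2norm_sqr.
Qed.

Lemma Re_H01ip u v : Re (H01ip D u v) = gradip u v.
Proof. by rewrite /H01ip Re_sum; apply: eq_bigr => i _; rewrite Re_L2ip. Qed.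

Lemma Im_H01ip u v : H1 D u -> H1 D v -> Im (H01ip D u v) = gradip (mulI u) v.
Proof.
move=> hu hv; rewrite /H01ip Im_sum; apply: eq_bigr => i _; rewrite Im_L2ip.
apply: ae_eq_dotL => //; try exact: wgrad_L2.
- by apply: L2_mulI => //; exact: wgrad_L2.
- by apply: wgrad_L2; exact: H1_mulI.
- by apply: filterS (wgrad_mulI_ae i hu) => x h Dx; rewrite h.
- exact: aeW.
Qed.

Lemma H1norm_lin c u v : H1 D u -> H1 D v ->
  H1norm D (lin c u v) <= H1norm D u + `|c| * H1norm D v.
Proof.
rewrite !H1normE; apply: (sip_nrm_lin H1_lin) => *;
  [exact: h1ipC|exact: h1ip_lin|exact: h1ip_ge0].
Qed.

Lemma L2norm_le_H1norm u : L2norm D u <= H1norm D u.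
Proof. by rewrite L2normE H1normE ler_sqrt ?h1ip_ge0// lerDl gradip_ge0. Qed.

Lemma H01norm_le_H1norm u : H01norm D u <= H1norm D u.
Proof. by rewrite H01normE H1normE ler_sqrt ?h1ip_ge0// lerDr dotL_ge0. Qed.

Lemma wgrad_le_H01norm u i : L2norm D (wgrad D u i) <= H01norm D u.
Proof.
rewrite L2normE H01normE ler_sqrt ?gradip_ge0// /gradip (bigD1 i)//= lerDl.
by apply: sumr_ge0 => j _; exact: dotL_ge0.
Qed.

Lemma H01_H1 u : H01 D u -> H1 D u. Proof. by case. Qed.

Lemma test_fun_lin c phi psi : test_fun D phi -> test_fun D psi -> test_fun D (lin c phi psi).
Proof.
move=> /test_funP[a1 a2] /test_funP[b1 b2]; apply/test_funP; split.
  by under eq_fun do rewrite Re_lin; apply: ctestD => //; exact: ctestZ.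
by under eq_fun do rewrite Im_lin; apply: ctestD => //; exact: ctestZ.
Qed.

Lemma test_fun_mulI phi : test_fun D phi -> test_fun D (mulI phi).
Proof.
move=> /test_funP[a1 a2]; apply/test_funP; split.
  under eq_fun do rewrite Re_mulI; have := ctestZ (-1) a2.
  by congr ctest; apply/funext => x; rewrite mulN1r.
by under eq_fun do rewrite Im_mulI.
Qed.

Lemma H01_density u e : H01 D u -> 0 < e ->
  exists2 phi, test_fun D phi & H1norm D (lin (-1) u phi) < e.
Proof. by move=> [_ h] /h[phi tphi]; rewrite sub_lin; exists phi. Qed.

Lemma H01_lin c u v : H01 D u -> H01 D v -> H01 D (lin c u v).
Proof.
move=> hu hv; split; first by apply: H1_lin; exact: H01_H1.
move=> e e0; have c0 : 0 < `|c| + 1 by rewrite ltr_wpDl.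
have [phi tphi uphi] := H01_density hu (divr_gt0 e0 (ltr0Sn R 1)).
have e2 : 0 < e / 2 / (`|c| + 1) by rewrite !divr_gt0.
have [psi tpsi vpsi] := H01_density hv e2.
exists (lin c phi psi); first exact: test_fun_lin.
rewrite sub_lin (_ : lin (-1) _ _ = lin c (lin (-1) u phi) (lin (-1) v psi)); last first.
  by apply/funext => x; apply: complex_ext; rewrite ?Re_lin ?Im_lin ?Re_lin ?Im_lin; ring.
apply: le_lt_trans (H1norm_lin _ _ _) _.
- by apply: H1_lin; [exact: H01_H1|exact: H1_test].
- by apply: H1_lin; [exact: H01_H1|exact: H1_test].
have : `|c| * H1norm D (lin (-1) v psi) <= e / 2.
  apply: (@le_trans _ _ ((`|c| + 1) * (e / 2 / (`|c| + 1)))); last first.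
    by rewrite mulrC divfK// gt_eqF.
  by apply: ler_pM => //; [exact: sqrtr_ge0|rewrite lerDl|exact: ltW].
by move=> h; rewrite [e]splitr ltr_leD.
Qed.

Lemma H01_test phi : test_fun D phi -> H01 D phi.
Proof.
move=> tphi; have hphi := H1_test tphi; split=> // e e0; exists phi => //.
rewrite sub_lin H1normE (_ : h1ip _ _ = 0) ?sqrtr0//.
have hl : H1 D (lin (-1) phi phi) by exact: H1_lin.
have e1 : h1ip (lin (-1) phi phi) phi = 0 by rewrite h1ip_lin// mulN1r subrr.
by rewrite h1ip_lin// !(h1ipC phi) e1 mulr0 addr0.
Qed.

Lemma H1norm_mulI u : H1 D u -> H1norm D (mulI u) = H1norm D u.
Proof.
move=> hu; rewrite [LHS]H1normE [RHS]H1normE.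
have e := @dotL_mulI R n D.
suff -> : h1ip (mulI u) (mulI u) = h1ip u u by [].
rewrite /h1ip e; apply: f_equal.
apply: eq_bigr => i _; rewrite -[RHS]e.
apply: ae_eq_dotL => //.
- by apply: wgrad_L2; exact: H1_mulI.
- by apply: L2_mulI => //; exact: wgrad_L2.
- by apply: wgrad_L2; exact: H1_mulI.
- by apply: L2_mulI => //; exact: wgrad_L2.
- exact: wgrad_mulI_ae.
- exact: wgrad_mulI_ae.
Qed.

Lemma H01_mulI u : H01 D u -> H01 D (mulI u).
Proof.
move=> hu; split; first by apply: H1_mulI; exact: H01_H1.
move=> e e0; have [phi tphi uphi] := H01_density hu e0.
exists (mulI phi); first exact: test_fun_mulI.
rewrite sub_lin (_ : lin (-1) _ _ = mulI (lin (-1) u phi)); last first.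
  apply/funext => x; apply: complex_ext;
    by rewrite ?Re_lin ?Im_lin ?Re_mulI ?Im_mulI ?Re_lin ?Im_lin; ring.
rewrite H1norm_mulI//; apply: H1_lin; [exact: H01_H1|exact: H1_test].
Qed.

Lemma eventually_all (I : finType) (P : I -> nat -> Prop) :
  (forall i, exists N, forall p, (N <= p)%N -> P i p) ->
  exists N, forall p, (N <= p)%N -> forall i, P i p.
Proof.
move=> /choice[N hN]; exists (\max_i N i)%N => p hp i.
by apply: hN; apply: leq_trans hp; exact: leq_bigmax.
Qed.

(** Functions and gradients converge separately in L^2, and the limit of the gradients is a weak
    gradient of the limit by [weak_partial_limit]. *)
Lemma H1_complete : sip_complete (H1 D) lin h1ip.
Proof.
move=> u hu cu.
have cu0 e : 0 < e -> exists N, forall p q, (N <= p)%N -> (N <= q)%N ->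
    Num.sqrt (dotL D (lin (-1) (u p) (u q)) (lin (-1) (u p) (u q))) <= e.
  move=> /cu[N hN]; exists N => p q Np Nq; apply: le_trans (hN p q Np Nq).
  by rewrite ler_sqrt ?h1ip_ge0// lerDl gradip_ge0.
have [v hv uv] := L2_complete oD (fun k => H1_L2 (hu k)) cu0.
(* The chosen gradient of a difference agrees only almost everywhere with the difference of
   gradients; inner products do not see the exception. *)
have gE i p w (g : 'I_n -> 'rV[R]_n -> R[i]) : L2 D w -> is_weak_grad D w g ->
    dotL D (wgrad D (lin (-1) (u p) w) i) (wgrad D (lin (-1) (u p) w) i) =
    dotL D (lin (-1) (wgrad D (u p) i) (g i)) (lin (-1) (wgrad D (u p) i) (g i)).
  move=> hw wg; have hw1 : H1 D w by split=> //; exists g.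
  have L1 : L2 D (wgrad D (lin (-1) (u p) w) i) by apply: wgrad_L2; exact: H1_lin.
  have L2' : L2 D (lin (-1) (wgrad D (u p) i) (g i)).
    have X := wgrad_L2 i (hu p); have Y := is_weak_grad_L2 i wg.
    exact (L2_lin oD (-1) X Y).
  have ae : {ae leb, forall x, D x -> wgrad D (lin (-1) (u p) w) i x = lin (-1) (wgrad D (u p) i) (g i) x}.
    apply: (wgrad_ae (g := fun i => lin (-1) (wgrad D (u p) i) (g i))).
      by apply: L2_lin => //; exact: H1_L2.
    by apply: weak_grad_lin => //; [exact: H1_L2|exact: H1_wgrad].
  exact: ae_eq_dotL.
have ex i : exists g, L2 D g /\ forall e, 0 < e -> exists N, forall p, (N <= p)%N ->
    Num.sqrt (dotL D (lin (-1) (wgrad D (u p) i) g) (lin (-1) (wgrad D (u p) i) g)) <= e.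
  have [||g hg ug] := L2_complete oD (u := fun k => wgrad D (u k) i).
  - by move=> k; exact: wgrad_L2.
  - move=> e /cu[N hN]; exists N => p q Np Nq; apply: le_trans (hN p q Np Nq).
    rewrite ler_sqrt ?h1ip_ge0// -(gE i p (u q) (wgrad D (u q)) (H1_L2 (hu q)) (H1_wgrad (hu q))).
    rewrite /h1ip /gradip (bigD1 i)//= addrCA lerDl addr_ge0 ?dotL_ge0//.
    by apply: sumr_ge0 => j _; exact: dotL_ge0.
  by exists g.
have [g hg] := choice ex.
have wg : is_weak_grad D v g.
  apply/(is_weak_gradP oD bD _ hv) => i; have [Lg ug] := hg i.
  have /(L2P oD)[v1 v2] := hv; have /(L2P oD)[g1 g2] := Lg.
  have Lu k := H1_L2 (hu k); have Lw k := wgrad_L2 i (hu k).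
  have sqs w : L2 D w -> sq D (fun x => Re (w x)) /\ sq D (fun x => Im (w x)).
    by move=> /(L2P oD).
  split=> //.
  - apply: (@weak_partial_limit _ _ _ oD bD i (fun k x => Re (u k x)) (fun k x => Re (wgrad D (u k) i x))) => //.
    + by move=> k; have [] := sqs _ (Lu k).
    + by move=> k; have [] := sqs _ (Lw k).
    + by move=> k; have /(is_weak_gradP oD bD _ (Lu k)) /(_ i)[] := H1_wgrad (hu k).
    + by move=> e /uv[N hN]; exists N => p /hN; apply: le_trans; exact: ipr_Re_le.
    + by move=> e /ug[N hN]; exists N => p /hN; apply: le_trans; exact: ipr_Re_le.
  - apply: (@weak_partial_limit _ _ _ oD bD i (fun k x => Im (u k x)) (fun k x => Im (wgrad D (u k) i x))) => //.
    + by move=> k; have [] := sqs _ (Lu k).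
    + by move=> k; have [] := sqs _ (Lw k).
    + by move=> k; have /(is_weak_gradP oD bD _ (Lu k)) /(_ i)[] := H1_wgrad (hu k).
    + by move=> e /uv[N hN]; exists N => p /hN; apply: le_trans; exact: ipr_Im_le.
    + by move=> e /ug[N hN]; exists N => p /hN; apply: le_trans; exact: ipr_Im_le.
exists v; first by split=> //; exists g.
(* The squared H^1 norm has [1 + n] terms; each being at most [e'^2], the sum is at most [e^2]. *)
move=> e e0; pose e' := e / Num.sqrt (1 + n%:R).
have s0 : 0 < Num.sqrt (1 + n%:R) :> R by rewrite sqrtr_gt0 ltr_pwDl.
have e'0 : 0 < e' by rewrite divr_gt0.
have [N hN] := uv e' e'0.
have [M hM] := eventually_all (P := fun i p => Num.sqrt (dotL D (lin (-1) (wgrad D (u p) i) (g i))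
   (lin (-1) (wgrad D (u p) i) (g i))) <= e') (fun i => (hg i).2 e' e'0).
exists (maxn N M) => p; rewrite geq_max => /andP[/hN h0 /hM h1].
have sqr_le x : 0 <= x -> Num.sqrt x <= e' -> x <= e' ^+ 2.
  by move=> x0 h; rewrite -[x]sqr_sqrtr// lerXn2r ?nnegrE ?sqrtr_ge0// ltW.
have -> : e = Num.sqrt (e' ^+ 2 * (1 + n%:R)).
  by rewrite sqrtrM ?sqr_ge0// sqrtr_sqr gtr0_norm// /e' divfK// gt_eqF.
rewrite ler_sqrt; last by rewrite mulr_ge0 ?sqr_ge0 ?addr_ge0.
rewrite mulrDr mulr1 /h1ip.
apply: lerD; first by apply: sqr_le h0; exact: dotL_ge0.
rewrite /gradip mulr_natr -[X in _ *+ X](card_ord n) -sumr_const; apply: ler_sum => i _.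
by rewrite (gE i p v g hv wg); apply: sqr_le (h1 i); exact: dotL_ge0.
Qed.

Lemma H01_complete_H1 : sip_complete (H01 D) lin h1ip.
Proof.
move=> u hu cu; have [v hv uv] := H1_complete (fun k => H01_H1 (hu k)) cu.
exists v => //; split=> // e e0; have e2 : 0 < e / 2 by rewrite divr_gt0.
have [N /(_ N (leqnn N)) hN] := uv _ e2.
have [phi tphi hphi] := H01_density (hu N) e2.
exists phi => //; have hp := H1_test tphi; have hN1 := H01_H1 (hu N).
rewrite sub_lin (_ : lin (-1) v phi = lin (-1) (lin (-1) (u N) phi) (lin (-1) (u N) v)); last first.
  by apply/funext => x; apply: complex_ext; rewrite ?Re_lin ?Im_lin ?Re_lin ?Im_lin; ring.
apply: le_lt_trans (H1norm_lin _ _ _) _; [exact: H1_lin|exact: H1_lin|].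
have h2 : H1norm D (lin (-1) (u N) v) <= e / 2 by rewrite H1normE; exact: hN.
rewrite normrN normr1 mul1r [ltRHS]splitr; exact: ltr_leD hphi h2.
Qed.

End sobolev_space.

(** * Inequalities for compactly supported smooth functions *)

Section compactly_supported.
Context (R : realType).
Local Notation mu := (@lebesgue_measure R).

(** The support lies in a cube of fixed half-side [M], so that slices stay in the class with the
    same [M] and inductions on the dimension have uniform constants. *)
Definition csm n (M : R) (f : 'rV[R]_n -> R) :=
  smooth f /\ forall x, ~ cube n M x -> f x = 0.
Arguments csm : clear implicits.

Definition slice n (f : 'rV[R]_n.+1 -> R) (t : R) : 'rV[R]_n -> R :=
  fun x => f (cons_rV (x, t)).

Lemma continuous_cons n (t : R) : continuous (fun x : 'rV[R]_n => cons_rV (x, t)).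
Proof.
suff h (x : 'rV[R]_n) : cons_rV (y, t) @[y --> x] --> cons_rV (x, t) by exact: h.
move=> A /nbhs_ballP[e /= e0 eA]; apply/nbhs_ballP; exists e => //= y.
move=> /ball_rVE => /(_ e0) xy; apply: eA.
apply/ball_rVE => // i.
case: (unliftP ord0 i) => [j|] ->; rewrite ?cons_rVS ?cons_rV0; first exact: xy.
by rewrite subrr normr0.
Qed.

Lemma cons_rV_line n (x : 'rV[R]_n) t (j : 'I_n) h :
  cons_rV (h *: delta_mx ord0 j + x, t) = h *: delta_mx ord0 (lift ord0 j) + cons_rV (x, t).
Proof.
apply/rowP => i; case: (unliftP ord0 i) => [k|] ->; rewrite [RHS]mxE.
  by rewrite !cons_rVS !mxE (inj_eq lift_inj).
by rewrite !cons_rV0 !mxE mulr0 add0r.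
Qed.

Lemma is_derive_slice n (f : 'rV[R]_n.+1 -> R) t (j : 'I_n) x :
  derivable f (cons_rV (x, t)) (delta_mx ord0 (lift ord0 j)) ->
  is_derive x (delta_mx ord0 j) (slice f t) (partial (lift ord0 j) f (cons_rV (x, t))).
Proof.
move=> df.
have e : (fun h => h^-1 *: ((slice f t \o shift x) (h *: delta_mx ord0 j) - slice f t x)) =
    (fun h : R => h^-1 *: ((f \o shift (cons_rV (x, t))) (h *: delta_mx ord0 (lift ord0 j)) - f (cons_rV (x, t)))).
  by apply/funext => h /=; rewrite /slice /shift cons_rV_line.
by split; rewrite /derivable /derive /partial ?e.
Qed.

Lemma partial_slice n (f : 'rV[R]_n.+1 -> R) t (j : 'I_n) : smooth f ->
  partial j (slice f t) = slice (partial (lift ord0 j) f) t.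
Proof.
move=> sf; apply/funext => x; rewrite /partial.
by have [_ ->] := is_derive_slice (@smooth_derivable _ _ _ sf (lift ord0 j) (cons_rV (x, t))).
Qed.

Lemma smooth_slice n (f : 'rV[R]_n.+1 -> R) t : smooth f -> smooth (slice f t).
Proof.
move=> sf; pose B g := exists2 f : 'rV[R]_n.+1 -> R, smooth f & g = slice f t.
apply: (@smooth_alg _ _ B); last by apply: alg_base; exists f.
move=> _ [{sf}f sf ->]; split=> [x|j].
  apply: (@continuous_comp _ _ _ (fun x => cons_rV (x, t)) f x).
    exact: continuous_cons.
  exact: smooth_continuous.
split=> [x|].
  by have [] := is_derive_slice (@smooth_derivable _ _ _ sf (lift ord0 j) (cons_rV (x, t))).
rewrite (partial_slice t j sf); apply: alg_base; exists (partial (lift ord0 j) f); last by [].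
exact: (smooth_partial (lift ord0 j) sf).
Qed.

Lemma csm_slice n M (f : 'rV[R]_n.+1 -> R) t : csm n.+1 M f -> csm n M (slice f t).
Proof.
move=> [sf f0]; split; first exact: smooth_slice.
move=> x nx; apply: f0 => h; apply: nx => i.
by have := h (lift ord0 i); rewrite cons_rVS.
Qed.

Lemma csm_smooth n M (f : 'rV[R]_n -> R) : csm n M f -> smooth f. Proof. by case. Qed.

Lemma csm_partial n M (f : 'rV[R]_n -> R) i : csm n M f -> csm n M (partial i f).
Proof.
move=> [sf f0]; split; first exact: smooth_partial.
move=> x /existsNP[j /negP]; rewrite -ltNge => xj.
rewrite /partial (@near_eq_derive _ _ _ f (fun=> 0)) ?derive_cst//.
have e0 : 0 < `|x ord0 j| - M by rewrite subr_gt0.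
apply/nbhs_ballP; exists (`|x ord0 j| - M) => //= y /ball_rVE => /(_ e0 j) xy.
apply: f0 => /(_ j) yM; move: xy; rewrite distrC => xy.
by have := ler_normD (x ord0 j - y ord0 j) (y ord0 j); rewrite subrK; lra.
Qed.

Lemma csmM n M (f g : 'rV[R]_n -> R) : csm n M f -> smooth g -> csm n M (fun x => f x * g x).
Proof.
by move=> [sf f0] sg; split; [exact: smoothM|move=> x /f0 ->; rewrite mul0r].
Qed.

(** In a slightly larger open cube the support is compact, so the results on test functions
    apply. *)
Lemma csm_ctest n M (f : 'rV[R]_n -> R) : csm n M f -> ctest (box 0 (`|M| + 1)) f.
Proof.
move=> [sf f0]; split=> //; exists (cbox (const_mx (- M)) (const_mx M)); split.
- have -> : cbox (const_mx (- M)) (const_mx M) =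
      [set v : 'rV[R]_n | forall i, `[- M, M]%classic (v ord0 i)].
    by apply/seteqP; split=> x /= h i; have := h i; rewrite !mxE /= in_itv.
  apply: (@rV_compact R n (fun i => `[- M, M]%classic)) => i.
  exact: segment_compact.
- move=> x h i; have := h i; rewrite !mxE subr0 -ler_norml => xM.
  by rewrite (le_lt_trans xM)// (le_lt_trans (ler_norm M))// ltrDl.
- move=> x nx; apply: f0 => h; apply: nx => i.
  by rewrite !mxE -ler_norml; exact: h.
Qed.

Lemma csm_bounded n M (f : 'rV[R]_n -> R) : csm n M f -> exists C, forall x, `|f x| <= C.
Proof. by move=> /csm_ctest; exact: ctest_bounded. Qed.

Lemma csm_ig n M (f : 'rV[R]_n -> R) : csm n M f -> ig setT f.
Proof.
move=> cf; have [C hC] := csm_bounded cf.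
have ic : ig setT (fun x => C * \1_(cube n M) x).
  apply: igZ; first exact: openT.
  have mc := @measurable_cube R n M.
  apply/integrableP; split; first exact/measurable_EFinP/measurable_indic.
  rewrite (eq_integral (fun x => (\1_(cube n M) x)%:E)); last first.
    by move=> x _ /=; rewrite ger0_norm.
  by rewrite integral_indic// setIT leb_cube_lty.
apply: (ig_le openT _ ic); first exact: smooth_measurable (csm_smooth cf).
move=> x _; rewrite indicE; have [Mx|nMx] := pselect (cube n M x).
  by rewrite mem_set// mulr1.
by rewrite memNset// mulr0 (cf.2 _ nMx) normr0.
Qed.

Lemma csm_sq n M (f : 'rV[R]_n -> R) : csm n M f -> sq setT f.
Proof.
move=> cf; split; first exact: smooth_measurable (csm_smooth cf).
apply: (eq_ig openT _ (csm_ig (csmM cf (csm_smooth cf)))) => x _.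
by rewrite expr2.
Qed.

Definition nT n (f : 'rV[R]_n -> R) := Num.sqrt (ipr setT f f).

Lemma nT_sqr n (f : 'rV[R]_n -> R) : nT f ^+ 2 = ipr setT f f.
Proof. by rewrite sqr_sqrtr// ipr_ge0. Qed.

Lemma integral_sqr n M (f : 'rV[R]_n -> R) : csm n M f ->
  (\int[leb]_x (f x ^+ 2)%:E = (nT f ^+ 2)%:E)%E.
Proof. by move=> cf; rewrite nT_sqr ipr_EFin//; [exact: openT|exact: csm_sq cf]. Qed.

(** The derivative of f^2 is 2 f times that of f; then Cauchy-Schwarz. *)
Lemma integral_abs_partial_sqr n M (f : 'rV[R]_n -> R) i : csm n M f ->
  (\int[leb]_x `|partial i (fun y => f y * f y) x|%:E <= (2 * nT f * nT (partial i f))%:E)%E.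
Proof.
move=> cf; have sf := csm_smooth cf.
pose af x := `|f x|; pose ag x := `|partial i f x|.
have sabs g : sq setT g -> sq setT (fun x => `|g x|).
  move=> [mg hg]; split; first exact: measurableT_comp.
  by apply: (eq_ig openT _ hg) => x _; rewrite real_normK ?num_real.
have sqf : sq setT af by apply: sabs; exact: csm_sq cf.
have sqg : sq setT ag by apply: sabs; exact: csm_sq (csm_partial i cf).
have e1 : ipr setT af af = ipr setT f f.
  by apply: eq_Rintegral => x _; rewrite /af -!expr2 real_normK ?num_real.
have e2 : ipr setT ag ag = ipr setT (partial i f) (partial i f).
  by apply: eq_Rintegral => x _; rewrite /ag -!expr2 real_normK ?num_real.
have := ipr_cs openT sqf sqg; rewrite e1 e2 => /(le_trans (ler_norm _)) h.
rewrite partialM//.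
have ip : ig setT (fun x => af x * ag x) by exact: (sqM openT sqf sqg).
have -> : (\int[leb]_x `|f x * partial i f x + f x * partial i f x|%:E =
           (2 * ipr setT af ag)%:E)%E.
  rewrite (eq_integral (EFin \o (fun x => 2 * (af x * ag x)))); last first.
    move=> x _ /=; set y := f x * _; have -> : y + y = 2 * y by ring.
    by rewrite !normrM normr_nat.
  rewrite -(fineK (integrable_fin_num measurableT (igZ openT 2 ip))); congr (_%:E).
  by rewrite -[LHS]/(\int[leb]_x (2 * (af x * ag x))) RintegralZl.
by rewrite lee_fin -mulrA ler_pM2l.
Qed.

Lemma csm_le_line n M (F : 'rV[R]_n -> R) i x t : csm n M F ->
  (`|F (upd i x t)|%:E <= \int[mu]_s `|partial i F (upd i x s)|%:E)%E.
Proof.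
move=> cF; have sF := csm_smooth cF.
have [h1 h2 _] := ctest_line i x (csm_ctest cF).
apply: (le_integral_abs_derivT h1 h2 (M := M)) => s Ms.
by apply: cF.2 => /(_ i); rewrite upd_coord leNgt Ms.
Qed.

Lemma measurable_abs_partial n (F : 'rV[R]_n -> R) i : smooth F ->
  measurable_fun [set: 'rV[R]_n] (fun x => `|partial i F x|%:E).
Proof.
move=> sF; apply/measurable_EFinP; apply: measurableT_comp => //.
by apply: smooth_measurable; exact: smooth_partial.
Qed.

(** On a line in direction [i], f^2 is at most the integral of |d_i(f^2)| and vanishes off a segment
    of length [2 * M]. Integration bounds the squared norm by [4 * M] times the product of the norms
    of [f] and of its derivative, and one factor cancels. *)
Lemma csm_poincare n M (f : 'rV[R]_n -> R) i : 0 <= M -> csm n M f ->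
  nT f <= 4 * M * nT (partial i f).
Proof.
move=> M0 cf; have sf := csm_smooth cf; have cF := csmM cf sf.
set F := (fun x => f x * f x) in cF.
have : (\int[leb]_x (F x)%:E <= \int[leb]_x (2 * M * `|partial i F x|)%:E)%E.
  apply: (le_integral_lines (i := i)).
  - by apply/measurable_EFinP; apply: smooth_measurable; exact: csm_smooth cF.
  - apply/measurable_EFinP; apply: measurable_funM => //; apply: measurableT_comp => //.
    apply: smooth_measurable; apply: smooth_partial; exact: csm_smooth cF.
  - by move=> x; rewrite lee_fin /F -expr2 sqr_ge0.
  - by move=> x; rewrite lee_fin !mulr_ge0.
  move=> x; set K := (\int[mu]_s `|partial i F (upd i x s)|%:E)%E.
  have K0 : (0 <= K)%E by apply: integral_ge0.
  have mFe : measurable_fun [set: 'rV[R]_n] (fun y => (F y)%:E).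
    by apply/measurable_EFinP; apply: smooth_measurable; exact: csm_smooth cF.
  have mup : measurable_fun [set: R] (upd i x) by exact: measurable_upd.
  have -> : (\int[mu]_t (2 * M * `|partial i F (upd i x t)|)%:E = (2 * M)%:E * K)%E.
    under eq_integral do rewrite EFinM.
    rewrite ge0_integralZl_EFin ?mulr_ge0//.
    exact: (measurableT_comp (measurable_abs_partial i (csm_smooth cF)) mup).
  apply: (@le_trans _ _ (\int[mu]_(t in `[(- M)%R, M]) K)%E).
    rewrite [leRHS]integral_mkcond; apply: ge0_le_integral => //.
    - by move=> t _; rewrite lee_fin /F -expr2 sqr_ge0.
    - exact: (measurableT_comp mFe mup).
    - by apply/(measurable_restrictT _ _).1 => //; exact: measurable_cst.
    move=> t _; rewrite patchE; case: ifPn => [_|].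
      by apply: le_trans (csm_le_line i x t cF); rewrite lee_fin ler_norm.
    rewrite notin_setE /= in_itv/= -ler_norml => /negP; rewrite -ltNge => Mt.
    by rewrite cF.2// => /(_ i); rewrite upd_coord leNgt Mt.
  rewrite integral_cst// muleC; apply: lee_wpmul2r => //.
  suff : (@lebesgue_measure R [set` `[(- M)%R, M]%R] <= (2 * M)%:E)%E by exact.
  rewrite lebesgue_measure_itv/=.
  by case: ifP => _; rewrite -?EFinB lee_fin ?mulr_ge0//; lra.
rewrite (eq_integral (fun x => (f x ^+ 2)%:E)); last by move=> x _; rewrite expr2.
rewrite (integral_sqr cf) => h1.
have {h1} : ((nT f ^+ 2)%:E <= (2 * M)%:E * (2 * nT f * nT (partial i f))%:E)%E.
  apply: (le_trans h1); under eq_integral do rewrite EFinM.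
  rewrite ge0_integralZl_EFin ?mulr_ge0//; last exact: measurable_abs_partial (csm_smooth cF).
  by apply: lee_wpmul2l; [rewrite lee_fin mulr_ge0|exact: integral_abs_partial_sqr cf].
rewrite -EFinM lee_fin.
have : 0 <= nT f by exact: sqrtr_ge0.
rewrite le_eqVlt => /predU1P[<- _|f0]; first by rewrite !mulr_ge0// sqrtr_ge0.
have -> : 2 * M * (2 * nT f * nT (partial i f)) = (4 * M * nT (partial i f)) * nT f by ring.
by rewrite expr2 ler_pM2r.
Qed.

End compactly_supported.
Arguments csm {R} n M f.

Section arithmetic.
Context (R : realType).
Implicit Types a b c g s K M : R.

Lemma amgm_slices s a b K : 0 <= a -> 0 <= b -> s ^+ 2 <= K ->
  2 * s * a * (2 * s * b) <= 2 * K * (a ^+ 2 + b ^+ 2).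
Proof.
move=> a0 b0 h.
have -> : 2 * s * a * (2 * s * b) = s ^+ 2 * (4 * (a * b)) by ring.
have -> : 2 * K * (a ^+ 2 + b ^+ 2) = K * (2 * (a ^+ 2 + b ^+ 2)) by ring.
apply: ler_pM => //; first exact: sqr_ge0.
  by rewrite !mulr_ge0.
by have := sqr_ge0 (a - b); rewrite sqrrB -mulr_natr; move: (a * b) => c; lra.
Qed.

Lemma ladyzhenskaya2_arith s a b g M : 0 <= M -> 0 <= s -> 0 <= a -> 0 <= b -> a <= g -> b <= g ->
  s <= 4 * M * a -> 2 * s * a * (2 * s * b) <= 16 * M * s * g ^+ 3.
Proof.
move=> M0 s0 a0 b0 ag bg sM; have g0 := le_trans a0 ag.
have -> : 2 * s * a * (2 * s * b) = s * (4 * (s * (a * b))) by ring.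
have -> : 16 * M * s * g ^+ 3 = s * (4 * (4 * M * g * (g * g))) by ring.
rewrite ler_wpM2l// ler_wpM2l// ler_pM ?mulr_ge0//; last by rewrite ler_pM.
by apply: le_trans sM _; rewrite ler_wpM2l ?mulr_ge0.
Qed.

Lemma ladyzhenskaya3_arith s a b c g : 0 <= s -> 0 <= a -> 0 <= b -> 0 <= c ->
  a <= g -> b <= g -> c <= g -> 2 * (2 * s * a) * (b ^+ 2 + c ^+ 2) <= 8 * s * g ^+ 3.
Proof.
move=> s0 a0 b0 c0 ag bg cg; have g0 := le_trans a0 ag.
have -> : 2 * (2 * s * a) * (b ^+ 2 + c ^+ 2) = s * (4 * (a * (b ^+ 2 + c ^+ 2))) by ring.
have -> : 8 * s * g ^+ 3 = s * (4 * (g * (g ^+ 2 + g ^+ 2))) by ring.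
rewrite ler_wpM2l// ler_wpM2l// ler_pM ?addr_ge0 ?sqr_ge0//.
by rewrite lerD// lerXn2r ?nnegrE.
Qed.

End arithmetic.

(** * Ladyzhenskaya's inequalities in dimensions 2 and 3 *)

Section ladyzhenskaya.
Context (R : realType).
Local Notation mu := (@lebesgue_measure R).

(** [leb 0] is a Dirac mass, so integration over the one-dimensional space is integration along a
    line. *)
Lemma leb1_line (g : 'rV[R]_1 -> \bar R) x :
  measurable_fun [set: 'rV[R]_1] g -> (forall y, 0 <= g y)%E ->
  (\int[leb]_y g y = \int[mu]_s g (upd ord0 x s))%E.
Proof.
move=> mg g0; rewrite leb_tonelli1//= integral_dirac//; last exact: measurable_tonelli1.
rewrite diracT mul1e; apply: eq_integral => s _; congr g.
apply/rowP => i; rewrite (ord1 i) upd_coord.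
by rewrite cons_rV0.
Qed.

Let i0 : 'I_2 := ord0.
Let i1 : 'I_2 := lift ord0 ord0.

Lemma csm_le_line0 n M (F : 'rV[R]_n.+1 -> R) x t : csm n.+1 M F ->
  (`|F (cons_rV (x, t))|%:E <= \int[mu]_s `|partial ord0 F (cons_rV (x, s))|%:E)%E.
Proof.
move=> cF; have := csm_le_line ord0 (cons_rV (x, t)) t cF.
have e : (\int[mu]_s `|partial ord0 F (upd ord0 (cons_rV (x, t)) s)|%:E =
    \int[mu]_s `|partial ord0 F (cons_rV (x, s))|%:E)%E.
  by apply: eq_integral => s _; rewrite upd_cons0.
by rewrite upd_cons0 e.
Qed.

Lemma csm_le_line1 M (F : 'rV[R]_2 -> R) x t : csm 2 M F ->
  (`|F (cons_rV (x, t))|%:E <= \int[leb]_y `|partial i1 F (cons_rV (y, t))|%:E)%E.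
Proof.
move=> cF; have := csm_le_line i1 (cons_rV (x, t)) (x ord0 ord0) cF.
rewrite /i1 upd_consS upd_id => h; apply: (le_trans h) => {h}.
have e : (\int[mu]_s `|partial i1 F (upd i1 (cons_rV (x, t)) s)|%:E =
    \int[mu]_s `|partial i1 F (cons_rV (upd ord0 x s, t))|%:E)%E.
  by apply: eq_integral => s _; rewrite upd_consS.
have mp := measurable_abs_partial i1 (csm_smooth cF).
pose g (y : 'rV[R]_1) := `|partial i1 F (cons_rV (y, t))|%:E.
have mg : measurable_fun [set: 'rV[R]_1] g.
  apply: (measurableT_comp mp).
  apply: measurableT_comp; first exact: measurable_cons_rV.
  exact: measurable_pair2.
have g0 y : (0 <= g y)%E by rewrite /g lee_fin normr_ge0.
rewrite e; have <- := leb1_line x mg g0; exact: lexx.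
Qed.

(** f^4 is the product of two copies of f^2. One is bounded by an integral along the first
    coordinate, a function [A] of the second; the other by an integral along the second, a function
    [B] of the first. The double integral of their product factorizes. *)
Lemma ladyzhenskaya2 M (f : 'rV[R]_2 -> R) : csm 2 M f ->
  (\int[leb]_x (f x ^+ 4)%:E <=
   ((2 * nT f * nT (partial i0 f)) * (2 * nT f * nT (partial i1 f)))%:E)%E.
Proof.
move=> cf; have sf := csm_smooth cf; have cF := csmM cf sf.
set F := (fun x => f x * f x) in cF; have sF := csm_smooth cF.
pose A (x : 'rV[R]_1) := (\int[mu]_s `|partial i0 F (cons_rV (x, s))|%:E)%E.
pose B t := (\int[leb]_y `|partial i1 F (cons_rV (y, t))|%:E)%E.
have A0 x : (0 <= A x)%E by exact: integral_ge0.
have B0 t : (0 <= B t)%E by exact: integral_ge0.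
have mp0 := measurable_abs_partial i0 sF; have mp1 := measurable_abs_partial i1 sF.
have p0 (i : 'I_2) y : (0 <= `|partial i F y|%:E)%E by [].
have mA : measurable_fun [set: 'rV[R]_1] A by exact: (measurable_tonelli1 mp0 (p0 i0)).
have mB : measurable_fun [set: R] B by exact: (measurable_tonelli2 mp1 (p0 i1)).
have intA : (\int[leb]_x A x = \int[leb]_x `|partial i0 F x|%:E)%E.
  exact: (esym (leb_tonelli1 mp0 (p0 i0))).
have intB : (\int[mu]_t B t = \int[leb]_x `|partial i1 F x|%:E)%E.
  exact: (esym (leb_tonelli2 mp1 (p0 i1))).
have mf4 : measurable_fun [set: 'rV[R]_2] (fun x => (f x ^+ 4)%:E).
  by apply/measurable_EFinP; apply: measurable_funX; exact: smooth_measurable.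
have f40 x : (0 <= (f x ^+ 4)%:E)%E by rewrite lee_fin exprn_even_ge0.
rewrite leb_tonelli1//.
apply: (@le_trans _ _ (\int[leb]_x (A x * \int[mu]_t B t))%E).
  apply: ge0_le_integral => //.
  - by move=> x _; exact: integral_ge0.
  - exact: (measurable_tonelli1 mf4 f40).
  - apply: emeasurable_funM; [exact: mA|exact: measurable_cst].
  move=> x _; rewrite -ge0_integralZl//.
  apply: ge0_le_integral => //.
  - apply: (measurableT_comp mf4); apply: measurableT_comp; first exact: measurable_cons_rV.
    exact: measurable_pair1.
  - apply: emeasurable_funM; [exact: measurable_cst|exact: mB].
  move=> t _; have -> : (f (cons_rV (x, t)) ^+ 4)%:E = (`|F (cons_rV (x, t))|%:E * `|F (cons_rV (x, t))|%:E)%E.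
    by rewrite -EFinM; congr (_%:E); rewrite -expr2 real_normK ?num_real// /F; ring.
  apply: lee_pmul => //; rewrite ?lee_fin//; [exact: csm_le_line0 cF|exact: csm_le_line1 cF].
rewrite ge0_integralZr//; last exact: integral_ge0.
rewrite intA intB EFinM; apply: lee_pmul; try exact: integral_ge0.
  exact: integral_abs_partial_sqr cf.
exact: integral_abs_partial_sqr cf.
Qed.

Let j0 : 'I_3 := ord0.
Let j1 : 'I_3 := lift ord0 i0.
Let j2 : 'I_3 := lift ord0 i1.

Lemma integral_slice_sqr n M (f : 'rV[R]_n.+1 -> R) : csm n.+1 M f ->
  (\int[mu]_t (nT (slice f t) ^+ 2)%:E = (nT f ^+ 2)%:E)%E.
Proof.
move=> cf; rewrite -(integral_sqr cf) leb_tonelli2.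
- by apply: eq_integral => t _; rewrite -(integral_sqr (csm_slice t cf)).
- by apply/measurable_EFinP; apply: measurable_funX; exact: smooth_measurable (csm_smooth cf).
- by move=> x; rewrite lee_fin sqr_ge0.
Qed.

Lemma measurable_slice_sqr n M (f : 'rV[R]_n.+1 -> R) : csm n.+1 M f ->
  measurable_fun [set: R] (fun t => (nT (slice f t) ^+ 2)%:E).
Proof.
move=> cf; have -> : (fun t => (nT (slice f t) ^+ 2)%:E) = (fun t => \int[leb]_x (f (cons_rV (x, t)) ^+ 2)%:E)%E.
  by apply/funext => t; rewrite -(integral_sqr (csm_slice t cf)).
apply: (measurable_tonelli2 (f := fun x => (f x ^+ 2)%:E)).
  by apply/measurable_EFinP; apply: measurable_funX; exact: smooth_measurable (csm_smooth cf).
by move=> x; rewrite lee_fin sqr_ge0.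
Qed.

(** Bounding f^2 pointwise by the line integral of |d_0(f^2)| gives a bound uniform in [t], which
    the passage from dimension 2 to dimension 3 requires. *)
Lemma slice_sqr_le n M (f : 'rV[R]_n.+1 -> R) t : csm n.+1 M f ->
  nT (slice f t) ^+ 2 <= 2 * nT f * nT (partial ord0 f).
Proof.
move=> cf; have sf := csm_smooth cf; have cF := csmM cf sf.
rewrite -lee_fin -(integral_sqr (csm_slice t cf)).
apply: le_trans (integral_abs_partial_sqr ord0 cf).
have mp := measurable_abs_partial ord0 (csm_smooth cF).
rewrite leb_tonelli1//; apply: ge0_le_integral => //.
- by move=> x _; rewrite lee_fin sqr_ge0.
- apply/measurable_EFinP; apply: measurable_funX.
  exact: smooth_measurable (csm_smooth (csm_slice t cf)).
- exact: (measurable_tonelli1 mp (fun _ => normr_ge0 _)).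
move=> x _; apply: le_trans (csm_le_line0 x t cF); rewrite lee_fin.
by rewrite /slice expr2 ler_norm.
Qed.

(** The planar inequality on each slice produces the squared norm of the slice, bounded uniformly by
    [slice_sqr_le], times a product of two derivative norms; the product is split into squares,
    which integrate over the slices. *)
Lemma ladyzhenskaya3 M (f : 'rV[R]_3 -> R) : csm 3 M f ->
  (\int[leb]_x (f x ^+ 4)%:E <=
   (2 * (2 * nT f * nT (partial j0 f)) * (nT (partial j1 f) ^+ 2 + nT (partial j2 f) ^+ 2))%:E)%E.
Proof.
move=> cf; have sf := csm_smooth cf.
have mf4 : measurable_fun [set: 'rV[R]_3] (fun x => (f x ^+ 4)%:E).
  by apply/measurable_EFinP; apply: measurable_funX; exact: smooth_measurable.
have f40 x : (0 <= (f x ^+ 4)%:E)%E by rewrite lee_fin exprn_even_ge0.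
rewrite leb_tonelli2//.
set K := 2 * nT f * nT (partial j0 f).
have K0 : 0 <= K by rewrite !mulr_ge0 ?sqrtr_ge0.
have c1 := csm_partial j1 cf; have c2 := csm_partial j2 cf.
apply: (@le_trans _ _ (\int[mu]_t ((2 * K)%:E *
   ((nT (slice (partial j1 f) t) ^+ 2)%:E + (nT (slice (partial j2 f) t) ^+ 2)%:E)))%E).
  apply: ge0_le_integral => //.
  - by move=> t _; exact: integral_ge0.
  - exact: (measurable_tonelli2 mf4 f40).
  - apply: emeasurable_funM; first exact: measurable_cst.
    apply: emeasurable_funD; [exact: (measurable_slice_sqr c1)|exact: (measurable_slice_sqr c2)].
  move=> t _; apply: le_trans (ladyzhenskaya2 (csm_slice t cf)) _.
  rewrite !partial_slice// -/j1 -/j2 -EFinD -EFinM lee_fin.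
  have h : nT (slice f t) ^+ 2 <= K := slice_sqr_le t cf.
  by apply: amgm_slices => //; exact: sqrtr_ge0.
pose G t := ((nT (slice (partial j1 f) t) ^+ 2)%:E + (nT (slice (partial j2 f) t) ^+ 2)%:E)%E.
have G0 t : (0 <= G t)%E by rewrite /G adde_ge0// lee_fin sqr_ge0.
have mG : measurable_fun [set: R] G.
  apply: emeasurable_funD; [exact: (measurable_slice_sqr c1)|exact: (measurable_slice_sqr c2)].
have K2 : 0 <= 2 * K by rewrite mulr_ge0.
have -> : (\int[mu]_t ((2 * K)%:E * G t) = (2 * K)%:E * \int[mu]_t G t)%E.
  by apply: ge0_integralZl_EFin.
have -> : (\int[mu]_t G t = (nT (partial j1 f) ^+ 2 + nT (partial j2 f) ^+ 2)%:E)%E.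
  rewrite EFinD; have e1 := integral_slice_sqr c1; have e2 := integral_slice_sqr c2.
  apply: etrans (f_equal2 (fun x y => x + y)%E e1 e2); apply: ge0_integralD.
  - by [].
  - by move=> t _; rewrite lee_fin sqr_ge0.
  - exact: (measurable_slice_sqr c1).
  - by move=> t _; rewrite lee_fin sqr_ge0.
  - exact: (measurable_slice_sqr c2).
by rewrite -EFinM.
Qed.

(* The planar case is reduced to the same bound by Poincare's inequality. *)
Lemma ladyzhenskaya m M : 0 <= M -> m.+2 = 2%N \/ m.+2 = 3%N ->
  exists2 C, 0 <= C & forall f : 'rV[R]_m.+2 -> R, csm m.+2 M f ->
  (\int[leb]_x (f x ^+ 4)%:E <=
    (C * nT f * Num.sqrt (\sum_i nT (partial i f) ^+ 2) ^+ 3)%:E)%E.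
Proof.
have le_g m' (f : 'rV[R]_m' -> R) i : nT (partial i f) <= Num.sqrt (\sum_i nT (partial i f) ^+ 2).
  rewrite -[leLHS]ger0_norm ?sqrtr_ge0// -sqrtr_sqr; apply: ler_wsqrtr.
  by rewrite (bigD1 i)//= lerDl; apply: sumr_ge0 => j _; exact: sqr_ge0.
have nT0 m' (f : 'rV[R]_m' -> R) : 0 <= nT f by exact: sqrtr_ge0.
move=> M0 [[m0]|[m1]]; [rewrite m0|rewrite m1].
  exists (16 * M); first by rewrite mulr_ge0.
  move=> f cf; apply: (le_trans (ladyzhenskaya2 cf)); rewrite lee_fin.
  apply: ladyzhenskaya2_arith => //; exact: csm_poincare.
exists 8 => // f cf; apply: (le_trans (ladyzhenskaya3 cf)); rewrite lee_fin.
exact: ladyzhenskaya3_arith.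
Qed.

End ladyzhenskaya.

(** * Averages over intervals, grids and slices *)

Section averages.
Context (R : realType).
Local Notation mu := (@lebesgue_measure R).

Lemma continuous_sqr (g : R -> R) : continuous g -> continuous (fun x => g x ^+ 2).
Proof. by move=> cg x; exact: (@continuousM _ _ g g x (cg x) (cg x)). Qed.

Lemma continuous_segment_integrable (h : R -> R) a b : continuous h ->
  mu.-integrable `[a, b] (EFin \o h).
Proof.
move=> ch; apply: continuous_compact_integrable; first exact: segment_compact.
exact: continuous_subspaceT.
Qed.

Lemma Rint_segment_cst (a b c : R) : a <= b -> \int[mu]_(x in `[a, b]) c = c * (b - a).
Proof.
move=> ab; rewrite Rintegral_cst//; congr (_ * _).
suff h : mu `[a, b]%classic = (b - a)%:E by exact: (congr1 fine h).
rewrite lebesgue_measure_itv/= lte_fin; move: ab; rewrite le_eqVlt => /predU1P[->|->].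
  by rewrite ltxx subrr.
by rewrite EFinB.
Qed.

(** Expansion of the nonnegative integral of (g - m)^2, with [m] the mean value of [g]. *)
Lemma sqr_integral_le (g : R -> R) a b : a < b -> continuous g ->
  (\int[mu]_(x in `[a, b]) g x) ^+ 2 <= (b - a) * \int[mu]_(x in `[a, b]) (g x ^+ 2).
Proof.
move=> ab cg; set I := \int[mu]_(x in _) g x; set S := \int[mu]_(x in _) (_ ^+ 2).
have e0 : 0 < b - a by rewrite subr_gt0.
have cg2 : continuous (fun x => g x ^+ 2).
  exact: continuous_sqr.
have ig1 := continuous_segment_integrable a b cg.
have ig2 := continuous_segment_integrable a b cg2.
pose m := I / (b - a).
have cm : continuous (fun x => g x ^+ 2 + (- (2 * m)) * g x).
  move=> x; apply: (@continuousD _ _ _ (fun x => g x ^+ 2) (fun x => (- (2 * m)) * g x)); first exact: cg2.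
  by apply: (@continuousM _ _ (cst (- (2 * m))) g); [exact: cst_continuous|exact: cg].
have : 0 <= \int[mu]_(x in `[a, b]) ((g x ^+ 2 + (- (2 * m)) * g x) + m ^+ 2).
  apply: Rintegral_ge0 => x _; rewrite (_ : _ + _ = (g x - m) ^+ 2) ?sqr_ge0//.
  by ring.
have icst c : mu.-integrable `[a, b] (EFin \o (fun=> c)).
  by apply: continuous_segment_integrable; exact: cst_continuous.
rewrite RintegralD//; last exact: continuous_segment_integrable.
rewrite RintegralD//; last first.
  apply: continuous_segment_integrable => x.
  by apply: (@continuousM _ _ (cst (- (2 * m))) g); [exact: cst_continuous|exact: cg].
rewrite RintegralZl// -/I -/S (Rint_segment_cst _ (ltW ab)) => h.
have {h} : 0 <= S - I ^+ 2 / (b - a).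
  apply: (le_trans h); rewrite /m le_eqVlt; apply/orP; left; apply/eqP.
  by field; rewrite gt_eqF.
by rewrite subr_ge0 ler_pdivrMr// mulrC.
Qed.

Lemma sqr_dist_line (g dg : R -> R) a b s t :
  (forall t, is_derive t (1 : R) g (dg t)) -> continuous dg -> a < b ->
  s \in `[a, b] -> t \in `[a, b] ->
  (((g s - g t) ^+ 2)%:E <= (b - a)%:E * \int[mu]_(x in `[a, b]) (dg x ^+ 2)%:E)%E.
Proof.
move=> gd cdg ab sI tI; have := le_integral_abs_deriv gd cdg sI tI.
have cn : continuous (fun x => `|dg x|).
  by move=> x; apply: (@continuous_comp _ _ _ dg Num.norm); [exact: cdg|exact: norm_continuous].
have cs : continuous (fun x => dg x ^+ 2).
  exact: continuous_sqr.
rewrite -(fineK (integrable_fin_num _ (continuous_segment_integrable a b cn)))//.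
rewrite -(fineK (integrable_fin_num _ (continuous_segment_integrable a b cs)))//.
rewrite -EFinM !lee_fin => h.
have := sqr_integral_le ab cn.
under [in leRHS]eq_Rintegral do rewrite real_normK ?num_real//.
apply: le_trans; rewrite -[leLHS]real_normK ?num_real// lerXn2r ?nnegrE//.
exact: le_trans (normr_ge0 _) h.
Qed.

(** Up to the factor [b - a], [h t] is the sum of its average and of the average of [h t - h s]; the
    latter is controlled by the oscillation [c]. *)
Lemma sqr_average (h : R -> R) a b c : a < b -> continuous h ->
  (forall s t, s \in `[a, b] -> t \in `[a, b] -> (h s - h t) ^+ 2 <= c) ->
  (\int[mu]_(x in `[a, b]) (h x ^+ 2)%:E <=
   (2 / (b - a) * (\int[mu]_(x in `[a, b]) h x) ^+ 2 + 2 * (b - a) * c)%:E)%E.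
Proof.
move=> ab ch hc; set I := \int[mu]_(x in _) h x.
have e0 : 0 < b - a by rewrite subr_gt0.
have ih := continuous_segment_integrable a b ch.
have cs : continuous (fun x => h x ^+ 2) by exact: continuous_sqr.
have is2 := continuous_segment_integrable a b cs.
have icst k : mu.-integrable `[a, b] (EFin \o (fun=> k)).
  by apply: continuous_segment_integrable; exact: cst_continuous.
have key t : t \in `[a, b] -> h t ^+ 2 <= 2 / (b - a) ^+ 2 * I ^+ 2 + 2 * c.
  move=> tI; pose d s := h t - h s.
  have cd : continuous d.
    by move=> s; apply: (@continuousB _ _ _ (cst (h t)) h); [exact: cst_continuous|exact: ch].
  have dI : \int[mu]_(s in `[a, b]) d s = (b - a) * h t - I.
    by rewrite RintegralB// (Rint_segment_cst _ (ltW ab)) mulrC.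
  have : (\int[mu]_(s in `[a, b]) d s) ^+ 2 <= (b - a) ^+ 2 * c.
    apply: le_trans (sqr_integral_le ab cd) _; rewrite [X in _ <= X * c]expr2 -mulrA; apply: (ler_wpM2l (ltW e0)).
    rewrite [leRHS]mulrC -(Rint_segment_cst _ (ltW ab)); apply: le_Rintegral => //.
      by apply: continuous_segment_integrable; exact: continuous_sqr.
    by move=> s sI; apply: hc.
  rewrite dI => h1; have e2 : 0 < (b - a) ^+ 2 by rewrite exprn_gt0.
  rewrite -(ler_pM2l e2).
  have -> : (b - a) ^+ 2 * (2 / (b - a) ^+ 2 * I ^+ 2 + 2 * c) = 2 * I ^+ 2 + 2 * ((b - a) ^+ 2 * c).
    by field; rewrite gt_eqF.
  (* This square equals 2 (y - I)^2 + 2 I^2 - y^2 for y = (b - a) h(t). *)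
  have := sqr_ge0 ((b - a) * h t - 2 * I); move: h1.
  have -> : ((b - a) * h t - I) ^+ 2 = (b - a) ^+ 2 * h t ^+ 2 - 2 * ((b - a) * h t * I) + I ^+ 2 by ring.
  have -> : ((b - a) * h t - 2 * I) ^+ 2 = (b - a) ^+ 2 * h t ^+ 2 - 4 * ((b - a) * h t * I) + 4 * I ^+ 2 by ring.
  by lra.
rewrite -(fineK (integrable_fin_num _ is2))// lee_fin.
have : \int[mu]_(x in `[a, b]) (h x ^+ 2) <= \int[mu]_(x in `[a, b]) (2 / (b - a) ^+ 2 * I ^+ 2 + 2 * c).
  by apply: le_Rintegral => // t tI; exact: key.
rewrite (Rint_segment_cst _ (ltW ab)) => /le_trans; apply.
rewrite le_eqVlt; apply/orP; left; apply/eqP.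
by field; rewrite gt_eqF.
Qed.

Lemma integral_grid (phi : R -> \bar R) a e N : 0 <= e ->
  measurable_fun [set: R] phi -> (forall t, 0 <= phi t)%E ->
  (\int[mu]_(t in `[a, (a + N%:R * e)%R[) phi t =
   \sum_(k < N) \int[mu]_(t in `[(a + k%:R * e)%R, (a + k.+1%:R * e)%R[) phi t)%E.
Proof.
move=> e0 mphi phi0; elim: N => [|N ih].
  by rewrite big_ord0 mul0r addr0 set_itvxx integral_set0.
rewrite big_ord_recr /= -ih -ge0_integral_setU//.
- rewrite -itv_bndbnd_setU// bnd_simp; first by rewrite lerDl mulr_ge0.
  by rewrite lerD2l ler_wpM2r// ler_nat.
- exact: measurable_funTS.
apply/disj_setPS => t [] /=; rewrite !in_itv/= => /andP[_ h1] /andP[h2 _].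
by move: (lt_le_trans h1 h2); rewrite ltxx.
Qed.

Lemma Fubini_slice n (F : 'rV[R]_n.+1 -> R) : ig setT F ->
  (\int[leb]_x (F x)%:E = \int[mu]_t \int[leb]_x (F (cons_rV (x, t)))%:E)%E.
Proof.
move=> iF; have mF : measurable_fun [set: 'rV[R]_n.+1] (EFin \o F) := measurable_int _ iF.
have mFc : measurable_fun [set: 'rV[R]_n * R] (fun p => (F (cons_rV p))%:E).
  exact: (measurableT_comp mF (@measurable_cons_rV R n)).
have iFc : ((@sleb R n) \x mu)%E.-integrable setT (fun p => (F (cons_rV p))%:E).
  apply/integrableP; split; first exact: mFc.
  have /integrableP[_] := iF; rewrite /= ge0_integral_pushforward//=.
  - exact: measurable_cons_rV.
  - exact: (measurable_int _ (integrable_abse iF)).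
have := integral21_prod_meas1 iFc.
rewrite /fubini_G => ->.
by rewrite /= integral_pushforward//; exact: measurable_cons_rV.
Qed.

End averages.

(** * Dependence of slices on the first coordinate; tensor products *)

Section ehrling.
Context (R : realType).
Local Notation mu := (@lebesgue_measure R).

Lemma csm_sub n M (f g : 'rV[R]_n -> R) : csm n M f -> csm n M g ->
  csm n M (fun x => f x - g x).
Proof.
move=> [sf f0] [sg g0]; split; last by move=> x nx; rewrite f0// g0// subrr.
have -> : (fun x => f x - g x) = (fun x => f x + (cst (-1) x) * g x).
  by apply/funext => x; rewrite /= mulN1r.
exact: (smoothD sf (smoothM (@smooth_cst R n (-1)) sg)).
Qed.

Lemma smooth_consr n (f : 'rV[R]_n.+1 -> R) x : smooth f ->
  (forall t, is_derive t (1 : R) (fun s => f (cons_rV (x, s))) (partial ord0 f (cons_rV (x, t)))) /\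
  continuous (fun s => f (cons_rV (x, s))).
Proof.
move=> sf.
have e (g : 'rV[R]_n.+1 -> R) : (fun s => g (cons_rV (x, s))) = (fun s => g (upd ord0 (cons_rV (x, 0)) s)).
  by apply/funext => s; rewrite upd_cons0.
split=> [t|]; rewrite e.
  rewrite -(upd_cons0 x 0 t); apply: is_derive_line; exact: smooth_derivable.
move=> t; apply: (@continuous_comp _ _ _ (upd ord0 (cons_rV (x, 0))) f).
  exact: continuous_upd.
exact: smooth_continuous.
Qed.

Lemma integral_strip n (F : 'rV[R]_n.+1 -> \bar R) (J : set R) : measurable J ->
  measurable_fun [set: 'rV[R]_n.+1] F -> (forall y, 0 <= F y)%E ->
  (\int[leb]_x \int[mu]_(t in J) F (cons_rV (x, t)) =
   \int[mu]_(t in J) \int[leb]_x F (cons_rV (x, t)))%E /\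
  measurable_fun [set: 'rV[R]_n] (fun x => \int[mu]_(t in J) F (cons_rV (x, t)))%E.
Proof.
move=> mJ mF F0; pose A := [set y : 'rV[R]_n.+1 | J (y ord0 ord0)].
have mA : measurable A.
  by have := measurable_coord (ord0 : 'I_n.+1) measurableT mJ; rewrite setTI.
pose G := F \_ A.
have mG : measurable_fun [set: 'rV[R]_n.+1] G.
  by apply/(measurable_restrictT _ _).1 => //; exact: measurable_funS mF.
have G0 y : (0 <= G y)%E by rewrite /G patchE; case: ifP.
have e x t : G (cons_rV (x, t)) = ((fun t => F (cons_rV (x, t))) \_ J) t.
  by rewrite /G !patchE; congr (if _ then _ else _); apply/asbool_equiv_eq; rewrite /A /= cons_rV0.
have e1 x : (\int[mu]_(t in J) F (cons_rV (x, t)) = \int[mu]_t G (cons_rV (x, t)))%E.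
  by rewrite integral_mkcond; apply: eq_integral => t _; rewrite e.
have e2 : (\int[mu]_(t in J) \int[leb]_x F (cons_rV (x, t)) = \int[mu]_t \int[leb]_x G (cons_rV (x, t)))%E.
  rewrite integral_mkcond; apply: eq_integral => t _; rewrite patchE.
  case: ifPn => tJ; first by apply: eq_integral => x _; rewrite e patchE tJ.
  by rewrite integral0_eq// => x _; rewrite e patchE (negbTE tJ).
have e3 : (fun x => \int[mu]_(t in J) F (cons_rV (x, t)))%E = (fun x => \int[mu]_t G (cons_rV (x, t)))%E.
  by apply/funext => x; exact: e1.
split; last by rewrite e3; exact: (measurable_tonelli1 mG G0).
by rewrite e2 e3 -(leb_tonelli1 mG G0) (leb_tonelli2 mG G0).
Qed.

(** The bound [sqr_dist_line] in the first coordinate, integrated over the remaining ones. *)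
Lemma slice_dist n M (f : 'rV[R]_n.+1 -> R) a b s t : csm n.+1 M f -> a < b ->
  s \in `[a, b] -> t \in `[a, b] ->
  ((nT (fun x => slice f s x - slice f t x) ^+ 2)%:E <=
   (b - a)%:E * \int[mu]_(r in `[a, b]) (nT (slice (partial ord0 f) r) ^+ 2)%:E)%E.
Proof.
move=> cf ab sI tI; have sf := csm_smooth cf.
have cp := csm_partial ord0 cf; have sp := csm_smooth cp.
pose F y := (partial ord0 f y ^+ 2)%:E.
have mF : measurable_fun [set: 'rV[R]_n.+1] F.
  by apply/measurable_EFinP; apply: measurable_funX; exact: smooth_measurable.
have F0 y : (0 <= F y)%E by rewrite lee_fin sqr_ge0.
have [eF mFx] := integral_strip (measurable_itv `[a, b]) mF F0.
have -> : (\int[mu]_(r in `[a, b]) (nT (slice (partial ord0 f) r) ^+ 2)%:E =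
    \int[mu]_(t in `[a, b]) \int[leb]_x F (cons_rV (x, t)))%E.
  by apply: eq_integral => r _; rewrite -(integral_sqr (csm_slice r cp)).
rewrite -eF -(integral_sqr (csm_sub (csm_slice s cf) (csm_slice t cf))).
rewrite -ge0_integralZl//; last 2 first.
- by move=> x _; exact: integral_ge0.
- by rewrite lee_fin subr_ge0 ltW.
apply: ge0_le_integral => //.
- by move=> x _; rewrite lee_fin sqr_ge0.
- apply/measurable_EFinP; apply: measurable_funX; apply: smooth_measurable.
  exact: csm_smooth (csm_sub (csm_slice s cf) (csm_slice t cf)).
- by apply: emeasurable_funM => //; exact: measurable_cst.
move=> x _; have [h1 _] := smooth_consr x sf; have [_ h2] := smooth_consr x sp.
exact: (sqr_dist_line h1 h2 ab sI tI).
Qed.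

Definition tail n (y : 'rV[R]_n.+1) : 'rV[R]_n := \row_j y ord0 (lift ord0 j).

Lemma tail_cons n (x : 'rV[R]_n) t : tail (cons_rV (x, t)) = x.
Proof. by apply/rowP => j; rewrite mxE cons_rVS. Qed.

Lemma measurable_tail n : measurable_fun [set: 'rV[R]_n.+1] (@tail n).
Proof.
apply: measurable_rVP => i; under eq_fun do rewrite mxE.
exact: measurable_coord.
Qed.

(** The tensor product of the indicator of [J] in the first coordinate with [q] in the others.
    Pairing [f] with it integrates over [J] the pairings of [q] with the slices of [f]. *)
Definition tens n (q : 'rV[R]_n -> R) (J : set R) (y : 'rV[R]_n.+1) : R :=
  q (tail y) * \1_J (y ord0 ord0).

Lemma measurable_tens n (q : 'rV[R]_n -> R) (J : set R) : measurable J ->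
  measurable_fun setT q -> measurable_fun setT (tens q J).
Proof.
move=> mJ mq; apply: measurable_funM.
  exact: (measurableT_comp mq (@measurable_tail n)).
by apply: measurableT_comp (measurable_coord _); exact: measurable_indic.
Qed.

Lemma tens_sq n (q : 'rV[R]_n -> R) a b : a < b -> sq setT q -> sq setT (tens q `[a, b]).
Proof.
move=> ab [mq iq]; have mt := measurable_tens (measurable_itv `[a, b]) mq.
have mt2 : measurable_fun setT (fun y => (tens q `[a, b] y ^+ 2)%:E).
  by apply/measurable_EFinP; apply: measurable_funX.
split=> //; apply/integrableP; split=> //.
have -> : (\int[leb]_x `|((EFin \o (fun x => tens q `[a, b] x ^+ 2)%R) x)| =
    \int[leb]_x (tens q `[a, b] x ^+ 2)%:E)%E.
  by apply: eq_integral => x _; rewrite /= ger0_norm ?sqr_ge0.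
rewrite leb_tonelli1//; last by move=> y; rewrite lee_fin sqr_ge0.
have -> : (\int[leb]_x \int[mu]_t (tens q `[a, b] (cons_rV (x, t)) ^+ 2)%:E =
    \int[leb]_x ((b - a)%:E * (q x ^+ 2)%:E))%E.
  apply: eq_integral => x _.
  have -> : (\int[mu]_t (tens q `[a, b] (cons_rV (x, t)) ^+ 2)%:E =
      \int[mu]_t ((q x ^+ 2)%:E * (\1_(`[a, b]%classic : set R) t)%:E))%E.
    apply: eq_integral => t _; rewrite /tens tail_cons cons_rV0 exprMn -EFinM.
    by rewrite indicE; case: (_ \in _); rewrite ?expr1n ?expr0n.
  rewrite ge0_integralZl//; last 2 first.
  - by apply/measurable_EFinP; exact: measurable_indic.
  - by rewrite lee_fin sqr_ge0.
  rewrite integral_indic// setIT muleC; congr (_ * _)%E.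
  suff h : mu `[a, b]%classic = (b - a)%:E by exact: h.
  by rewrite lebesgue_measure_itv/= lte_fin ab EFinB.
rewrite ge0_integralZl//; last 3 first.
- by apply/measurable_EFinP; apply: measurable_funX.
- by move=> x _; rewrite lee_fin sqr_ge0.
- by rewrite lee_fin subr_ge0 ltW.
have /integrableP[_ h] := iq.
rewrite lte_mul_pinfty//; first by rewrite lee_fin subr_ge0 ltW.
have -> // : (\int[leb]_x (q x ^+ 2)%:E = \int[leb]_x `|((EFin \o (fun x => q x ^+ 2)%R) x)|)%E.
by apply: eq_integral => x _; rewrite /= ger0_norm ?sqr_ge0.
Qed.

End ehrling.

(** * L^2 norms controlled by finitely many functionals *)

Section ehrling.
Context (R : realType).
Local Notation mu := (@lebesgue_measure R).

Lemma ipr_slice_tens n M (f : 'rV[R]_n.+1 -> R) (q : 'rV[R]_n -> R) a b :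
  csm n.+1 M f -> sq setT q -> a < b ->
  continuous (fun t => ipr setT q (slice f t)) ->
  \int[mu]_(t in `[a, b]) ipr setT q (slice f t) = ipr setT (tens q `[a, b]) f.
Proof.
move=> cf sqq ab ch.
have iF : ig setT (fun y => tens q `[a, b] y * f y).
  by apply: sqM; [exact: openT|exact: tens_sq|exact: csm_sq cf].
rewrite /ipr /Rintegral; congr fine.
rewrite (Fubini_slice iF) integral_mkcond; apply: eq_integral => t _.
rewrite patchE; case: ifPn => tJ.
  have iq : ig setT (fun x => q x * slice f t x).
    by apply: sqM; [exact: openT| |exact: csm_sq (csm_slice t cf)].
  rewrite fineK; last exact: (integrable_fin_num _ iq).
  by apply: eq_integral => x _; rewrite /tens tail_cons cons_rV0 indicE tJ mulr1.
rewrite integral0_eq// => x _.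
by rewrite /tens tail_cons cons_rV0 indicE (negbTE tJ) mulr0 mul0r.
Qed.

Lemma ipr_slice_dist n M (f : 'rV[R]_n.+1 -> R) (q : 'rV[R]_n -> R) a b s t :
  csm n.+1 M f -> sq setT q -> a < b -> s \in `[a, b] -> t \in `[a, b] ->
  (((ipr setT q (slice f s) - ipr setT q (slice f t)) ^+ 2)%:E <=
   (nT q ^+ 2 * (b - a))%:E * \int[mu]_(r in `[a, b]) (nT (slice (partial ord0 f) r) ^+ 2)%:E)%E.
Proof.
move=> cf sqq ab sI tI.
have cd := csm_sub (csm_slice s cf) (csm_slice t cf).
have ss := csm_sq (csm_slice s cf); have st := csm_sq (csm_slice t cf).
have e : ipr setT q (slice f s) - ipr setT q (slice f t) = ipr setT q (fun x => slice f s x - slice f t x).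
  have -> : (fun x => slice f s x - slice f t x) = linr (-1) (slice f s) (slice f t).
    by apply/funext => x; rewrite /linr mulN1r.
  rewrite [RHS](iprC setT q) (@ipr_linr _ _ _ (@openT _))// mulN1r.
  by rewrite (iprC setT (slice f s)) (iprC setT (slice f t)).
rewrite e (EFinM (nT q ^+ 2)) -muleA.
apply: le_trans (lee_wpmul2l _ (slice_dist cf ab sI tI)); last by rewrite lee_fin sqr_ge0.
rewrite -EFinM lee_fin -exprMn.
rewrite -[leLHS]real_normK ?num_real// lerXn2r ?nnegrE//.
  by rewrite mulr_ge0 ?sqrtr_ge0.
exact: (ipr_cs (@openT _) sqq (csm_sq cd)).
Qed.

(** Hoelder continuity of exponent 1/2, from [ipr_slice_dist] on the segment between two
    parameters. *)
Lemma continuous_ipr_slice n M (f : 'rV[R]_n.+1 -> R) (q : 'rV[R]_n -> R) :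
  csm n.+1 M f -> sq setT q -> continuous (fun t => ipr setT q (slice f t)).
Proof.
move=> cf sqq; set h := (fun t => _).
pose K := nT q ^+ 2 * nT (partial ord0 f) ^+ 2 + 1.
have K0 : 0 < K by rewrite ltr_wpDl// mulr_ge0 ?sqr_ge0.
have key s t : s < t -> (h s - h t) ^+ 2 <= K * (t - s).
  move=> st; have cp := csm_partial ord0 cf.
  have sI : s \in `[s, t] by rewrite in_itv/= lexx ltW.
  have tI : t \in `[s, t] by rewrite in_itv/= lexx ltW.
  rewrite -lee_fin; apply: le_trans (ipr_slice_dist cf sqq st sI tI) _.
  have t0 : 0 <= t - s by rewrite subr_ge0 ltW.
  apply: (@le_trans _ _ ((nT q ^+ 2 * (t - s))%:E * (nT (partial ord0 f) ^+ 2)%:E)%E).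
    apply: lee_wpmul2l; first by rewrite lee_fin mulr_ge0 ?sqr_ge0.
    rewrite -(integral_slice_sqr cp); apply: ge0_subset_integral => //.
      exact: (measurable_slice_sqr cp).
    by move=> r _; rewrite lee_fin sqr_ge0.
  rewrite -EFinM lee_fin mulrAC ler_wpM2r// /K lerDl//.
have key2 s t : (h s - h t) ^+ 2 <= K * `|t - s|.
  have [st|st|->] := ltgtP s t.
  - by rewrite ger0_norm ?subr_ge0 ?(ltW st)//; exact: key.
  - by rewrite distrC ger0_norm ?subr_ge0 ?(ltW st)// -sqrrN opprB; exact: key.
  - by rewrite !subrr normr0 mulr0 expr0n.
move=> t; apply/cvgrPdist_lt => /= e e0.
have d0 : 0 < e ^+ 2 / K by rewrite divr_gt0 ?exprn_gt0.
near=> s.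
have : `|t - s| < e ^+ 2 / K by near: s; exact: cvgr_dist_lt.
rewrite ltr_pdivlMr// mulrC => hs.
have h2 : (h t - h s) ^+ 2 < e ^+ 2.
  by apply: le_lt_trans hs; rewrite -[`|t - s|]distrC; exact: key2.
by move: h2; rewrite -[X in X < _]real_normK ?num_real// ltr_pXn2r// nnegrE ?(ltW e0).
Unshelve. all: by end_near.
Qed.

(** Cell number [k] in a division of an interval of length [N * e], centred at 0, into [N] cells of
    length [e]. *)
Definition cell (N : nat) (e : R) (k : nat) : interval R :=
  `[- (N%:R * e / 2) + k%:R * e, - (N%:R * e / 2) + k.+1%:R * e].

(** The condition [M < N * e / 2] makes the cells cover the support. On a cell, the squared
    oscillation of the pairing is at most [e] times the squared norm of [q] times the share of the
    first derivative carried by that cell; these shares add up to at most the full norm. *)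
Lemma ehrling_step n M (f : 'rV[R]_n.+1 -> R) (q : 'rV[R]_n -> R) (N : nat) e :
  csm n.+1 M f -> sq setT q -> 0 < e -> M < N%:R * e / 2 ->
  (\int[mu]_t (ipr setT q (slice f t) ^+ 2)%:E <=
   (2 / e * \sum_(k < N) ipr setT (tens q [set` cell N e k]) f ^+ 2 +
    2 * e ^+ 2 * nT q ^+ 2 * nT (partial ord0 f) ^+ 2)%:E)%E.
Proof.
move=> cf sqq e0; set h := (fun t => ipr setT q (slice f t)).
rewrite /cell; set L := N%:R * e / 2 => ML.
pose J k : interval R := `[- L + k%:R * e, - L + k.+1%:R * e].
have ch : continuous h := continuous_ipr_slice cf sqq.
have ch2 := continuous_sqr ch.
have cp := csm_partial ord0 cf.
pose G t := (nT (slice (partial ord0 f) t) ^+ 2)%:E.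
have mG : measurable_fun setT G := measurable_slice_sqr cp.
have G0 t : (0 <= G t)%E by rewrite lee_fin sqr_ge0.
have G1 : (\int[mu]_t G t)%E = (nT (partial ord0 f) ^+ 2)%:E := integral_slice_sqr cp.
have Gle A : measurable A -> (\int[mu]_(t in A) G t <= (nT (partial ord0 f) ^+ 2)%:E)%E.
  by move=> mA; rewrite -G1; apply: ge0_subset_integral.
have mh2 : measurable_fun setT (fun t => (h t ^+ 2)%:E).
  by apply/measurable_EFinP; exact: continuous_measurable_fun.
have h20 t : (0 <= (h t ^+ 2)%:E)%E by rewrite lee_fin sqr_ge0.
have hout t : L <= `|t| -> h t = 0.
  move=> Lt; rewrite /h /ipr /Rintegral integral0_eq// => x _.
  rewrite /slice cf.2 ?mulr0// => /(_ ord0); rewrite cons_rV0 leNgt.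
  by rewrite (lt_le_trans ML Lt).
have eL : - L + N%:R * e = L by rewrite /L; field.
have -> : (\int[mu]_t (h t ^+ 2)%:E = \int[mu]_(t in `[(- L)%R, (- L + N%:R * e)%R[) (h t ^+ 2)%:E)%E.
  rewrite [RHS]integral_mkcond; apply: eq_integral => t _; rewrite patchE.
  case: ifPn => //; rewrite notin_setE /= in_itv/= eL => /negP; rewrite negb_and -ltNge -leNgt => tL.
  rewrite hout ?expr0n//; case/orP: tL => tL.
    by rewrite ler_normr lerNr (ltW tL) orbT.
  by rewrite ler_normr tL.
rewrite integral_grid//; last exact: ltW.
pose c k := nT q ^+ 2 * e * fine (\int[mu]_(t in [set` J k]) G t).
have JE k : (- L + k%:R * e) + e = - L + k.+1%:R * e by rewrite -addrA -[X in _ + (_ + X)]mul1r -mulrDl -natr1.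
have fG A : measurable A -> (\int[mu]_(t in A) G t \is a fin_num)%E.
  move=> mA; rewrite ge0_fin_numE ?integral_ge0//.
  by apply: le_lt_trans (Gle A mA) _; rewrite ltry.
have Jab k : - L + k%:R * e < - L + k.+1%:R * e by rewrite -JE ltrDl.
have Je k : (- L + k.+1%:R * e) - (- L + k%:R * e) = e by rewrite -JE addrAC subrr add0r.
(* Half-open cells are disjoint, closed ones suit the estimates for continuous functions; they
   differ by a null set. *)
have half g k : measurable_fun setT g ->
  (\int[mu]_(t in `[(- L + k%:R * e)%R, (- L + k.+1%:R * e)%R[) g t =
   \int[mu]_(t in [set` J k]) g t)%E.
  by move=> mg; apply: integral_itv_bndo_bndc; exact: measurable_funTS.
apply: (@le_trans _ _ (\sum_(k < N) (2 / e * ipr setT (tens q [set` J k]) f ^+ 2 + 2 * e * c k)%:E)%E).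
  apply: lee_sum => k _; rewrite half//.
  have hc : forall s t, s \in J k -> t \in J k -> (h s - h t) ^+ 2 <= c k.
    move=> s t sJ tJ; rewrite -lee_fin; apply: le_trans (ipr_slice_dist cf sqq (Jab k) sJ tJ) _.
    by rewrite Je /c (EFinM (nT q ^+ 2 * e)) fineK; [exact: lexx|exact: fG].
  have := sqr_average (Jab k) ch hc; rewrite Je => /le_trans; apply.
  by rewrite (ipr_slice_tens cf sqq (Jab k) ch).
rewrite sumEFin lee_fin big_split/= -!mulr_sumr lerD2l.
have -> : 2 * e ^+ 2 * nT q ^+ 2 * nT (partial ord0 f) ^+ 2 =
   2 * e * (nT q ^+ 2 * e * nT (partial ord0 f) ^+ 2) by ring.
apply: ler_wpM2l; first by rewrite mulr_ge0 ?(ltW e0).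
apply: ler_wpM2l; first by rewrite mulr_ge0 ?sqr_ge0 ?(ltW e0).
rewrite -lee_fin -sumEFin.
under eq_bigr do rewrite fineK ?fG//.
under eq_bigr do rewrite -half//.
rewrite -integral_grid//; last exact: ltW.
exact: Gle.
Qed.

(** In dimension 0 the space is one point of mass 1, and pairing with 1 is evaluation. *)
Lemma csm_rV0 M (f : 'rV[R]_0 -> R) : csm 0 M f -> nT f ^+ 2 = ipr setT (fun=> 1) f ^+ 2.
Proof.
move=> cf; have fE : f = fun=> f 0 by apply/funext => x; congr f; apply/rowP; case.
have l1 : fine (leb [set: 'rV[R]_0]) = 1 by rewrite (_ : leb _ = 1%E)//; exact: diracT.
by rewrite nT_sqr fE /ipr !Rintegral_cst// l1 !mulr1 mul1r expr2.
Qed.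

Definition ehrling_at n M := forall d : R, 0 < d ->
  exists C (I : finType) (q : I -> 'rV[R]_n -> R), [/\ 0 <= C, forall i, sq setT (q i) &
  forall f, csm n M f -> nT f ^+ 2 <= C * (\sum_i ipr setT (q i) f ^+ 2) +
    d * \sum_i nT (partial i f) ^+ 2].

Lemma grid_exists (M A d : R) : 0 <= M -> 0 <= A -> 0 < d ->
  exists e (N : nat), [/\ 0 < e, M < N%:R * e / 2 & A * (2 * e ^+ 2) <= d].
Proof.
(* [e <= 1] gives [e^2 <= e], so that 2 A e^2 <= 2 A e <= d; then [N] is taken large enough. *)
move=> M0 A0 d0; pose e := Num.min 1 (d / (2 * A + 1)).
have A1 : 0 < 2 * A + 1 by rewrite ltr_wpDl// mulr_ge0.
have e0 : 0 < e by rewrite lt_min ltr01 divr_gt0.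
exists e, (Num.truncn (2 * M / e)).+1; split=> //.
  by rewrite ltr_pdivlMr// mulrC -ltr_pdivrMr//; exact: truncnS_gt.
have e1 : e <= 1 by rewrite ge_min lexx.
have e2 : e <= d / (2 * A + 1) by rewrite ge_min lexx orbT.
have h : e * (2 * A + 1) <= d by rewrite -ler_pdivlMr.
have : e ^+ 2 <= e by rewrite expr2 ler_piMr// ltW.
by move=> e3; nra.
Qed.

Lemma sum_slice n (f : 'rV[R]_n.+1 -> R) t : smooth f ->
  \sum_i nT (partial i (slice f t)) ^+ 2 = \sum_(j < n) nT (slice (partial (lift ord0 j) f) t) ^+ 2.
Proof. by move=> sf; apply: eq_bigr => j _; rewrite partial_slice. Qed.

(** The induction hypothesis on slices, with the same [d], pays for all derivatives but the first.
    The error of [ehrling_step] involves only the first derivative, with a factor made at most [d]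
    because [e] is chosen after [C] and the [q i]. *)
Lemma ehrling n M : 0 <= M -> ehrling_at n M.
Proof.
move=> M0; elim: n => [|n ih] d d0.
  exists 1, unit, (fun _ _ => 1); split=> //.
    by move=> _; apply: (@csm_sq _ _ M); split=> [|x []]; [exact: smooth_cst|case].
  by move=> f cf; rewrite big_ord0 mulr0 addr0 mul1r big_const/= card_unit/= addr0 (csm_rV0 cf).
have [C [I [q [C0 sqq hq]]]] := ih d d0.
pose Q := \sum_i nT (q i) ^+ 2.
have Q0 : 0 <= Q by apply: sumr_ge0 => i _; exact: sqr_ge0.
have [e [N [e0 ML he]]] := grid_exists M0 (mulr_ge0 C0 Q0) d0.
exists (C * (2 / e)), (I * 'I_N)%type, (fun p : I * 'I_N => tens (q p.1) [set` cell N e p.2]).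
have e2 : 0 <= 2 / e by rewrite divr_ge0 ?(ltW e0).
split; first exact: mulr_ge0.
  by move=> [i k]; apply: tens_sq => //=; rewrite ltrD2l ltr_pM2r// ltr_nat.
move=> f cf; have sf := csm_smooth cf.
have ch i := continuous_ipr_slice cf (sqq i).
have cp i := csm_partial i cf.
have mh i : measurable_fun setT (fun t => (ipr setT (q i) (slice f t) ^+ 2)%:E).
  by apply/measurable_EFinP; apply: continuous_measurable_fun; exact: continuous_sqr.
pose H t := (\sum_i (ipr setT (q i) (slice f t) ^+ 2)%:E)%E.
pose G t := (\sum_(j < n) (nT (slice (partial (lift ord0 j) f) t) ^+ 2)%:E)%E.
have mH : measurable_fun setT H by apply: emeasurable_sum => i; exact: mh.
have mG : measurable_fun setT G by apply: emeasurable_sum => j; exact: (measurable_slice_sqr (cp _)).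
have H0 t : (0 <= H t)%E by apply: sume_ge0 => i _; rewrite lee_fin sqr_ge0.
have G0 t : (0 <= G t)%E by apply: sume_ge0 => i _; rewrite lee_fin sqr_ge0.
have key : (\int[mu]_t (nT (slice f t) ^+ 2)%:E <=
  \int[mu]_t (C%:E * H t + d%:E * G t))%E.
  apply: ge0_le_integral => //.
  - by move=> t _; rewrite lee_fin sqr_ge0.
  - exact: (measurable_slice_sqr cf).
  - by apply: emeasurable_funD; apply: emeasurable_funM => //; exact: measurable_cst.
  move=> t _; rewrite /H /G !sumEFin -!EFinM -EFinD lee_fin.
  by rewrite -(sum_slice t sf); exact: (hq _ (csm_slice t cf)).
have iG : (\int[mu]_t G t = (\sum_(j < n) nT (partial (lift ord0 j) f) ^+ 2)%:E)%E.
  rewrite ge0_integral_sum//; last 2 first.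
  - by move=> j; exact: (measurable_slice_sqr (cp _)).
  - by move=> j t _; rewrite lee_fin sqr_ge0.
  by rewrite -sumEFin; apply: eq_bigr => j _; exact: (integral_slice_sqr (cp _)).
have iH : (\int[mu]_t H t <= (\sum_i (2 / e * \sum_(k < N) ipr setT (tens (q i) [set` cell N e k]) f ^+ 2 +
    2 * e ^+ 2 * nT (q i) ^+ 2 * nT (partial ord0 f) ^+ 2))%:E)%E.
  rewrite ge0_integral_sum//; last by move=> j t _; rewrite lee_fin sqr_ge0.
  by rewrite -sumEFin; apply: lee_sum => i _; exact: (ehrling_step cf).
rewrite (integral_slice_sqr cf) ge0_integralD// in key; last 4 first.
- by move=> t _; apply: mule_ge0.
- by apply: emeasurable_funM => //; exact: measurable_cst.
- by move=> t _; apply: mule_ge0 => //; rewrite lee_fin ltW.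
- by apply: emeasurable_funM => //; exact: measurable_cst.
rewrite !ge0_integralZl_EFin// ?(ltW d0)// iG in key.
rewrite -lee_fin; apply: (le_trans key).
apply: (le_trans (leeD (lee_wpmul2l _ iH) (lexx _))); first by rewrite lee_fin.
rewrite -!EFinM -EFinD lee_fin big_ord_recl mulrDr addrA lerD2r.
rewrite big_split/= -!mulr_sumr -mulr_suml -!mulr_sumr mulrDr (mulrA C (2 / e)) pair_big/= lerD2l.
rewrite -/Q; move: (sqr_ge0 (nT (partial ord0 f))) he; move: (nT _ ^+ 2) => z z0 he.
have -> : C * (2 * e ^+ 2 * Q * z) = C * Q * (2 * e ^+ 2) * z by ring.
exact: (ler_wpM2r z0 he).
Qed.

End ehrling.

(** * Inequalities and compactness in H_0^1 *)

Section test_inequalities.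
Context (R : realType) (n : nat) (D : set 'rV[R]_n).
Hypotheses (oD : open D) (bD : bounded_set D).
Let mD := mD oD.
Variables (M : R) (DM : D `<=` cube n M).

Lemma ctest_csm f : ctest D f -> csm n M f.
Proof.
move=> cf; split; first exact: ctest_smooth cf.
by move=> x nx; apply: (ctest_out cf) => /DM.
Qed.

Lemma ipr_setT f g : (forall x, ~ D x -> g x = 0) -> ipr setT f g = ipr D f g.
Proof.
move=> g0; rewrite /ipr [RHS]Rintegral_mkcond; apply: eq_Rintegral => x _.
rewrite patchE; case: ifPn => //; rewrite notin_setE => /g0 ->.
by rewrite mulr0.
Qed.

Lemma ctest_nT f : ctest D f -> nT f ^+ 2 = ipr D f f.
Proof. by move=> cf; rewrite nT_sqr ipr_setT// => x; exact: ctest_out. Qed.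

Variables (phi : 'rV[R]_n -> R[i]) (tphi : test_fun D phi).
Let a x := Re (phi x).
Let b x := Im (phi x).
Let ca : ctest D a. Proof. by have /test_funP[] := tphi. Qed.
Let cb : ctest D b. Proof. by have /test_funP[] := tphi. Qed.

Lemma dotL_test : dotL D phi phi = nT a ^+ 2 + nT b ^+ 2.
Proof.
by rewrite (dotL_parts oD); [rewrite (ctest_nT ca) (ctest_nT cb)|exact: test_fun_L2..].
Qed.

Lemma gradip_test : gradip D phi phi =
  \sum_i nT (partial i a) ^+ 2 + \sum_i nT (partial i b) ^+ 2.
Proof.
rewrite -big_split/=; apply: eq_bigr => i _.
have tp : test_fun D (Cpartial i phi) := test_fun_Cpartial i tphi.
have h : {ae leb, forall x, D x -> wgrad D phi i x = Cpartial i phi x} := wgrad_test_ae oD bD i tphi.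
have lw : L2 D (wgrad D phi i) by apply: wgrad_L2; exact: (H1_test oD bD).
have lc : L2 D (Cpartial i phi) by exact: test_fun_L2.
rewrite (ae_eq_dotL oD lw lc lw lc h h) (dotL_parts oD)//.
have e1 := ctest_nT (ctest_partial i ca); have e2 := ctest_nT (ctest_partial i cb).
exact: (f_equal2 +%R (esym e1) (esym e2)).
Qed.

End test_inequalities.

Section arithmetic.
Context (R : realType).

Lemma l4_parts (C na nb Xa Xb N X : R) : 0 <= C -> 0 <= na -> 0 <= nb -> 0 <= Xa -> 0 <= Xb ->
  0 <= N -> 0 <= X -> na <= N -> nb <= N -> Xa <= X -> Xb <= X ->
  2 * (C * na * Xa ^+ 3 + C * nb * Xb ^+ 3) <= 4 * C * N * X ^+ 3.
Proof.
move=> C0 na0 nb0 Xa0 Xb0 N0 X0 naN nbN XaX XbX.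
have h (p q : R) : 0 <= p -> 0 <= q -> p <= N -> q <= X -> C * p * q ^+ 3 <= C * N * X ^+ 3.
  move=> p0 q0 pN qX; apply: ler_pM.
  - by rewrite mulr_ge0.
  - by rewrite exprn_ge0.
  - by rewrite ler_wpM2l.
  - by rewrite lerXn2r ?nnegrE.
have h1 := h _ _ na0 Xa0 naN XaX; have h2 := h _ _ nb0 Xb0 nbN XbX.
by move: h1 h2; rewrite -!mulrA; lra.
Qed.

Lemma le_sqrt_sum (x y z : R) : 0 <= x -> 0 <= y -> x ^+ 2 + y ^+ 2 = z -> x <= Num.sqrt z.
Proof.
move=> x0 y0 <-; rewrite -[leLHS]ger0_norm// -sqrtr_sqr; apply: ler_wsqrtr.
by rewrite lerDl sqr_ge0.
Qed.

End arithmetic.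

Section test_inequalities2.
Context (R : realType) (m : nat) (D : set 'rV[R]_m.+2).
Hypotheses (oD : open D) (bD : bounded_set D).
Let mD := mD oD.
Variables (M : R) (M0 : 0 <= M) (DM : D `<=` cube m.+2 M).
Implicit Types phi : 'rV[R]_m.+2 -> R[i].
Let cR phi (t : test_fun D phi) : csm m.+2 M (fun x => Re (phi x)).
Proof. by apply: (ctest_csm DM); have /test_funP[] := t. Qed.
Let cI phi (t : test_fun D phi) : csm m.+2 M (fun x => Im (phi x)).
Proof. by apply: (ctest_csm DM); have /test_funP[] := t. Qed.

Lemma test_poincare phi : test_fun D phi ->
  dotL D phi phi <= (4 * M) ^+ 2 * gradip D phi phi.
Proof.
move=> t; rewrite (dotL_test oD bD t) (gradip_test oD bD t) mulrDr.
have h (f : 'rV[R]_m.+2 -> R) : csm m.+2 M f ->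
    nT f ^+ 2 <= (4 * M) ^+ 2 * \sum_i nT (partial i f) ^+ 2.
  move=> cf; apply: (@le_trans _ _ ((4 * M) ^+ 2 * nT (partial ord0 f) ^+ 2)).
    rewrite -exprMn lerXn2r ?nnegrE ?sqrtr_ge0 ?mulr_ge0 ?sqrtr_ge0//.
    exact: csm_poincare.
  apply: ler_wpM2l; first exact: sqr_ge0.
  by rewrite (bigD1 ord0)//= lerDl; apply: sumr_ge0 => j _; exact: sqr_ge0.
by apply: lerD; apply: h; [exact: cR|exact: cI].
Qed.

Lemma test_ehrling d : 0 < d -> exists C (I : finType) (q : I -> 'rV[R]_m.+2 -> R),
  [/\ 0 <= C, forall i, sq D (q i) & forall phi, test_fun D phi ->
   dotL D phi phi <= C * (\sum_i (ipr D (q i) (fun x => Re (phi x)) ^+ 2 +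
     ipr D (q i) (fun x => Im (phi x)) ^+ 2)) + d * gradip D phi phi].
Proof.
move=> d0; have [C [I [q [C0 sqq h]]]] := @ehrling R m.+2 M M0 d d0.
exists C, I, q; split=> //.
  move=> i; have [mq iq] := sqq i; split; first exact: measurable_funS mq.
  exact: (integrableS measurableT mD (@subsetT _ _) iq).
move=> phi t; rewrite (dotL_test oD bD t) (gradip_test oD bD t) big_split/= !mulrDr addrACA.
have e f : ctest D f -> \sum_i ipr setT (q i) f ^+ 2 = \sum_i ipr D (q i) f ^+ 2.
  by move=> cf; apply: eq_bigr => i _; rewrite (ipr_setT (D := D))// => x; exact: (ctest_out cf).
have /test_funP[ta tb] := t.
by apply: lerD; [rewrite -(e _ ta); exact: (h _ (cR t))|rewrite -(e _ tb); exact: (h _ (cI t))].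
Qed.

(** (a^2 + b^2)^2 <= 2 (a^4 + b^4) reduces the complex case to the real and imaginary parts. *)
Lemma test_l4 : m.+2 = 2%N \/ m.+2 = 3%N -> exists2 C, 0 <= C & forall phi, test_fun D phi ->
  (\int[leb]_(x in D) (sqmod (phi x) ^+ 2)%:E <= (C * L2norm D phi * H01norm D phi ^+ 3)%:E)%E.
Proof.
move=> hm; have [C C0 h] := ladyzhenskaya M0 hm.
exists (4 * C); first by rewrite mulr_ge0.
move=> phi t; have ca := cR t; have cb := cI t.
set a := (fun x => Re (phi x)) in ca; set b := (fun x => Im (phi x)) in cb.
have m4 f : csm m.+2 M f -> measurable_fun setT (fun x => (f x ^+ 4)%:E).
  move=> cf; apply/measurable_EFinP; apply: measurable_funX.
  exact: smooth_measurable (csm_smooth cf).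
have p4 (f : 'rV[R]_m.+2 -> R) x : (0 <= (f x ^+ 4)%:E)%E by rewrite lee_fin exprn_even_ge0.
have mS : measurable_fun setT (fun x => (sqmod (phi x) ^+ 2)%:E).
  apply/measurable_EFinP; apply: measurable_funX; rewrite /sqmod.
  have ma := smooth_measurable (csm_smooth ca); have mb := smooth_measurable (csm_smooth cb).
  by apply: measurable_funD; apply: measurable_funX; [exact: ma|exact: mb].
apply: (@le_trans _ _ (\int[leb]_x (2%:E * ((a x ^+ 4)%:E + (b x ^+ 4)%:E)))%E).
  apply: (@le_trans _ _ (\int[leb]_x (sqmod (phi x) ^+ 2)%:E)%E).
    by apply: ge0_subset_integral => // x _; rewrite lee_fin sqr_ge0.
  apply: ge0_le_integral => //.
  - by move=> x _; rewrite lee_fin sqr_ge0.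
  - by apply: emeasurable_funM; [exact: measurable_cst|apply: emeasurable_funD; exact: m4].
  move=> x _; rewrite -EFinD -EFinM lee_fin /sqmod -/(a x) -/(b x).
  by have := sqr_ge0 (a x ^+ 2 - b x ^+ 2); lra.
rewrite ge0_integralZl//; last 2 first.
- by apply: emeasurable_funD; exact: m4.
- by move=> x _; rewrite adde_ge0.
rewrite ge0_integralD//; try exact: m4.
apply: (le_trans (lee_wpmul2l _ (leeD (h _ ca) (h _ cb)))); first by rewrite lee_fin.
rewrite -EFinD -EFinM lee_fin.
have s0 f : 0 <= \sum_i nT (@partial R m.+2 i f) ^+ 2 by apply: sumr_ge0 => i _; exact: sqr_ge0.
apply: l4_parts => //; try exact: sqrtr_ge0.
- by rewrite L2normE; apply: (le_sqrt_sum (sqrtr_ge0 _) (sqrtr_ge0 _)); rewrite (dotL_test oD bD t).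
- rewrite L2normE; apply: (le_sqrt_sum (sqrtr_ge0 _) (sqrtr_ge0 _)).
  by rewrite addrC (dotL_test oD bD t).
- by rewrite H01normE; apply: ler_wsqrtr; rewrite (gradip_test oD bD t) lerDl.
- by rewrite H01normE; apply: ler_wsqrtr; rewrite (gradip_test oD bD t) lerDr.
Qed.

End test_inequalities2.

Section limits.
Context (R : realType).

Lemma fast_cvg0 (s : nat -> R) (C : R) :
  (forall j, s j ^+ 2 <= C * (1 / 4) ^+ j) -> s @ \oo --> (0 : R).
Proof.
move=> h; apply: norm_cvg0.
have e : (fun j => `|s j|) = (fun j => Num.sqrt (s j ^+ 2)).
  by apply/funext => j; rewrite sqrtr_sqr.
rewrite e -sqrtr0; apply: (@continuous_cvg _ _ _ _ _ (fun j => s j ^+ 2) Num.sqrt).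
  exact: sqrt_continuous.
apply: (@squeeze_cvgr _ _ _ _ (cst 0) (geometric C (1 / 4))).
- by near=> j; rewrite sqr_ge0 h.
- exact: cvg_cst.
- by apply: cvg_geometric; rewrite ger0_norm; lra.
Unshelve. all: by end_near.
Qed.

Lemma cvg0_le (s : nat -> R) : (forall e, 0 < e -> \forall k \near \oo, `|s k| <= e) ->
  s @ \oo --> (0 : R).
Proof.
move=> h; apply/cvgrPdist_le => e e0; near=> k.
by rewrite sub0r normrN; near: k; exact: h.
Unshelve. all: by end_near.
Qed.

End limits.

(** * The Poincare inequality and approximation by test functions *)

Section H01_inequalities.
Context (R : realType) (m : nat) (D : set 'rV[R]_m.+2).
Hypotheses (oD : open D) (bD : bounded_set D).
Let mD := mD oD.
Implicit Types u v w phi : 'rV[R]_m.+2 -> R[i].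
Local Notation lin := (@lin R m.+2).
Local Notation nL := (L2norm D).
Local Notation nX := (H01norm D).

Lemma L2norm_ge0 u : 0 <= nL u. Proof. exact: sqrtr_ge0. Qed.
Lemma H01norm_ge0 u : 0 <= nX u. Proof. exact: sqrtr_ge0. Qed.

Lemma H01norm_sqr u : nX u ^+ 2 = gradip D u u.
Proof. by rewrite H01normE sqr_sqrtr// gradip_ge0. Qed.

Lemma L2norm_lin c u v : L2 D u -> L2 D v -> nL (lin c u v) <= nL u + `|c| * nL v.
Proof.
rewrite !L2normE; apply: (sip_nrm_lin (L2_lin oD)) => *;
  [exact: dotLC|exact: dotL_lin|exact: dotL_ge0].
Qed.

Lemma H01norm_lin c u v : H1 D u -> H1 D v -> nX (lin c u v) <= nX u + `|c| * nX v.
Proof.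
rewrite !H01normE; apply: (sip_nrm_lin (H1_lin oD bD)) => *;
  [exact: gradipC|exact: gradip_lin|exact: gradip_ge0].
Qed.

Lemma gradip_cs u v : H1 D u -> H1 D v -> `|gradip D u v| <= nX u * nX v.
Proof.
rewrite !H01normE; apply: (sip_cauchy_schwarz (H1_lin oD bD)) => *;
  [exact: gradipC|exact: gradip_lin|exact: gradip_ge0].
Qed.

Lemma lin_sub u v : lin 1 (lin (-1) u v) v = u.
Proof.
by apply/funext => x; apply: complex_ext; rewrite ?Re_lin ?Im_lin mulN1r mul1r subrK.
Qed.

Lemma subKlin u v : lin (-1) u (lin (-1) u v) = v.
Proof.
apply/funext => x; apply: complex_ext; rewrite ?Re_lin ?Im_lin !mulN1r opprD opprK addrA subrr;
by rewrite add0r.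
Qed.

Lemma L2norm_le_sub u v : L2 D u -> L2 D v -> nL u <= nL (lin (-1) u v) + nL v.
Proof.
move=> hu hv; have := L2norm_lin 1 (L2_lin oD (-1) hu hv) hv.
by rewrite lin_sub normr1 mul1r.
Qed.

Lemma H01norm_sub_le u v : H1 D u -> H1 D v -> nX v <= nX u + nX (lin (-1) u v).
Proof.
move=> hu hv; have := H01norm_lin (-1) hu (H1_lin oD bD (-1) hu hv).
by rewrite subKlin normrN1 mul1r.
Qed.

Lemma L2norm_sub_le u v : L2 D u -> L2 D v -> nL v <= nL u + nL (lin (-1) u v).
Proof.
move=> hu hv; have := L2norm_lin (-1) hu (L2_lin oD (-1) hu hv).
by rewrite subKlin normrN1 mul1r.
Qed.

Variables (M : R) (M0 : 0 <= M) (DM : D `<=` cube m.+2 M).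

Lemma poincare u : H01 D u -> nL u <= 4 * M * nX u.
Proof.
move=> hu; apply/ler_addgt0Pr => e e0.
have M1 : 0 < 4 * M + 1 by rewrite ltr_wpDl// mulr_ge0.
(* The approximation error enters once through the L^2 norm and [4 * M] times through the gradient
   norm. *)
have [phi t hphi] := H01_density hu (divr_gt0 e0 M1).
have h1 := H01_H1 hu; have h2 := H1_test oD bD t.
have e1 : nL phi <= 4 * M * nX phi.
  rewrite L2normE H01normE -[leRHS]ger0_norm; last by rewrite mulr_ge0 ?sqrtr_ge0 ?mulr_ge0.
  rewrite -sqrtr_sqr; apply: ler_wsqrtr; rewrite exprMn sqr_sqrtr ?gradip_ge0//.
  exact: (test_poincare oD bD M0 DM t).
have e2 := L2norm_le_sub (H1_L2 h1) (H1_L2 h2).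
have e3 := H01norm_sub_le h1 h2.
have e4 := L2norm_le_H1norm D (lin (-1) u phi).
have e5 := H01norm_le_H1norm D (lin (-1) u phi).
rewrite ltr_pdivlMr// in hphi.
apply: (le_trans e2); apply: (le_trans (lerD e4 e1)).
apply: (@le_trans _ _ (H1norm D (lin (-1) u phi) + 4 * M * (nX u + H1norm D (lin (-1) u phi)))).
  rewrite lerD2l; apply: ler_wpM2l; first by rewrite mulr_ge0.
  by apply: (le_trans e3); rewrite lerD2l.
by rewrite mulrDr addrCA lerD2l; apply: le_trans (ltW hphi); rewrite mulrDr mulr1 addrC mulrC.
Qed.

(** The rate 8^-k is the one that [fast_decay_ae] turns into convergence almost everywhere. *)
Lemma H01_fast u : H01 D u -> exists phi : nat -> 'rV[R]_m.+2 -> R[i],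
  (forall k, test_fun D (phi k)) /\
  forall k, H1norm D (lin (-1) u (phi k)) ^+ 2 <= (1 / 8) ^+ k.
Proof.
move=> hu; have h k : exists phi, test_fun D phi /\ H1norm D (lin (-1) u phi) ^+ 2 <= (1 / 8) ^+ k.
  have p : 0 < Num.sqrt ((1 / 8) ^+ k : R) by rewrite sqrtr_gt0 exprn_gt0.
  have [phi t hphi] := H01_density hu p.
  exists phi; split=> //; rewrite -[leRHS]sqr_sqrtr ?exprn_ge0//.
  by rewrite lerXn2r ?nnegrE ?sqrtr_ge0 ?(ltW hphi).
have [phi hphi] := choice h.
by exists phi; split=> k; have [] := hphi k.
Qed.

Lemma H01_fast_ae u (phi : nat -> 'rV[R]_m.+2 -> R[i]) : H01 D u ->
  (forall k, test_fun D (phi k)) ->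
  (forall k, H1norm D (lin (-1) u (phi k)) ^+ 2 <= (1 / 8) ^+ k) ->
  {ae leb, forall x, D x -> (fun k => sqmod (phi k x)) @ \oo --> sqmod (u x)}.
Proof.
move=> hu t hphi; have lu := H1_L2 (H01_H1 hu).
have ls k : L2 D (lin (-1) u (phi k)) by apply: L2_lin => //; exact: test_fun_L2.
have [lR lI] : (forall k, sq D (fun x => Re (lin (-1) u (phi k) x))) /\
    (forall k, sq D (fun x => Im (lin (-1) u (phi k) x))).
  by split=> k; have /(L2P oD)[] := ls k.
have b1 k : ipr D (fun x => Re (lin (-1) u (phi k) x)) (fun x => Re (lin (-1) u (phi k) x)) +
    ipr D (fun x => Im (lin (-1) u (phi k) x)) (fun x => Im (lin (-1) u (phi k) x)) <= (1 / 8) ^+ k.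
  rewrite -(dotL_parts oD (ls k) (ls k)) -L2norm_sqr; apply: le_trans (hphi k).
  by rewrite lerXn2r ?nnegrE ?sqrtr_ge0// L2norm_le_H1norm.
have aR := @fast_decay_ae _ _ _ leb D mD (fun k x => Re (lin (-1) u (phi k) x)) (fun k => sq_meas (lR k)) _.
have {}aR := aR (fun k => _).
have aI := @fast_decay_ae _ _ _ leb D mD (fun k x => Im (lin (-1) u (phi k) x)) (fun k => sq_meas (lI k)) _.
have dR k : (\int[leb]_(x in D) (Re (lin (-1) u (phi k) x) ^+ 2)%:E <= ((1 / 8) ^+ k)%:E)%E.
  by rewrite (ipr_EFin oD (lR k)) lee_fin; apply: le_trans (b1 k); rewrite lerDl ipr_ge0.
have dI k : (\int[leb]_(x in D) (Im (lin (-1) u (phi k) x) ^+ 2)%:E <= ((1 / 8) ^+ k)%:E)%E.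
  by rewrite (ipr_EFin oD (lI k)) lee_fin; apply: le_trans (b1 k); rewrite lerDr ipr_ge0.
have [{}aR {}aI] := (aR dR, aI dI).
have key (a : R) (f : nat -> R) C : (forall k, (a + -1 * f k) ^+ 2 <= C * (1 / 4) ^+ k) ->
    (fun k => f k ^+ 2) @ \oo --> a ^+ 2.
  move=> /fast_cvg0 h; have h2 : f @ \oo --> a.
    have -> : f = (fun k => a - (a + -1 * f k)) by apply/funext => k; ring.
    by rewrite -[X in _ --> X]subr0; apply: cvgB => //; exact: cvg_cst.
  by apply: (@cvgM _ _ _ _ f f).
apply: filterS2 aR aI => x hR hI Dx.
have [C1 {}hR] := hR Dx; have [C2 {}hI] := hI Dx.
apply: (@cvgD _ _ _ _ _ (fun k => Re (phi k x) ^+ 2) (fun k => Im (phi k x) ^+ 2)).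
  by apply: (key _ _ C1) => k; rewrite -Re_lin.
by apply: (key _ _ C2) => k; rewrite -Im_lin.
Qed.

End H01_inequalities.

Section limits.
Context (R : realType).

Lemma cvg0_add (s t : nat -> R) : s @ \oo --> (0 : R) -> t @ \oo --> (0 : R) ->
  (fun k => s k + t k) @ \oo --> (0 : R).
Proof. by move=> h1 h2; rewrite -[X in _ --> X]addr0; exact: (cvgD h1 h2). Qed.

Lemma cvg0_sum (I : finType) (s : I -> nat -> R) : (forall i, s i @ \oo --> (0 : R)) ->
  (fun k => \sum_i s i k) @ \oo --> (0 : R).
Proof.
move=> h; elim: (index_enum I) => [|i r ih].
  by under eq_fun do rewrite big_nil; exact: cvg_cst.
by under eq_fun do rewrite big_cons; exact: cvg0_add.
Qed.

Lemma cvg0_sqr (s : nat -> R) : s @ \oo --> (0 : R) -> (fun k => s k ^+ 2) @ \oo --> (0 : R).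
Proof.
move=> h; have -> : (0 : R) = 0 * 0 by rewrite mulr0.
exact: (@cvgM _ _ _ _ s s).
Qed.

Lemma cvg0_Ml c (s : nat -> R) : s @ \oo --> (0 : R) -> (fun k => c * s k) @ \oo --> (0 : R).
Proof.
move=> h; have -> : (0 : R) = c * 0 by rewrite mulr0.
by apply: (@cvgM _ _ _ _ (cst c) s) => //; exact: cvg_cst.
Qed.

Lemma cvg0_dom (s t : nat -> R) : (forall k, `|s k| <= t k) -> t @ \oo --> (0 : R) ->
  s @ \oo --> (0 : R).
Proof.
move=> st h; apply: norm_cvg0; apply: (@squeeze_cvgr _ _ _ _ (cst 0) t) => //.
  by near=> k; rewrite normr_ge0 st.
exact: cvg_cst.
Unshelve. all: by end_near.
Qed.

Lemma cvg0_near (s : nat -> R) e : s @ \oo --> (0 : R) -> 0 < e -> \forall k \near \oo, s k <= e.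
Proof.
move=> /cvgrPdist_le h e0; apply: filterS (h e e0) => k.
by rewrite sub0r normrN; apply: le_trans; exact: ler_norm.
Qed.

(** Every positive power of [e] in the expansion is at most [e]; the coefficients then add up to at
    most those of the expansion at [e = 1]. *)
Lemma l4_perturb (a b e : R) : 0 <= a -> 0 <= b -> 0 <= e -> e <= 1 ->
  (a + e) * (b + e) ^+ 3 <= a * b ^+ 3 + e * ((a + 1) * (b + 1) ^+ 3).
Proof.
move=> a0 b0 e0 e1.
have e2 : e ^+ 2 <= e by rewrite expr2 ler_piMr.
have e3 : e ^+ 3 <= e by rewrite exprS ler_piMr// exprn_ile1.
have e4 : e ^+ 4 <= e by rewrite exprS ler_piMr// exprn_ile1.
have h1 := ler_wpM2r (mulr_ge0 a0 b0) e2.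
have h2 := ler_wpM2r (mulr_ge0 b0 b0) e2.
have h3 := ler_wpM2r a0 e3; have h4 := ler_wpM2r b0 e3.
have p1 : 0 <= e * (a * b ^+ 3) by rewrite !mulr_ge0 ?exprn_ge0.
have -> : (a + e) * (b + e) ^+ 3 = a * b ^+ 3 + 3 * (e * (a * (b * b))) + e * (b * b * b) +
  3 * (e ^+ 2 * (a * b)) + 3 * (e ^+ 2 * (b * b)) + e ^+ 3 * a + 3 * (e ^+ 3 * b) + e ^+ 4 by ring.
have -> : e * ((a + 1) * (b + 1) ^+ 3) = e * (a * b ^+ 3) + 3 * (e * (a * (b * b))) + e * (b * b * b) +
  3 * (e * (a * b)) + 3 * (e * (b * b)) + e * a + 3 * (e * b) + e by ring.
lra.
Qed.

End limits.

(** * The L^4 bound and Rellich's theorem *)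

Section H01_inequalities.
Context (R : realType) (m : nat) (D : set 'rV[R]_m.+2).
Hypotheses (oD : open D) (bD : bounded_set D).
Let mD := mD oD.
Implicit Types u v w phi : 'rV[R]_m.+2 -> R[i].
Local Notation lin := (@lin R m.+2).
Local Notation nL := (L2norm D).
Local Notation nX := (H01norm D).
Variables (M : R) (M0 : 0 <= M) (DM : D `<=` cube m.+2 M).

(* Fatou's lemma along test functions converging almost everywhere. *)
Lemma H01_l4 : m.+2 = 2%N \/ m.+2 = 3%N -> exists2 C, 0 <= C & forall u, H01 D u ->
  (\int[leb]_(x in D) (sqmod (u x) ^+ 2)%:E <= (C * nL u * nX u ^+ 3)%:E)%E.
Proof.
move=> hm; have [C C0 h] := test_l4 oD bD M0 DM hm.
exists C => // u hu; have h1 := H01_H1 hu; have lu := H1_L2 h1.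
have sqmeas v : L2 D v -> measurable_fun D (fun x => (sqmod (v x) ^+ 2)%:E).
  move=> /(L2P oD)[[m1 _] [m2 _]]; apply/measurable_EFinP; apply: measurable_funX; rewrite /sqmod.
  by apply: measurable_funD; apply: measurable_funX.
have [phi [t hphi]] := H01_fast hu.
apply/lee_addgt0Pr => d d0.
(* By [l4_perturb], enlarging both norms by [e <= 1] raises the bound by at most [e * K]. *)
pose K := C * ((nL u + 1) * (nX u + 1) ^+ 3) + 1.
have K0 : 0 < K by rewrite ltr_wpDl// !mulr_ge0 ?exprn_ge0 ?addr_ge0 ?L2norm_ge0 ?H01norm_ge0.
pose e := Num.min 1 (d / K).
have e0 : 0 < e by rewrite lt_min ltr01 divr_gt0.
have e1 : e <= 1 by rewrite ge_min lexx.
have eK : e * K <= d by rewrite -ler_pdivlMr// ge_min lexx orbT.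
have [k0 hk0] : exists k0, (1 / 8) ^+ k0 <= e ^+ 2.
  have hg : (geometric 1 (1 / 8 : R)) @ \oo --> (0 : R).
    by apply: cvg_geometric; rewrite ger0_norm; lra.
  have [N _ hN] := cvg0_near hg (exprn_gt0 2 e0).
  by exists N; have := hN N (leqnn N); rewrite /geometric/= mul1r.
have hd k : H1norm D (lin (-1) u (phi (k + k0)%N)) <= e.
  rewrite -(@ler_pXn2r _ 2)// ?nnegrE ?sqrtr_ge0 ?(ltW e0)//.
  apply: le_trans (hphi _) _; apply: le_trans hk0; rewrite exprD ler_piMl ?exprn_ge0//.
  by apply: exprn_ile1 => //; lra.
have hc : C * ((nL u + e) * (nX u + e) ^+ 3) <= C * nL u * nX u ^+ 3 + d.
  have := ler_wpM2l C0 (l4_perturb (L2norm_ge0 D u) (H01norm_ge0 D u) (ltW e0) e1).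
  move/le_trans; apply; move: eK; rewrite /K.
  by move: (nL u) (nX u) => a b; rewrite !mulrDr mulr1 mulrCA mulrA; lra.
rewrite -EFinD; apply: (@fatou_bound _ _ _ leb D mD (fun k x => (sqmod (phi (k + k0)%N x) ^+ 2)%:E)).
- by move=> k; apply: sqmeas; exact: test_fun_L2.
- exact: sqmeas.
- by move=> k x _; rewrite lee_fin sqr_ge0.
- by move=> x _; rewrite lee_fin sqr_ge0.
- have := H01_fast_ae oD bD hu t hphi; apply: filterS => x hx Dx; apply: cvg_EFin; first exact: nearW.
  have := hx Dx; rewrite -(cvg_shiftn k0) => h2.
  exact: (@cvgM _ _ _ _ (fun k => sqmod (phi (k + k0)%N x)) (fun k => sqmod (phi (k + k0)%N x)) _ _ h2 h2).
move=> k; apply: (le_trans (h _ (t _))); rewrite lee_fin; apply: le_trans hc.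
have h2 := H1_test oD bD (t (k + k0)%N).
have l1 := L2norm_sub_le oD lu (H1_L2 h2); have l2 := H01norm_sub_le oD bD h1 h2.
have l3 := L2norm_le_H1norm D (lin (-1) u (phi (k + k0)%N)).
have l4 := H01norm_le_H1norm D (lin (-1) u (phi (k + k0)%N)).
rewrite -mulrA; apply: ler_wpM2l => //; apply: ler_pM; try exact: L2norm_ge0.
- by rewrite exprn_ge0// H01norm_ge0.
- by apply: (le_trans l1); rewrite lerD2l; exact: le_trans l3 (hd k).
- rewrite lerXn2r ?nnegrE ?addr_ge0 ?H01norm_ge0 ?(ltW e0)//.
  by apply: (le_trans l2); rewrite lerD2l; exact: le_trans l4 (hd k).
Qed.

(** [test_ehrling] speaks of test functions, so each [w k] is replaced by a test function at H^1
    distance less than 1/(k+1). This raises the gradient bound by at most 1 and does not affect the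
    convergence of the pairings. *)
Lemma rellich (w : nat -> 'rV[R]_m.+2 -> R[i]) B : (forall k, H01 D (w k)) ->
  (forall k, nX (w k) <= B) ->
  (forall q, sq D q -> (fun k => ipr D q (fun x => Re (w k x))) @ \oo --> (0 : R)) ->
  (forall q, sq D q -> (fun k => ipr D q (fun x => Im (w k x))) @ \oo --> (0 : R)) ->
  (fun k => nL (w k)) @ \oo --> (0 : R).
Proof.
move=> hw wB cR cI.
have B0 : 0 <= B by apply: le_trans (wB 0%N); exact: H01norm_ge0.
have lw k := H1_L2 (H01_H1 (hw k)).
have exphi k : exists f, test_fun D f /\ H1norm D (lin (-1) (w k) f) < k.+1%:R^-1.
  have p : 0 < k.+1%:R^-1 :> R by rewrite invr_gt0.
  by have [f tf hf] := H01_density (hw k) p; exists f.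
have [phi hphi] := choice exphi.
have t k : test_fun D (phi k) by case: (hphi k).
have lp k : L2 D (phi k) by exact: test_fun_L2.
pose r k := lin (-1) (w k) (phi k).
have lr k : L2 D (r k) by exact: L2_lin.
have r1 k : H1norm D (r k) <= k.+1%:R^-1 by apply: ltW; case: (hphi k).
have inv0 : (fun k => k.+1%:R^-1) @ \oo --> (0 : R) by exact: cvg_harmonic.
have r0 : (fun k => nL (r k)) @ \oo --> (0 : R).
  apply: (cvg0_dom _ inv0) => k; rewrite ger0_norm ?L2norm_ge0//.
  exact: le_trans (L2norm_le_H1norm _ _) (r1 k).
have part (part : R[i] -> R) : (forall k x, part (phi k x) = part (w k x) + -1 * part (r k x)) ->
    (forall u, L2 D u -> sq D (fun x => part (u x))) ->
    (forall u, L2 D u -> Num.sqrt (ipr D (fun x => part (u x)) (fun x => part (u x))) <= nL u) ->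
    forall q, sq D q -> (fun k => ipr D q (fun x => part (w k x))) @ \oo --> (0 : R) ->
    (fun k => ipr D q (fun x => part (phi k x))) @ \oo --> (0 : R).
  move=> pE psq ple q sqq hc.
  have e k : ipr D q (fun x => part (phi k x)) = ipr D q (fun x => part (w k x)) +
      -1 * ipr D q (fun x => part (r k x)).
    have -> : (fun x => part (phi k x)) = linr (-1) (fun x => part (w k x)) (fun x => part (r k x)).
      by apply/funext => x; rewrite pE.
    rewrite iprC (ipr_linr oD); [|exact: psq|exact: psq|exact: sqq].
    by rewrite (iprC D q) (iprC D q).
  have -> : (fun k => ipr D q (fun x => part (phi k x))) = (fun k => ipr D q (fun x => part (w k x)) +
      -1 * ipr D q (fun x => part (r k x))) by apply/funext.
  apply: cvg0_add => //; apply: cvg0_Ml.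
  apply: (cvg0_dom _ (cvg0_Ml (Num.sqrt (ipr D q q)) r0)) => k.
  apply: (le_trans (ipr_cs oD sqq (psq _ (lr k)))).
  by apply: ler_wpM2l; [exact: sqrtr_ge0|exact: ple].
have pR q : sq D q -> (fun k => ipr D q (fun x => Re (phi k x))) @ \oo --> (0 : R).
  move=> sqq; refine (part (@complex.Re R) _ _ _ q sqq (cR q sqq)).
  - by move=> k x; rewrite /r !Re_lin; ring.
  - by move=> u /(L2P oD)[].
  move=> u hu; rewrite L2normE; apply: ler_wsqrtr.
  by rewrite (dotL_parts oD)// lerDl ipr_ge0.
have pI q : sq D q -> (fun k => ipr D q (fun x => Im (phi k x))) @ \oo --> (0 : R).
  move=> sqq; refine (part (@complex.Im R) _ _ _ q sqq (cI q sqq)).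
  - by move=> k x; rewrite /r !Im_lin; ring.
  - by move=> u /(L2P oD)[].
  move=> u hu; rewrite L2normE; apply: ler_wsqrtr.
  by rewrite (dotL_parts oD)// lerDr ipr_ge0.
apply: cvg0_le => e e0.
have B1 : 0 < 8 * (B + 1) ^+ 2 by rewrite mulr_gt0// exprn_gt0// ltr_wpDl.
(* With this factor the gradient term is at most [e^2 / 8]. The functionals eventually contribute as
   much, so the test function has norm at most [e / 2]; the other half is left for the remainder
   [r k]. *)
have [C [I [q [C0 sqq hC]]]] := test_ehrling oD bD M0 DM (divr_gt0 (exprn_gt0 2 e0) B1).
pose S k := C * (\sum_i (ipr D (q i) (fun x => Re (phi k x)) ^+ 2 +
     ipr D (q i) (fun x => Im (phi k x)) ^+ 2)).
have S0 : S @ \oo --> (0 : R).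
  apply: cvg0_Ml; apply: cvg0_sum => i; apply: cvg0_add; apply: cvg0_sqr; [exact: pR|exact: pI].
have e8 : 0 < e ^+ 2 / 8 by rewrite divr_gt0 ?exprn_gt0.
have e2 : 0 < e / 2 by rewrite divr_gt0.
apply: filterS2 (cvg0_near S0 e8) (cvg0_near r0 e2) => k hS hr.
rewrite ger0_norm ?L2norm_ge0//.
have h2 := H1_test oD bD (t k).
apply: (le_trans (L2norm_le_sub oD (lw k) (lp k))); rewrite -/(r k).
have nXp : nX (phi k) <= B + 1.
  apply: (le_trans (H01norm_sub_le oD bD (H01_H1 (hw k)) h2)); apply: lerD; first exact: wB.
  apply: (le_trans (H01norm_le_H1norm _ _)); apply: (le_trans (r1 k)).
  by rewrite invf_le1// ler1n.
have gp : gradip D (phi k) (phi k) <= (B + 1) ^+ 2.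
  by rewrite -H01norm_sqr lerXn2r ?nnegrE ?H01norm_ge0// addr_ge0.
have nLp : nL (phi k) ^+ 2 <= (e / 2) ^+ 2.
  rewrite L2norm_sqr; apply: (le_trans (hC _ (t k))); rewrite -/(S k).
  apply: (@le_trans _ _ (e ^+ 2 / 8 + e ^+ 2 / (8 * (B + 1) ^+ 2) * (B + 1) ^+ 2)).
    apply: lerD => //; apply: ler_wpM2l => //; apply: ltW; exact: divr_gt0 (exprn_gt0 2 e0) B1.
  rewrite le_eqVlt; apply/orP; left; apply/eqP; field.
  by rewrite gt_eqF// ltr_wpDl.
have {}nLp : nL (phi k) <= e / 2.
  by move: nLp; rewrite ler_pXn2r// ?nnegrE ?L2norm_ge0 ?(ltW e2).
by have := lerD hr nLp; lra.
Qed.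

End H01_inequalities.

(** * Riesz representation and compactness of weakly convergent sequences *)

Section H01_riesz.
Context (R : realType) (m : nat) (D : set 'rV[R]_m.+2).
Hypotheses (oD : open D) (bD : bounded_set D).
Let mD := mD oD.
Implicit Types u v w g h : 'rV[R]_m.+2 -> R[i].
Local Notation lin := (@lin R m.+2).
Local Notation nL := (L2norm D).
Local Notation nX := (H01norm D).
Variables (M : R) (M0 : 0 <= M) (DM : D `<=` cube m.+2 M).

Lemma H01_0 : H01 D (fun=> 0).
Proof. by apply: (H01_test oD bD); apply/test_funP; split; exact: ctest0. Qed.

Lemma H1norm_le_H01norm u : H01 D u -> H1norm D u <= (4 * M + 1) * nX u.
Proof.
move=> hu; rewrite -(@ler_pXn2r _ 2)// ?nnegrE ?sqrtr_ge0 ?mulr_ge0 ?addr_ge0 ?mulr_ge0 ?sqrtr_ge0//.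
rewrite H1normE sqr_sqrtr ?h1ip_ge0// /h1ip -L2norm_sqr -H01norm_sqr.
have h1 : nL u ^+ 2 <= (4 * M * nX u) ^+ 2.
  by rewrite lerXn2r ?nnegrE ?mulr_ge0 ?sqrtr_ge0 ?(poincare oD bD M0 DM)// mulr_ge0.
apply: (le_trans (lerD h1 (lexx _))); rewrite !exprMn -{2}[nX u ^+ 2]mul1r -mulrDl.
by apply: ler_wpM2r; [exact: sqr_ge0|move: M0 => ?; nra].
Qed.

Lemma H01_complete : sip_complete (H01 D) lin (gradip D).
Proof.
move=> u hu cu; have K0 : 0 < 4 * M + 1 by rewrite ltr_wpDl// mulr_ge0.
have [|v hv uv] := H01_complete_H1 oD bD hu.
  move=> e e0; have [N hN] := cu _ (divr_gt0 e0 K0); exists N => p q Np Nq.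
  rewrite -H1normE; apply: (le_trans (H1norm_le_H01norm (H01_lin oD bD (-1) (hu p) (hu q)))).
  by rewrite mulrC -ler_pdivlMr// H01normE; exact: hN.
exists v => // e e0; have [N hN] := uv e e0; exists N => p Np.
by rewrite -H01normE; apply: (le_trans (H01norm_le_H1norm D _)); rewrite H1normE; exact: hN.
Qed.

Lemma H01_riesz (F : ('rV[R]_m.+2 -> R[i]) -> R) C :
  (forall c u v, H01 D u -> H01 D v -> F (lin c u v) = F u + c * F v) ->
  (forall u, H01 D u -> `|F u| <= C * nX u) ->
  exists2 g, H01 D g & forall h, H01 D h -> gradip D g h = F h.
Proof.
move=> Flin FC.
have Fb u : H01 D u -> `|F u| <= C * Num.sqrt (gradip D u u) by rewrite -H01normE; exact: FC.
have linH c u v : H01 D u -> H01 D v -> H01 D (lin c u v) := @H01_lin _ _ _ oD bD c u v.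
have aC u v : H01 D u -> H01 D v -> gradip D u v = gradip D v u by move=> _ _; exact: gradipC.
have al c u v w : H01 D u -> H01 D v -> H01 D w ->
    gradip D (lin c u v) w = gradip D u w + c * gradip D v w.
  by move=> /H01_H1 ? /H01_H1 ? /H01_H1 ?; exact: gradip_lin.
have a0 u : H01 D u -> 0 <= gradip D u u by move=> _; exact: gradip_ge0.
exact: (sip_riesz linH aC al a0 H01_complete H01_0 Flin Fb).
Qed.

(** The opposite of [u] appears as u - 2 u, the form that [lin] provides. *)
Lemma mulI_mulI u : mulI (mulI u) = lin (-2) u u.
Proof.
by apply/funext => x; apply: complex_ext;
  rewrite ?Re_lin ?Im_lin ?Re_mulI ?Im_mulI ?Re_mulI ?Im_mulI; ring.
Qed.

Lemma dotL_mulIl u v : L2 D u -> L2 D v -> dotL D (mulI u) v = - dotL D u (mulI v).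
Proof.
move=> hu hv; have hv' := L2_mulI oD hv.
rewrite -(dotL_mulI D (mulI u) v) mulI_mulI (dotL_lin oD)//.
by move: (dotL _ _ _) => x; ring.
Qed.

Lemma gradip_mulIl u v : H1 D u -> H1 D v -> gradip D (mulI u) v = - gradip D u (mulI v).
Proof.
move=> hu hv; rewrite /gradip -sumrN; apply: eq_bigr => i _.
have lu : L2 D (wgrad D u i) by exact: wgrad_L2.
have lv : L2 D (wgrad D v i) by exact: wgrad_L2.
have lu' : L2 D (wgrad D (mulI u) i) by apply: wgrad_L2; exact: (H1_mulI oD bD).
have lv' : L2 D (wgrad D (mulI v) i) by apply: wgrad_L2; exact: (H1_mulI oD bD).
have rfl (w : 'rV[R]_m.+2 -> R[i]) : {ae leb, forall x, D x -> w x = w x} by apply: aeW.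
rewrite (ae_eq_dotL oD lu' (L2_mulI oD lu) lv lv (wgrad_mulI_ae oD bD i hu) (rfl _)).
rewrite (ae_eq_dotL oD lu lu lv' (L2_mulI oD lv) (rfl _) (wgrad_mulI_ae oD bD i hv)).
exact: dotL_mulIl.
Qed.

(** Riesz gives a function satisfying the real part of the defining identity; the imaginary part
    follows by testing with [mulI h]. Existence then transfers the identity to the chosen [GX]. *)
Lemma GX_spec w : L2 D w -> H01 D (GX D w) /\
  forall h, H01 D h -> gradip D (GX D w) h = dotL D w h.
Proof.
move=> lw; pose P g := H01 D g /\ forall h, H01 D h -> H01ip D g h = L2ip D w h.
have Fl c u v : H01 D u -> H01 D v -> dotL D w (lin c u v) = dotL D w u + c * dotL D w v.
  move=> /H01_H1/H1_L2 hu /H01_H1/H1_L2 hv; rewrite dotLC (dotL_lin oD)//.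
  by rewrite (dotLC D u) (dotLC D v).
have [|g hg gE] := @H01_riesz (dotL D w) (nL w * (4 * M)) Fl.
  move=> u hu; apply: (le_trans (dotL_cs oD lw (H1_L2 (H01_H1 hu)))).
  by rewrite -mulrA; apply: ler_wpM2l; [exact: L2norm_ge0|exact: (poincare oD bD M0 DM)].
have Pg : P g.
  split=> // h hh; have h1 := H01_H1 hh; apply: complex_ext.
    by rewrite Re_H01ip Re_L2ip gE.
  rewrite (Im_H01ip oD bD (H01_H1 hg) h1) Im_L2ip gradip_mulIl//; last exact: H01_H1.
  rewrite dotL_mulIl//; last exact: H1_L2.
  exact: (congr1 -%R (gE _ (H01_mulI oD bD hh))).
have [h1 h2] : P (GX D w) := xgetPex (fun=> 0) (ex_intro _ g Pg).
split; first exact: h1.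
move=> h hh; rewrite -Re_H01ip -Re_L2ip.
exact: (congr1 (@complex.Re R) (h2 h hh)).
Qed.

(** By Poincare and Riesz, pairing the real or imaginary part with a square-integrable [q] is an
    H_0^1 inner product with a fixed function, so weak convergence yields the hypotheses of
    [rellich]. *)
Lemma weak_cvg_L2 (v : nat -> 'rV[R]_m.+2 -> R[i]) w B : (forall k, H01 D (v k)) -> H01 D w ->
  (forall k, nX (v k) <= B) -> H01_weak_cvg D v w ->
  (fun k => nL (lin (-1) (v k) w)) @ \oo --> (0 : R).
Proof.
move=> hv hw vB hc.
have gc h : H01 D h -> (fun k => gradip D h (v k)) @ \oo --> gradip D h w.
  move=> hh; have e : (fun k => Re (H01ip D h (v k))) = (fun k => gradip D h (v k)).
    by apply/funext => k; exact: Re_H01ip.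
  by rewrite -e -Re_H01ip; exact: (proj1 (hc h hh)).
have main (part : R[i] -> R) : (forall c u v x, part (lin c u v x) = part (u x) + c * part (v x)) ->
    (forall u, L2 D u -> sq D (fun x => part (u x))) ->
    (forall u, L2 D u -> Num.sqrt (ipr D (fun x => part (u x)) (fun x => part (u x))) <= nL u) ->
    forall q, sq D q -> (fun k => ipr D q (fun x => part (lin (-1) (v k) w x))) @ \oo --> (0 : R).
  move=> pE psq ple q sqq; pose F u := ipr D q (fun x => part (u x)).
  have Fl c u v' : H01 D u -> H01 D v' -> F (lin c u v') = F u + c * F v'.
    move=> /H01_H1/H1_L2 hu /H01_H1/H1_L2 hv'; rewrite /F.
    have -> : (fun x => part (lin c u v' x)) = linr c (fun x => part (u x)) (fun x => part (v' x)).
      by apply/funext => x; rewrite pE.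
    rewrite iprC (ipr_linr oD); [|exact: psq|exact: psq|exact: sqq].
    by rewrite (iprC D q) (iprC D q).
  have [|g hg gE] := @H01_riesz F (Num.sqrt (ipr D q q) * (4 * M)) Fl.
    move=> u hu; have lu := H1_L2 (H01_H1 hu).
    apply: (le_trans (ipr_cs oD sqq (psq _ lu))); rewrite -mulrA.
    apply: ler_wpM2l; first exact: sqrtr_ge0.
    by apply: (le_trans (ple _ lu)); exact: (poincare oD bD M0 DM).
  have -> : (fun k => ipr D q (fun x => part (lin (-1) (v k) w x))) =
      (fun k => gradip D g (v k) - gradip D g w).
    apply/funext => k; rewrite -/(F _) (Fl _ _ _ (hv k) hw) (gE _ (hv k)) (gE _ hw).
    by rewrite mulN1r.
  by rewrite -(subrr (gradip D g w)); apply: cvgB; [exact: gc|exact: cvg_cst].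
have hd k : H01 D (lin (-1) (v k) w) := H01_lin oD bD (-1) (hv k) hw.
apply: (rellich oD bD M0 DM hd (B := B + nX w)).
- move=> k; have := H01norm_lin oD bD (-1) (H01_H1 (hv k)) (H01_H1 hw).
  by rewrite normrN1 mul1r => /le_trans; apply; rewrite lerD2r; exact: vB.
- refine (main (@complex.Re R) _ _ _).
  + by move=> *; exact: Re_lin.
  + by move=> u /(L2P oD)[].
  by move=> u hu; rewrite L2normE; apply: ler_wsqrtr; rewrite (dotL_parts oD)// lerDl ipr_ge0.
refine (main (@complex.Im R) _ _ _).
+ by move=> *; exact: Im_lin.
+ by move=> u /(L2P oD)[].
by move=> u hu; rewrite L2normE; apply: ler_wsqrtr; rewrite (dotL_parts oD)// lerDr ipr_ge0.
Qed.

End H01_riesz.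

(** * Angular momentum *)

Section multiplication_operators.
Context (R : realType) (n : nat) (D : set 'rV[R]_n).
Hypotheses (oD : open D) (bD : bounded_set D).
Let mD := mD oD.
Implicit Types u v w : 'rV[R]_n -> R[i].
Local Notation lin := (@lin R n).
Local Notation nL := (L2norm D).

Lemma Rint_ae_ge0 (f : 'rV[R]_n -> R) : measurable_fun D f -> {ae leb, forall x, D x -> 0 <= f x} ->
  0 <= \int[leb]_(x in D) f x.
Proof.
move=> mf f0; rewrite (@Rint_ae_eq _ _ _ oD f (fun x => `|f x|)) => //.
- by apply: Rintegral_ge0 => x _; exact: normr_ge0.
- exact: measurableT_comp.
by apply: filterS f0 => x h Dx; rewrite ger0_norm// h.
Qed.

Lemma Rint_ae_le (f g : 'rV[R]_n -> R) : ig D f -> ig D g -> {ae leb, forall x, D x -> f x <= g x} ->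
  \int[leb]_(x in D) f x <= \int[leb]_(x in D) g x.
Proof.
move=> hf hg fg; rewrite -subr_ge0 -RintegralB//; apply: Rint_ae_ge0.
  by apply: measurable_funB; apply: ig_meas.
by apply: filterS fg => x h Dx; rewrite subr_ge0 h.
Qed.

Definition mulR (b : 'rV[R]_n -> R) u : 'rV[R]_n -> R[i] := fun x => (b x)%:C%C * u x.

Lemma Re_mulR b u x : Re (mulR b u x) = b x * Re (u x).
Proof. by rewrite /mulR ReMc /= mul0r subr0. Qed.
Lemma Im_mulR b u x : Im (mulR b u x) = b x * Im (u x).
Proof. by rewrite /mulR ImMc /= mul0r addr0. Qed.

Section bounded_factor.
Variables (b : 'rV[R]_n -> R) (K : R).
Hypotheses (K0 : 0 <= K) (mb : measurable_fun D b) (bK : {ae leb, forall x, D x -> `|b x| <= K}).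

Lemma L2_mulR u : L2 D u -> L2 D (mulR b u).
Proof.
move=> /(L2P oD)[u1 u2]; apply/(L2P oD); split.
  by under eq_fun do rewrite Re_mulR; exact: (sq_ae_bounded oD mb bK).
by under eq_fun do rewrite Im_mulR; exact: (sq_ae_bounded oD mb bK).
Qed.

Lemma L2norm_mulR u : L2 D u -> nL (mulR b u) <= K * nL u.
Proof.
move=> hu; have hb := L2_mulR hu; rewrite !L2normE -[X in X * _]ger0_norm// -sqrtr_sqr -sqrtrM ?sqr_ge0//.
apply: ler_wsqrtr; rewrite /dotL -RintegralZl//; last exact: ig_dot.
apply: Rint_ae_le; [exact: ig_dot|by apply: igZ => //; exact: ig_dot|].
apply: filterS bK => x h Dx; rewrite /dot Re_mulR Im_mulR.
have -> : b x * Re (u x) * (b x * Re (u x)) + b x * Im (u x) * (b x * Im (u x)) =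
  `|b x| ^+ 2 * (Re (u x) * Re (u x) + Im (u x) * Im (u x)).
  by rewrite real_normK ?num_real//; ring.
apply: ler_wpM2r; first by rewrite -!expr2 addr_ge0 ?sqr_ge0.
by rewrite lerXn2r ?nnegrE// h.
Qed.

End bounded_factor.

Lemma mulR_lin b c u v : mulR b (lin c u v) = lin c (mulR b u) (mulR b v).
Proof.
by apply/funext => x; apply: complex_ext; rewrite ?Re_lin ?Im_lin ?Re_mulR ?Im_mulR ?Re_lin ?Im_lin; ring.
Qed.

Lemma dotL_mulRC b u v : dotL D (mulR b u) v = dotL D (mulR b v) u.
Proof. by apply: eq_Rintegral => x _; rewrite /dot !Re_mulR !Im_mulR; ring. Qed.

Lemma L2norm_mulI u : nL (mulI u) = nL u.
Proof. by rewrite !L2normE dotL_mulI. Qed.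

End multiplication_operators.

Lemma bilinear_sub (R : realType) (a b c d p q : R) : p = a + -1 * b -> q = c + -1 * d -> b = d ->
  a - c = p - q.
Proof. by move=> -> -> ->; ring. Qed.

Lemma density_arith (R : realType) (z p q : R) : 0 <= z -> p * z + q * z <= z * (p + q + 1).
Proof. by move=> z0; rewrite !mulrDr mulr1 ![z * _]mulrC lerDl. Qed.

Section angular_momentum.
Context (R : realType) (m : nat) (D : set 'rV[R]_m.+2).
Hypotheses (oD : open D) (bD : bounded_set D).
Let mD := mD oD.
Implicit Types u v w phi : 'rV[R]_m.+2 -> R[i].
Local Notation lin := (@lin R m.+2).
Local Notation nL := (L2norm D).
Local Notation nX := (H01norm D).
Variables (M : R) (M0 : 0 <= M) (DM : D `<=` cube m.+2 M).
Let ix : 'I_m.+2 := @Ordinal m.+2 0 isT.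
Let iy : 'I_m.+2 := @Ordinal m.+2 1 isT.
Let cx (i : 'I_m.+2) (r : 'rV[R]_m.+2) := r ord0 i.

Let mc i : measurable_fun D (cx i).
Proof. by apply: measurable_funTS; exact: measurable_coord. Qed.
Let cM i : {ae leb, forall x, D x -> `|cx i x| <= M}.
Proof. by apply: aeW => x Dx; exact: DM. Qed.

Lemma LzE u : Lz D u = mulI (lin (-1) (mulR (cx iy) (wgrad D u ix)) (mulR (cx ix) (wgrad D u iy))).
Proof.
apply/funext => x; apply: complex_ext;
  rewrite /Lz ?Re_mulI ?Im_mulI ?Re_lin ?Im_lin ?Re_mulR ?Im_mulR !partsE /= /cx; ring.
Qed.

Lemma Lz_L2 u : H1 D u -> L2 D (Lz D u).
Proof.
move=> hu; rewrite LzE; apply: (L2_mulI oD); apply: (L2_lin oD);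
  by apply: (L2_mulR oD (mc _) (cM _)); exact: wgrad_L2.
Qed.

Lemma L2norm_Lz u : H1 D u -> nL (Lz D u) <= 2 * M * nX u.
Proof.
move=> hu; rewrite LzE L2norm_mulI.
have h i j : nL (mulR (cx i) (wgrad D u j)) <= M * nX u.
  apply: (le_trans (L2norm_mulR oD M0 (mc i) (cM i) (wgrad_L2 j hu))).
  by apply: ler_wpM2l => //; exact: wgrad_le_H01norm.
have l i j : L2 D (mulR (cx i) (wgrad D u j)).
  by apply: (L2_mulR oD (mc _) (cM _)); exact: wgrad_L2.
apply: (le_trans (L2norm_lin oD (-1) (l _ _) (l _ _))); rewrite normrN1 mul1r.
apply: (le_trans (lerD (h _ _) (h _ _))).
by move: (nX u) => X; rewrite le_eqVlt; apply/orP; left; apply/eqP; ring.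
Qed.

Lemma Lz_lin_ae c u v : H1 D u -> H1 D v ->
  {ae leb, forall x, D x -> Lz D (lin c u v) x = lin c (Lz D u) (Lz D v) x}.
Proof.
move=> hu hv; have ax := wgrad_lin_ae oD bD c ix hu hv; have ay := wgrad_lin_ae oD bD c iy hu hv.
apply: filterS2 ax ay => x ex ey Dx; rewrite /Lz -/ix -/iy ex// ey//.
by rewrite /lin /Lz -/ix -/iy; ring.
Qed.

Lemma lip_lin c u v w : H1 D u -> H1 D v -> L2 D w ->
  dotL D (Lz D (lin c u v)) w = dotL D (Lz D u) w + c * dotL D (Lz D v) w.
Proof.
move=> hu hv hw; have lu := Lz_L2 hu; have lv := Lz_L2 hv.
rewrite -(dotL_lin oD c lu lv hw); apply: (ae_eq_dotL oD _ _ hw hw).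
- by apply: Lz_L2; exact: (H1_lin oD bD).
- exact: (L2_lin oD).
- exact: Lz_lin_ae.
by apply: aeW.
Qed.

Lemma lip_bound u v : H1 D u -> L2 D v -> `|dotL D (Lz D u) v| <= 2 * M * nX u * nL v.
Proof.
move=> hu hv; apply: (le_trans (dotL_cs oD (Lz_L2 hu) hv)).
by apply: ler_wpM2r; [exact: L2norm_ge0|exact: L2norm_Lz].
Qed.

Let scx i : smooth (cx i). Proof. exact: (@smooth_coord R m.+2 i). Qed.

Definition rot (g h : 'rV[R]_m.+2 -> R) (r : 'rV[R]_m.+2) : R := cx ix r * g r - cx iy r * h r.

Lemma Re_Lz u x : Re (Lz D u x) = rot (fun y => Im (wgrad D u iy y)) (fun y => Im (wgrad D u ix y)) x.
Proof. by rewrite /Lz /rot !partsE /= /cx -/ix -/iy; ring. Qed.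

Lemma Im_Lz u x : Im (Lz D u x) = - rot (fun y => Re (wgrad D u iy y)) (fun y => Re (wgrad D u ix y)) x.
Proof. by rewrite /Lz /rot !partsE /= /cx -/ix -/iy; ring. Qed.

Opaque Lz.

Lemma rot_sq g h : sq D g -> sq D h -> sq D (rot g h).
Proof.
move=> sg sh; apply: (sqD oD); first exact: (sq_ae_bounded oD (mc _) (cM _)).
by apply: (sqN oD); exact: (sq_ae_bounded oD (mc _) (cM _)).
Qed.

(** The coefficient x goes with the y-derivative and y with the x-derivative, so integrating by
    parts never differentiates a coefficient. *)
Lemma rot_by_parts f g h psi : sq D f -> sq D g -> sq D h ->
  weak_partial D iy f g -> weak_partial D ix f h -> ctest D psi ->
  ipr D (rot g h) psi = - ipr D f (rot (partial iy psi) (partial ix psi)).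
Proof.
move=> sf sg sh wg wh tpsi; have spsi := ctest_smooth tpsi.
have tc i : ctest D (fun x => cx i x * psi x) := ctestMl tpsi (scx i).
have pc i j : i != j -> partial i (fun x => cx j x * psi x) = fun x => cx j x * partial i psi x.
  move=> ij; rewrite (partialM i (scx j) spsi); apply/funext => x.
  by rewrite (partial_coord R i j) (negbTE ij) mulr0 addr0.
have s1 i : sq D (fun x => cx i x * psi x) by exact: ctest_sq.
have s2 i j : sq D (fun x => cx j x * partial i psi x).
  exact: (ctest_sq oD bD (ctestMl (ctest_partial i tpsi) (scx j))).
have e1 := wg _ (tc ix); have e2 := wh _ (tc iy).
rewrite !pc// in e1 e2.
have -> : ipr D (rot g h) psi = ipr D g (fun x => cx ix x * psi x) - ipr D h (fun x => cx iy x * psi x).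
  rewrite -RintegralB//; try exact: sqM.
  by apply: eq_Rintegral => x _; rewrite /rot; ring.
have -> : ipr D f (rot (partial iy psi) (partial ix psi)) =
  ipr D f (fun x => cx ix x * partial iy psi x) - ipr D f (fun x => cx iy x * partial ix psi x).
  rewrite -RintegralB//; try exact: sqM.
  by apply: eq_Rintegral => x _; rewrite /rot; ring.
by rewrite e1 e2 opprK opprD opprK.
Qed.

Lemma lip_sym_test u phi : H1 D u -> test_fun D phi ->
  dotL D (Lz D u) phi = dotL D (Lz D phi) u.
Proof.
move=> hu t; have lu := H1_L2 hu; have [ta tb] := (test_funP D phi).1 t.
have hphi := H1_test oD bD t.
have wu := (is_weak_gradP oD bD _ lu).1 (H1_wgrad hu).
have [/(L2P oD)[x1 x2] x3 x4] := wu ix; have [/(L2P oD)[y1 y2] y3 y4] := wu iy.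
have [u1 u2] := (L2P oD u).1 lu.
pose a x := Re (phi x); pose b x := Im (phi x).
pose L : 'rV[R]_m.+2 -> R[i] := fun x => (rot (partial iy b) (partial ix b) x +i* (- rot (partial iy a) (partial ix a) x))%C.
have s i f : ctest D f -> sq D (partial i f) by move=> tf; apply: ctest_sq => //; exact: ctest_partial.
have lL : L2 D L by apply/(L2P oD); split; [apply: rot_sq; exact: s|apply: (sqN oD); apply: rot_sq; exact: s].
have -> : dotL D (Lz D phi) u = dotL D L u.
  apply: (ae_eq_dotL oD (Lz_L2 hphi) lL lu lu); last exact: aeW.
  apply: filterS2 (wgrad_test_ae oD bD ix t) (wgrad_test_ae oD bD iy t) => x ex ey Dx.
  by apply: complex_ext; rewrite ?Re_Lz ?Im_Lz /rot ex// ey.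
rewrite (dotL_parts oD (Lz_L2 hu) (H1_L2 hphi)) (dotL_parts oD lL lu).
have e1 := rot_by_parts u2 y2 x2 y4 x4 ta; have e2 := rot_by_parts u1 y1 x1 y3 x3 tb.
have -> : (fun x => Re (Lz D u x)) = rot (fun y => Im (wgrad D u iy y)) (fun y => Im (wgrad D u ix y)).
  by apply/funext => x; exact: Re_Lz.
have -> : (fun x => Im (Lz D u x)) = linr (-2) (rot (fun y => Re (wgrad D u iy y)) (fun y => Re (wgrad D u ix y)))
    (rot (fun y => Re (wgrad D u iy y)) (fun y => Re (wgrad D u ix y))).
  by apply/funext => x; rewrite Im_Lz /linr; ring.
have -> : (fun x => Im (L x)) = linr (-2) (rot (partial iy a) (partial ix a)) (rot (partial iy a) (partial ix a)).
  by apply/funext => x; rewrite /linr /=; ring.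
have sr1 := rot_sq y1 x1; have sr2 := rot_sq (s iy _ ta) (s ix _ ta).
rewrite (ipr_linr oD _ sr1 sr1 (ctest_sq oD bD tb)) (ipr_linr oD _ sr2 sr2 u2) e1 e2.
rewrite (iprC D (fun x => Im (u x))) (iprC D (fun x => Re (u x))) /=.
by move: (ipr _ _ _) (ipr _ _ _) => p q; ring.
Qed.

(** Integration by parts settles the case of a test function in the second place; both sides are
    continuous in [v] for the H^1 norm, with combined constant at most [K]. *)
Lemma lip_sym u v : H01 D u -> H01 D v -> dotL D (Lz D u) v = dotL D (Lz D v) u.
Proof.
move=> hu hv; have h1 := H01_H1 hu; have h2 := H01_H1 hv.
have lu := H1_L2 h1; have lv := H1_L2 h2.
apply/eqP; rewrite -subr_eq0 -normr_le0; apply/ler_addgt0Pr => e e0.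
pose K := 2 * M * nX u + 2 * M * nL u + 1.
have K0 : 0 < K.
  by rewrite ltr_wpDl// addr_ge0// !mulr_ge0 ?H01norm_ge0 ?L2norm_ge0.
have [phi t hphi] := H01_density hv (divr_gt0 e0 K0).
have hp := H1_test oD bD t; have lp := H1_L2 hp.
pose r := lin (-1) v phi; have hr : H1 D r := H1_lin oD bD (-1) h2 hp.
have lr := H1_L2 hr.
have q1 : dotL D (Lz D u) r = dotL D (Lz D u) v + (-1) * dotL D (Lz D u) phi.
  have := dotL_lin oD (-1) lv lp (Lz_L2 h1).
  by rewrite (dotLC D v) (dotLC D phi) dotLC.
have q2 := lip_lin (-1) h2 hp lu; rewrite -/r in q2.
have e1 : dotL D (Lz D u) v - dotL D (Lz D v) u = dotL D (Lz D u) r - dotL D (Lz D r) u.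
  exact: (bilinear_sub q1 q2 (lip_sym_test h1 t)).
rewrite e1 add0r; apply: (le_trans (ler_normB _ _)).
apply: (le_trans (lerD (lip_bound h1 lr) (lip_bound hr lu))).
have l1 := L2norm_le_H1norm D r; have l2 := H01norm_le_H1norm D r.
have {}hphi : H1norm D r * K <= e by apply: ltW; rewrite -(ltr_pdivlMr _ _ K0); exact: hphi.
apply: le_trans hphi.
have M2 : 0 <= 2 * M by rewrite mulr_ge0.
have b1 := ler_wpM2l (mulr_ge0 M2 (H01norm_ge0 D u)) l1.
have b2 := ler_wpM2l (mulr_ge0 M2 (L2norm_ge0 D u)) l2.
have b3 : 0 <= H1norm D r by exact: sqrtr_ge0.
apply: (le_trans (lerD b1 (le_trans _ b2))).
  by rewrite mulrAC.
exact: (density_arith _ _ b3).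
Qed.

End angular_momentum.

(** * Projected gradient descent in an abstract setting *)

Section arithmetic.
Context (R : realType).

(** Here [x] stands for X(p)^2, [Nup] for N(u, p) and [qv] for the quartic part at u - al p. The
    first-order terms combine to [- al * x]; the smallness of [al] lets the higher-order terms
    consume at most half of it. *)
Lemma descent_arith (auu aup app qu qv Nup CA K4 be B Pb al x : R) :
  0 <= be -> 0 <= K4 -> 0 <= al -> al <= 1 -> app <= CA * x -> 0 <= x -> x <= Pb ^+ 2 ->
  qv <= qu - 4 * al * Nup + 8 * al ^+ 2 * K4 * B ^+ 2 * x + 3 * al ^+ 4 * K4 * x ^+ 2 ->
  aup + be * Nup = x ->
  al * (CA / 2 + 2 * be * K4 * B ^+ 2 + be * K4 * Pb ^+ 2) <= 2^-1 ->
  (auu - 2 * al * aup + al ^+ 2 * app) / 2 + be / 4 * qv <=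
    auu / 2 + be / 4 * qu - al / 2 * x.
Proof.
move=> be0 K0 al0 al1 happ x0 xP hq hx hal.
have h1 : be / 4 * qv <= be / 4 * (qu - 4 * al * Nup + 8 * al ^+ 2 * K4 * B ^+ 2 * x + 3 * al ^+ 4 * K4 * x ^+ 2).
  by apply: ler_wpM2l => //; rewrite divr_ge0.
have h2 : al ^+ 2 * app <= al ^+ 2 * (CA * x) by apply: ler_wpM2l => //; exact: sqr_ge0.
have h3 : al ^+ 4 * x ^+ 2 <= al ^+ 2 * (Pb ^+ 2 * x).
  have -> : al ^+ 4 * x ^+ 2 = al ^+ 2 * ((al ^+ 2 * x) * x) by ring.
  apply: ler_wpM2l; first exact: sqr_ge0.
  apply: ler_wpM2r => //; apply: le_trans xP; rewrite ler_piMl//.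
  by rewrite expr2 mulr_ile1.
have h4 := ler_wpM2l (mulr_ge0 be0 K0) h3.
have h5 := ler_wpM2l (mulr_ge0 al0 x0) hal.
have h6 : 0 <= be * K4 * (al ^+ 2 * (Pb ^+ 2 * x)).
  exact: mulr_ge0 (mulr_ge0 be0 K0) (mulr_ge0 (sqr_ge0 _) (mulr_ge0 (sqr_ge0 _) x0)).
have e1 : aup = x - be * Nup by rewrite -hx addrK.
rewrite e1.
have e2 : be / 4 * (qu - 4 * al * Nup + 8 * al ^+ 2 * K4 * B ^+ 2 * x + 3 * al ^+ 4 * K4 * x ^+ 2) =
  be / 4 * qu - al * (be * Nup) + 2 * (be * K4 * (al ^+ 2 * (B ^+ 2 * x))) +
  3 / 4 * (be * K4 * (al ^+ 4 * x ^+ 2)) by field.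
have e3 : al * x * (al * (CA / 2 + 2 * be * K4 * B ^+ 2 + be * K4 * Pb ^+ 2)) =
  al ^+ 2 * (CA * x) / 2 + 2 * (be * K4 * (al ^+ 2 * (B ^+ 2 * x))) + be * K4 * (al ^+ 2 * (Pb ^+ 2 * x)).
  by field.
rewrite e2 in h1; rewrite e3 in h5.
have e4 : (auu - 2 * al * (x - be * Nup) + al ^+ 2 * app) / 2 =
  auu / 2 - al * x + al * (be * Nup) + al ^+ 2 * app / 2 by field.
rewrite e4; lra.
Qed.

End arithmetic.

Lemma cst_cvg0 (R : realType) (c : R) (s : nat -> R) : (forall j, c = s j) ->
  s @ \oo --> (0 : R) -> c = 0.
Proof.
move=> cs; have -> : s = cst c by apply/funext => j; rewrite -cs.
by move=> /(cvg_lim (@Rhausdorff R)) <-; rewrite lim_cst.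
Qed.

Section descent.
Context (R : realType) (T : Type) (H : set T) (lin : R -> T -> T -> T).
(* [l] and [g] are the inner products of L^2 and H_0^1; the energy is
   [a u u / 2 + be / 4 * q u], and [4 * N u] is the derivative of [q] at [u]. *)
Variables (l g a N : T -> T -> R) (q : T -> R).
Let L u := Num.sqrt (l u u).
Let X u := Num.sqrt (g u u).
Hypotheses (linH : forall c u v, H u -> H v -> H (lin c u v))
  (lC : forall u v, H u -> H v -> l u v = l v u)
  (llin : forall c u v w, H u -> H v -> H w -> l (lin c u v) w = l u w + c * l v w)
  (l_ge0 : forall u, H u -> 0 <= l u u)
  (gC : forall u v, H u -> H v -> g u v = g v u)
  (glin : forall c u v w, H u -> H v -> H w -> g (lin c u v) w = g u w + c * g v w)
  (g_ge0 : forall u, H u -> 0 <= g u u)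
  (aC : forall u v, H u -> H v -> a u v = a v u)
  (alin : forall c u v w, H u -> H v -> H w -> a (lin c u v) w = a u w + c * a v w).
Variables (c0 CA CL K4 be : R).
Hypotheses (c0_gt0 : 0 < c0) (CA0 : 0 <= CA) (CL0 : 0 <= CL) (K40 : 0 <= K4) (be0 : 0 <= be).
Hypotheses (a_coer : forall u, H u -> c0 * g u u <= a u u)
  (a_bnd : forall u v, H u -> H v -> `|a u v| <= CA * X u * X v)
  (a_low : forall u w, H u -> H w -> `|a u w - g u w| <= CL * X u * L w)
  (q_ge0 : forall u, H u -> 0 <= q u)
  (N_bnd : forall u v, H u -> H v -> `|N u v| <= K4 * X u ^+ 3 * X v)
  (Nq : forall u, H u -> N u u = q u)
  (q_scale : forall c u, H u -> q (lin (c - 1) u u) = c ^+ 4 * q u)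
  (q_step : forall t u p, H u -> H p -> q (lin (- t) u p) <=
     q u - 4 * t * N u p + 8 * t ^+ 2 * K4 * X u ^+ 2 * X p ^+ 2 + 3 * t ^+ 4 * K4 * (X p ^+ 2) ^+ 2)
  (N_small : forall B e, 0 < e -> exists2 d, 0 < d & forall u w, H u -> H w ->
     X u <= B -> X w <= B -> L w <= d -> `|N u w| <= e)
  (N_cont : forall B h e, H h -> 0 < e -> exists2 d, 0 < d & forall u v, H u -> H v ->
     X u <= B -> X v <= B -> L (lin (-1) u v) <= d -> `|N u h - N v h| <= e)
  (cpt : forall (v : nat -> T) w B, (forall k, H (v k)) -> H w -> (forall k, X (v k) <= B) ->
     (forall h, H h -> (fun k => g h (v k)) @ \oo --> g h w) ->
     (fun k => L (lin (-1) (v k) w)) @ \oo --> (0 : R)).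
Let E u := a u u / 2 + be / 4 * q u.
Let dE u v := a u v + be * N u v.
Variables (S G : T -> T).
Hypotheses (SP : forall u, H u -> H (S u) /\ forall h, H h -> g (S u) h = dE u h)
  (GP : forall u, H u -> H (G u) /\ forall h, H h -> g (G u) h = l u h).
(** The coefficient that makes [P u] orthogonal to [G u] for [g], hence to [u] for [l]. *)
Let mu u := g (S u) (G u) / g (G u) (G u).
Let P u := lin (- mu u) (S u) (G u).

Let X0 u : 0 <= X u. Proof. exact: sqrtr_ge0. Qed.
Let L0 u : 0 <= L u. Proof. exact: sqrtr_ge0. Qed.
Let Xsq u : H u -> X u ^+ 2 = g u u. Proof. by move=> hu; rewrite sqr_sqrtr// g_ge0. Qed.
Let Lsq u : H u -> L u ^+ 2 = l u u. Proof. by move=> hu; rewrite sqr_sqrtr// l_ge0. Qed.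
Let gcs u v : H u -> H v -> `|g u v| <= X u * X v := sip_cauchy_schwarz linH gC glin g_ge0 (u := u) (v := v).
Let lcs u v : H u -> H v -> `|l u v| <= L u * L v := sip_cauchy_schwarz linH lC llin l_ge0 (u := u) (v := v).

Let HP u : H u -> H (P u).
Proof. by move=> hu; apply: linH; [case: (SP hu)|case: (GP hu)]. Qed.

Lemma gP u h : H u -> H h -> g (P u) h = dE u h - mu u * l u h.
Proof.
move=> hu hh; have [hS SE] := SP hu; have [hG GE] := GP hu.
by rewrite glin// SE// GE// mulNr.
Qed.

(** [g (G u) u] is the squared L^2 norm of [u], that is 1; by Cauchy-Schwarz [G u] cannot have norm
    zero. This justifies the division in [mu]. *)
Lemma G_pos u : H u -> L u = 1 -> 0 < g (G u) (G u).
Proof.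
move=> hu lu; have [hG GE] := GP hu; rewrite lt_neqAle g_ge0// andbT eq_sym.
apply/eqP => G0; have := gcs hG hu.
rewrite GE// -Lsq// lu expr1n normr1 /X G0 sqrtr0 mul0r.
by rewrite leNgt ltr01.
Qed.

Lemma lP0 u : H u -> L u = 1 -> l u (P u) = 0.
Proof.
move=> hu lu; have [hS SE] := SP hu; have [hG GE] := GP hu.
have G0 := G_pos hu lu.
rewrite -GE; last exact: HP.
rewrite gC//; last exact: HP.
by rewrite glin// /mu mulNr divfK ?gt_eqF// subrr.
Qed.

Lemma dEP u : H u -> L u = 1 -> dE u (P u) = X (P u) ^+ 2.
Proof.
by move=> hu lu; have hp := HP hu; rewrite Xsq// gP// (lP0 hu lu) mulr0 subr0.
Qed.

Lemma dE_bnd u v : H u -> H v -> `|dE u v| <= (CA * X u + be * K4 * X u ^+ 3) * X v.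
Proof.
move=> hu hv; apply: (le_trans (ler_normD _ _)); rewrite mulrDl; apply: lerD; first exact: a_bnd.
by rewrite normrM (ger0_norm be0); apply: (le_trans (ler_wpM2l be0 (N_bnd hu hv))); rewrite !mulrA.
Qed.

(** X(P u)^2 equals [dE u (P u)], at most a constant times X(P u); one factor cancels. *)
Lemma X_P u B : H u -> L u = 1 -> X u <= B -> X (P u) <= CA * B + be * K4 * B ^+ 3.
Proof.
move=> hu lu uB; have hp := HP hu.
have B0 : 0 <= B := le_trans (X0 u) uB.
have h : X (P u) ^+ 2 <= (CA * B + be * K4 * B ^+ 3) * X (P u).
  rewrite -dEP//; apply: (le_trans (ler_norm _)); apply: (le_trans (dE_bnd hu hp)).
  apply: ler_wpM2r => //; apply: lerD; first exact: ler_wpM2l.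
  by apply: ler_wpM2l; [exact: mulr_ge0|rewrite lerXn2r ?nnegrE].
have [x0|x0] := eqVneq (X (P u)) 0.
  by rewrite x0 addr_ge0// !mulr_ge0// exprn_ge0.
by move: h; rewrite expr2 ler_pM2r// lt_neqAle eq_sym x0 X0.
Qed.

Lemma E_coer u : H u -> c0 * X u ^+ 2 <= 2 * E u.
Proof.
move=> hu; rewrite Xsq//; apply: (le_trans (a_coer hu)).
rewrite /E mulrDr mulrCA divff// mulr1 lerDl mulr_ge0// mulr_ge0 ?q_ge0//.
by rewrite divr_ge0.
Qed.

Let v al u := lin (- al) u (P u).
(** Scaling by [c], written as w + (c - 1) w with the only operation at hand. *)
Let scal c w := lin (c - 1) w w.
Let next al u := scal (L (v al u))^-1 (v al u).
(** [Pb B] bounds the projected gradient on the ball of radius [B], by [X_P]; [Cst B] collects the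
    second-order coefficients in the smallness condition of [descent_arith]. *)
Let Pb B := CA * B + be * K4 * B ^+ 3.
Let Cst B := CA / 2 + 2 * be * K4 * B ^+ 2 + be * K4 * Pb B ^+ 2.

Let Hv al u : H u -> H (v al u). Proof. by move=> hu; apply: linH => //; exact: HP. Qed.
Let Hnext al u : H u -> H (next al u). Proof. by move=> hu; apply: linH => //; exact: Hv. Qed.

Lemma form_scale (b : T -> T -> R) c w : (forall u v, H u -> H v -> b u v = b v u) ->
  (forall c u v w, H u -> H v -> H w -> b (lin c u v) w = b u w + c * b v w) ->
  H w -> b (scal c w) (scal c w) = c ^+ 2 * b w w.
Proof.
move=> bC bl hw; rewrite (sip_sqr linH bC bl _ hw hw).
by move: (b w w) => z; ring.
Qed.

Lemma L_v al u : H u -> L u = 1 -> 1 <= L (v al u).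
Proof.
move=> hu lu; rewrite -(@ler_pXn2r _ 2)// ?nnegrE// expr1n Lsq; last exact: Hv.
rewrite (sip_sqr linH lC llin _ hu (HP hu)) (lP0 hu lu) mulr0 addr0 -Lsq// lu expr1n lerDl.
by rewrite mulr_ge0 ?sqr_ge0// l_ge0//; exact: HP.
Qed.

Lemma L_next al u : H u -> L u = 1 -> L (next al u) = 1.
Proof.
move=> hu lu; have l1 := L_v al hu lu; have hv := Hv al hu.
have l0 : 0 < L (v al u) := lt_le_trans ltr01 l1.
rewrite /L (form_scale _ lC llin hv) -/(L _) -Lsq// exprVn mulVf ?sqrtr1//.
by rewrite expf_neq0// gt_eqF.
Qed.

Lemma E_next al u B : H u -> L u = 1 -> X u <= B -> 0 <= al -> al <= 1 -> al * Cst B <= 2^-1 ->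
  E (next al u) <= E u - al / 2 * X (P u) ^+ 2.
Proof.
move=> hu lu uB al0 al1 hal; have l1 := L_v al hu lu; have hv := Hv al hu; have hp := HP hu.
have l0 : 0 < L (v al u) := lt_le_trans ltr01 l1.
have B0 : 0 <= B := le_trans (X0 u) uB.
(* The two parts of [E] are nonnegative and homogeneous of degrees 2 and 4, so the factor 1 / L(v)
   <= 1 decreases both. *)
apply: (@le_trans _ _ (E (v al u))).
  rewrite /E (form_scale _ aC alin hv) q_scale//.
  have i1 : (L (v al u))^-1 <= 1 by rewrite invf_le1.
  have i0 : 0 <= (L (v al u))^-1 by rewrite invr_ge0.
  have a0 : 0 <= a (v al u) (v al u).
    by apply: le_trans (a_coer hv); rewrite mulr_ge0 ?(ltW c0_gt0)// g_ge0.
  apply: lerD; first by rewrite ler_pM2r ?invr_gt0// ler_piMl// exprn_ile1.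
  by apply: ler_wpM2l; [rewrite divr_ge0|rewrite ler_piMl ?q_ge0// exprn_ile1].
have e : a (v al u) (v al u) = a u u - 2 * al * a u (P u) + al ^+ 2 * a (P u) (P u).
  rewrite (sip_sqr linH aC alin _ hu hp); move: (a _ _) (a _ _) (a _ _) => x y z; ring.
rewrite /E e; apply: (@descent_arith R (a u u) (a u (P u)) (a (P u) (P u)) (q u) (q (v al u)) (N u (P u)) CA K4 be B (Pb B) al) => //.
- by apply: (le_trans (ler_norm _)); apply: (le_trans (a_bnd hp hp)); rewrite -mulrA expr2.
- exact: sqr_ge0.
- by rewrite lerXn2r ?nnegrE// ?addr_ge0 ?mulr_ge0 ?exprn_ge0//; exact: X_P.
- apply: (le_trans (q_step al hu hp)); rewrite lerD2r lerD2l.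
  apply: ler_wpM2r; first exact: sqr_ge0.
  apply: ler_wpM2l; first by rewrite !mulr_ge0 ?sqr_ge0.
  by rewrite lerXn2r ?nnegrE.
exact: dEP.
Qed.

(** [E0 n0] bounds the energy of every function of norm [n0], and coercivity confines that energy
    level to the radius [bnd n0]. The inverse of [2 * Cst + 1] is at most 1 and keeps the step times
    [Cst] below 1/2. *)
Let E0 n0 := CA / 2 * n0 ^+ 2 + be / 4 * (K4 * n0 ^+ 4).
Let bnd n0 := Num.sqrt (2 * E0 n0 / c0).
Definition step_bound n0 := (2 * Cst (bnd n0) + 1)^-1.

Let Cst_ge0 n0 : 0 <= Cst (bnd n0).
Proof.
rewrite /Cst; apply: addr_ge0; last exact: mulr_ge0 (mulr_ge0 be0 K40) (sqr_ge0 _).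
apply: addr_ge0; first by rewrite divr_ge0.
exact: mulr_ge0 (mulr_ge0 (mulr_ge0 (ler0n R 2) be0) K40) (sqr_ge0 _).
Qed.

Lemma step_bound_gt0 n0 : 0 < step_bound n0.
Proof. by rewrite invr_gt0 ltr_wpDl// mulr_ge0. Qed.

Lemma step_bound_le1 n0 : step_bound n0 <= 1.
Proof. by rewrite invf_le1 ?ltr_wpDl ?mulr_ge0// lerDr mulr_ge0. Qed.

Section scheme.
Variables (n0 amin : R) (u : nat -> T) (alpha : nat -> R).
Hypotheses (u0 : H (u 0%N)) (Lu0 : L (u 0%N) = 1) (Xu0 : X (u 0%N) = n0) (amin0 : 0 < amin)
  (al_ge : forall k, amin <= alpha k) (al_le : forall k, alpha k <= step_bound n0)
  (uS : forall k, u k.+1 = next (alpha k) (u k)).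
Let B := bnd n0.

Lemma E_le_X w : H w -> E w <= E0 n0 -> X w <= B.
Proof.
move=> hw hE; rewrite /B /bnd -[leLHS]ger0_norm// -sqrtr_sqr; apply: ler_wsqrtr.
rewrite ler_pdivlMr// mulrC; apply: (le_trans (E_coer hw)).
by rewrite ler_pM2l.
Qed.

Let al0 k : 0 <= alpha k. Proof. exact: le_trans (ltW amin0) (al_ge k). Qed.

Lemma al_Cst k : alpha k * Cst B <= 2^-1.
Proof.
have C0 := Cst_ge0 n0; have D0 : 0 < 2 * Cst B + 1 by rewrite ltr_wpDl// mulr_ge0.
have h : alpha k * (2 * Cst B + 1) <= 1.
  by rewrite -ler_pdivlMr// div1r; exact: al_le.
by have := al0 k; move: h; rewrite /B; move: (Cst _) (alpha k) C0 => c z c00; rewrite mulrDr mulrCA; lra.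
Qed.

(** The propagated quantity is the energy level: the step condition requires the radius [B], which
    [E_le_X] recovers from that level after each step. *)
Lemma scheme_inv k : [/\ H (u k), L (u k) = 1, E (u k) <= E0 n0 & X (u k) <= B].
Proof.
elim: k => [|k [hu lu Eu Xu]].
  have hE : E (u 0%N) <= E0 n0.
    rewrite /E /E0; apply: lerD.
      rewrite mulrAC ler_pM2r ?invr_gt0// -Xu0; apply: (le_trans (ler_norm _)).
      by apply: (le_trans (a_bnd u0 u0)); rewrite -mulrA expr2.
    apply: ler_wpM2l; first by rewrite divr_ge0.
    by rewrite -Nq// -Xu0; apply: (le_trans (ler_norm _)); apply: (le_trans (N_bnd u0 u0)); rewrite -mulrA -exprSr.
  by split=> //; exact: E_le_X.
have al1 : alpha k <= 1 := le_trans (al_le k) (step_bound_le1 n0).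
have hE : E (u k.+1) <= E0 n0.
  rewrite uS; apply: (le_trans (E_next hu lu Xu (al0 k) al1 (al_Cst k))); apply: le_trans Eu.
  by rewrite lerBlDr lerDl mulr_ge0 ?sqr_ge0// divr_ge0.
have hu' : H (u k.+1) by rewrite uS; exact: Hnext.
by split=> //; [rewrite uS; exact: L_next|exact: E_le_X].
Qed.

Let Hu k : H (u k). Proof. by case: (scheme_inv k). Qed.
Let Lu k : L (u k) = 1. Proof. by case: (scheme_inv k). Qed.
Let Xu k : X (u k) <= B. Proof. by case: (scheme_inv k). Qed.

Lemma energy_decrease k : amin / 2 * X (P (u k)) ^+ 2 <= E (u k) - E (u k.+1).
Proof.
have al1 : alpha k <= 1 := le_trans (al_le k) (step_bound_le1 n0).
have h := E_next (Hu k) (Lu k) (Xu k) (al0 k) al1 (al_Cst k).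
rewrite lerBrDr -lerBrDl in h; rewrite -uS in h.
apply: (@le_trans _ _ (alpha k / 2 * X (P (u k)) ^+ 2)).
  by apply: ler_wpM2r; [exact: sqr_ge0|rewrite ler_pM2r ?invr_gt0].
exact: h.
Qed.

(** The energies decrease and are nonnegative, so their differences tend to 0; the lower bound
    [amin] on the steps lets these differences control X(P)^2. *)
Lemma grad_cvg0 : (fun k => X (P (u k))) @ \oo --> (0 : R).
Proof.
pose e k := E (u k).
have e_ge0 k : 0 <= e k.
  have := E_coer (Hu k); rewrite -/(e k) => h.
  by rewrite -(@pmulr_rge0 _ 2)//; apply: le_trans h; rewrite mulr_ge0 ?sqr_ge0// ltW.
have dec k : e k.+1 <= e k.
  rewrite -subr_ge0; apply: le_trans (energy_decrease k).
  by rewrite mulr_ge0 ?sqr_ge0// divr_ge0 ?(ltW amin0).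
have ce : cvgn e.
  apply: nonincreasing_is_cvgn; first exact/nonincreasing_seqP.
  by exists 0 => _ [k _ <-].
have c1 : (fun k => e k - e k.+1) @ \oo --> (0 : R).
  rewrite -(subrr (limn e)); apply: cvgB; first exact: ce.
  by rewrite (cvg_shiftS e); exact: ce.
have c2 : (fun k => X (P (u k)) ^+ 2) @ \oo --> (0 : R).
  apply: (cvg0_dom _ (cvg0_Ml (amin / 2)^-1 c1)) => k.
  rewrite ger0_norm ?sqr_ge0// mulrC ler_pdivlMr ?divr_gt0// mulrC.
  exact: energy_decrease.
have -> : (fun k => X (P (u k))) = (fun k => Num.sqrt (X (P (u k)) ^+ 2)).
  by apply/funext => k; rewrite sqrtr_sqr ger0_norm.
rewrite -sqrtr0; apply: (@continuous_cvg _ _ _ _ _ (fun k => X (P (u k)) ^+ 2) Num.sqrt) => //.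
exact: sqrt_continuous.
Qed.

Variables (k : nat -> nat) (ustar : T).
Hypotheses (kc : k @ \oo --> \oo) (hs : H ustar)
  (weak : forall h, H h -> (fun j => g h (u (k j))) @ \oo --> g h ustar).
Let w j := lin (-1) (u (k j)) ustar.
Let Hw j : H (w j). Proof. by apply: linH. Qed.
Let b_w (b : T -> T -> R) :
  (forall c u v w, H u -> H v -> H w -> b (lin c u v) w = b u w + c * b v w) ->
  forall j h, H h -> b (w j) h = b (u (k j)) h - b ustar h.
Proof. by move=> bl j h hh; rewrite bl// mulN1r. Qed.

Let Xw j : X (w j) <= B + X ustar.
Proof.
apply: (le_trans (sip_nrm_lin linH gC glin g_ge0 (-1) (Hu (k j)) hs)).
by rewrite normrN1 mul1r lerD2r; exact: Xu.
Qed.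

Lemma L_cvg0 : (fun j => L (w j)) @ \oo --> (0 : R).
Proof. by apply: (cpt (B := B)) => // j; exact: Xu. Qed.

Lemma X_P_cvg0 : (fun j => X (P (u (k j)))) @ \oo --> (0 : R).
Proof. exact: (cvg_comp _ _ kc grad_cvg0). Qed.

Let l_w0 h : H h -> (fun j => l (w j) h) @ \oo --> (0 : R).
Proof.
move=> hh; apply: (cvg0_dom _ (cvg0_Ml (L h) L_cvg0)) => j.
by rewrite mulrC; exact: lcs.
Qed.

Lemma L_ustar : L ustar = 1.
Proof.
have h : 1 - l ustar ustar = 0.
  apply: (cst_cvg0 (s := fun j => l (w j) (u (k j)) + l (w j) ustar)) => [j|].
    rewrite !(b_w llin)// (lC hs (Hu (k j))) -(Lsq (Hu (k j))) Lu expr1n.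
    by move: (l _ _) (l _ _) => x y; ring.
  apply: cvg0_add; last exact: l_w0.
  by apply: (cvg0_dom _ L_cvg0) => j; apply: (le_trans (lcs (Hw j) (Hu (k j)))); rewrite Lu mulr1.
by move/eqP: h; rewrite subr_eq0 => /eqP h; rewrite /L -h sqrtr1.
Qed.

Let Mmu := 2 * Pb B * B.

(** Testing [gP] with [u j] itself and using L(u_j) = 1 expresses [mu] as a difference of two terms,
    each at most [Pb B * B] in absolute value. *)
Lemma mu_bnd j : `|mu (u j)| <= Mmu.
Proof.
have hu := Hu j; have := gP hu hu; rewrite -Lsq// Lu expr1n mulr1 => h.
have -> : mu (u j) = dE (u j) (u j) - g (P (u j)) (u j) by rewrite h opprB addrC subrK.
have B0 : 0 <= B := le_trans (X0 _) (Xu j).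
have P0 : 0 <= Pb B := le_trans (X0 _) (X_P hu (Lu j) (Xu j)).
apply: (le_trans (ler_normB _ _)).
have -> : Mmu = Pb B * B + Pb B * B by rewrite /Mmu; ring.
apply: lerD.
  apply: (le_trans (dE_bnd hu hu)); apply: ler_pM => //.
    by rewrite addr_ge0// !mulr_ge0// exprn_ge0.
  apply: lerD; first exact: ler_wpM2l.
  by apply: ler_wpM2l; [exact: mulr_ge0|rewrite lerXn2r ?nnegrE].
apply: (le_trans (gcs (HP hu) hu)); apply: ler_pM => //.
exact: X_P.
Qed.

Lemma N_w0 : (fun j => N (u (k j)) (w j)) @ \oo --> (0 : R).
Proof.
apply: cvg0_le => e e0; have [d d0 hd] := N_small (B + X ustar) e0.
apply: filterS (cvg0_near L_cvg0 d0) => j hj; apply: hd => //.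
by apply: (le_trans (Xu _)); rewrite lerDl.
Qed.

Lemma X_cvg0 : (fun j => X (w j)) @ \oo --> (0 : R).
Proof.
have gvw : (fun j => g (u (k j)) (w j)) @ \oo --> (0 : R).
  pose t j := X (P (u (k j))) * (B + X ustar) + (Mmu * L (w j) + (be * `|N (u (k j)) (w j)| + CL * B * L (w j))).
  have t0 : t @ \oo --> (0 : R).
    apply: cvg0_add.
      by under eq_fun do rewrite mulrC; apply: cvg0_Ml; exact: X_P_cvg0.
    apply: cvg0_add; first by apply: cvg0_Ml; exact: L_cvg0.
    apply: cvg0_add; last by apply: cvg0_Ml; exact: L_cvg0.
    by apply: cvg0_Ml; apply/norm_cvg0P; exact: N_w0.
  apply: (cvg0_dom _ t0) => j; have hv := Hu (k j); have hw := Hw j.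
  (* [a] is traded for [g]: their difference contains only lower-order terms, which [a_low] controls
     by the L^2 norm of [w j]. *)
  have e : g (u (k j)) (w j) = g (P (u (k j))) (w j) + (mu (u (k j)) * l (u (k j)) (w j) +
     (- (be * N (u (k j)) (w j)) - (a (u (k j)) (w j) - g (u (k j)) (w j)))).
    by rewrite gP// /dE; move: (a _ _) (g _ _) (N _ _) (l _ _) (mu _) => x1 x2 x3 x4 x5; ring.
  rewrite e; apply: (le_trans (ler_normD _ _)); apply: lerD.
    by apply: (le_trans (gcs (HP hv) hw)); apply: ler_wpM2l.
  apply: (le_trans (ler_normD _ _)); apply: lerD.
    rewrite normrM; apply: ler_pM => //; first exact: mu_bnd.
    by apply: (le_trans (lcs hv hw)); rewrite Lu mul1r.
  apply: (le_trans (ler_normB _ _)); rewrite normrN normrM (ger0_norm be0) lerD2l.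
  apply: (le_trans (a_low hv hw)); apply: ler_wpM2r => //.
  by apply: ler_wpM2l.
have gsw : (fun j => g ustar (w j)) @ \oo --> (0 : R).
  have -> : (fun j => g ustar (w j)) = (fun j => g ustar (u (k j)) - g ustar ustar).
    apply/funext => j; rewrite (gC hs (Hw j)) (b_w glin)//.
    by rewrite (gC (Hu _) hs).
  by rewrite -(subrr (g ustar ustar)); apply: cvgB; [exact: weak|exact: cvg_cst].
have c2 : (fun j => X (w j) ^+ 2) @ \oo --> (0 : R).
  have -> : (fun j => X (w j) ^+ 2) = (fun j => g (u (k j)) (w j) + (-1) * g ustar (w j)).
    by apply/funext => j; rewrite Xsq// (b_w glin)// mulN1r.
  by apply: cvg0_add => //; exact: cvg0_Ml.
have -> : (fun j => X (w j)) = (fun j => Num.sqrt (X (w j) ^+ 2)).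
  by apply/funext => j; rewrite sqrtr_sqr ger0_norm.
rewrite -sqrtr0; apply: (@continuous_cvg _ _ _ _ _ (fun j => X (w j) ^+ 2) Num.sqrt) => //.
exact: sqrt_continuous.
Qed.

Lemma stationary_limit h : H h -> dE ustar h = dE ustar ustar * l ustar h.
Proof.
have dEc h' : H h' -> (fun j => dE (u (k j)) h' - dE ustar h') @ \oo --> (0 : R).
  move=> hh; have Na : (fun j => N (u (k j)) h' - N ustar h') @ \oo --> (0 : R).
    apply: cvg0_le => e e0; have [d d0 hd] := N_cont (B + X ustar) hh e0.
    apply: filterS (cvg0_near L_cvg0 d0) => j hj; apply: hd => //.
      by apply: (le_trans (Xu _)); rewrite lerDl.
    by rewrite lerDr; apply: le_trans (X0 _) (Xu 0%N).
  have aa : (fun j => a (w j) h') @ \oo --> (0 : R).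
    apply: (cvg0_dom _ (cvg0_Ml (CA * X h') X_cvg0)) => j.
    by rewrite mulrAC; exact: a_bnd.
  have -> : (fun j => dE (u (k j)) h' - dE ustar h') =
      (fun j => a (w j) h' + be * (N (u (k j)) h' - N ustar h')).
    apply/funext => j; rewrite (b_w alin)// /dE.
    by move: (a _ _) (a _ _) (N _ _) (N _ _) => x1 x2 x3 x4; ring.
  by apply: cvg0_add => //; exact: cvg0_Ml.
have rc h' : H h' -> (fun j => mu (u (k j)) * l ustar h' - dE ustar h') @ \oo --> (0 : R).
  move=> hh.
  have -> : (fun j => mu (u (k j)) * l ustar h' - dE ustar h') =
      (fun j => (dE (u (k j)) h' - dE ustar h') + ((-1) * g (P (u (k j))) h' + (-1) * (mu (u (k j)) * l (w j) h'))).
    apply/funext => j; rewrite gP// (b_w llin)//.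
    by move: (dE _ _) (dE _ _) (mu _) (l _ _) (l _ _) => x1 x2 x3 x4 x5; ring.
  apply: cvg0_add; first exact: dEc.
  apply: cvg0_add; apply: cvg0_Ml.
    apply: (cvg0_dom _ (cvg0_Ml (X h') X_P_cvg0)) => j.
    by rewrite mulrC; exact: gcs (HP (Hu _)) hh.
  apply: (cvg0_dom (t := fun j => Mmu * `|l (w j) h'|)) => [j|].
    by rewrite normrM; apply: ler_wpM2r => //; exact: mu_bnd.
  by apply: cvg0_Ml; apply/norm_cvg0P; exact: l_w0.
move=> hh; apply/eqP; rewrite eq_sym -subr_eq0; apply/eqP.
(* The combination of the relations for [h] and for [ustar] in which [mu] cancels: it is constant in
   [j] and tends to 0. *)
apply: (cst_cvg0 (s := fun j => (mu (u (k j)) * l ustar h - dE ustar h) +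
   (- l ustar h) * (mu (u (k j)) * l ustar ustar - dE ustar ustar))) => [j|].
  rewrite -(Lsq hs) L_ustar expr1n.
  by move: (dE _ _) (dE _ _) (mu _) (l _ _) => x1 x2 x3 x4; ring.
by apply: cvg0_add; [exact: rc|apply: cvg0_Ml; exact: rc].
Qed.

End scheme.

Theorem descent n0 : exists Ca, 0 < Ca <= 1 /\
  forall (u : nat -> T) (alpha : nat -> R) amin, H (u 0%N) -> L (u 0%N) = 1 -> X (u 0%N) = n0 ->
    0 < amin -> (forall k, amin <= alpha k) -> (forall k, alpha k <= Ca) ->
    (forall k, u k.+1 = next (alpha k) (u k)) ->
  (forall k, H (u k)) /\
  forall (k : nat -> nat) ustar, k @ \oo --> \oo -> H ustar ->
    (forall h, H h -> (fun j => g h (u (k j))) @ \oo --> g h ustar) ->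
  [/\ L ustar = 1, exists lambda, forall h, H h -> dE ustar h = lambda * l ustar h &
    (fun j => X (lin (-1) (u (k j)) ustar)) @ \oo --> (0 : R)].
Proof.
exists (step_bound n0); split; first by rewrite step_bound_gt0 step_bound_le1.
move=> u alpha amin u0 Lu0 Xu0 amin0 al1 al2 uS; split.
  by move=> k; have [] := scheme_inv u0 Lu0 Xu0 amin0 al1 al2 uS k.
move=> k ustar kc hs weak; split.
- exact: (L_ustar u0 Lu0 Xu0 amin0 al1 al2 uS hs weak).
- exists (dE ustar ustar) => h hh.
  exact: (stationary_limit u0 Lu0 Xu0 amin0 al1 al2 uS kc hs weak hh).
exact: (X_cvg0 u0 Lu0 Xu0 amin0 al1 al2 uS kc hs weak).
Qed.

End descent.

(** * The quartic and quadratic parts of the energy *)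

Section quartic_form.
Context (R : realType) (m : nat) (D : set 'rV[R]_m.+2).
Hypotheses (oD : open D) (bD : bounded_set D).
Let mD := mD oD.
Implicit Types u v w p h : 'rV[R]_m.+2 -> R[i].
Local Notation lin := (@lin R m.+2).
Local Notation nL := (L2norm D).
Local Notation nX := (H01norm D).
Variables (M : R) (M0 : 0 <= M) (DM : D `<=` cube m.+2 M).
Hypothesis hm : m.+2 = 2%N \/ m.+2 = 3%N.

Definition dots u v : 'rV[R]_m.+2 -> R := fun x => dot (u x) (v x).
(** The 4-linear form with diagonal the integral of |u|^4; [T4 u u u v] is the real part of the L^2
    product of |u|^2 u and v. *)
Definition T4 u v w p : R := ipr D (dots u v) (dots w p).
(** The square of the L^4 norm. *)
Definition r4 u : R := Num.sqrt (T4 u u u u).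

Lemma dots_sqmod_sq u : H01 D u -> sq D (dots u u).
Proof.
move=> hu; have [C C0 /(_ u hu) hC] := H01_l4 oD bD M0 DM hm.
have /(L2P oD)[[m1 _] [m2 _]] := H1_L2 (H01_H1 hu).
have ms : measurable_fun D (dots u u).
  by rewrite /dots /dot; apply: measurable_funD; apply: measurable_funM.
split=> //; apply/integrableP; split.
  by apply/measurable_EFinP; apply: measurable_funX.
have e : (\int[leb]_(x in D) `|((EFin \o (fun x => dots u u x ^+ 2)%R) x)| =
    \int[leb]_(x in D) (sqmod (u x) ^+ 2)%:E)%E.
  by apply: eq_integral => x _; rewrite /= ger0_norm ?sqr_ge0// /dots dot_sqmod.
by rewrite e; apply: (le_lt_trans hC); rewrite ltry.
Qed.

Lemma sqr_dots_le u v x : dots u v x ^+ 2 <= dots u u x * dots v v x.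
Proof.
rewrite /dots /dot; move: (Re (u x)) (Im (u x)) (Re (v x)) (Im (v x)) => a b c d.
by have := sqr_ge0 (a * d - b * c); lra.
Qed.

Lemma dots_ge0 u x : 0 <= dots u u x.
Proof. by rewrite /dots dot_sqmod sqmod_ge0. Qed.

Lemma dots_sq u v : H01 D u -> H01 D v -> sq D (dots u v).
Proof.
move=> hu hv.
have /(L2P oD)[[m1 _] [m2 _]] := H1_L2 (H01_H1 hu).
have /(L2P oD)[[m3 _] [m4 _]] := H1_L2 (H01_H1 hv).
apply: (sq_ae_le oD _ (sqD oD (dots_sqmod_sq hu) (dots_sqmod_sq hv))).
  by rewrite /dots /dot; apply: measurable_funD; apply: measurable_funM.
apply: aeW => x Dx; have hs := sqr_dots_le u v x; have u0 := dots_ge0 u x; have v0 := dots_ge0 v x.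
rewrite -(@ler_pXn2r _ 2)// ?nnegrE// !real_normK ?num_real//; apply: (le_trans hs).
by move: u0 v0; move: (dots u u x) (dots v v x) => s t s0 t0; nra.
Qed.

Lemma dotsC u v : dots u v = dots v u.
Proof. by apply/funext => x; rewrite /dots dotC. Qed.

Lemma dots_lin c u v w : dots (lin c u v) w = linr c (dots u w) (dots v w).
Proof. by apply/funext => x; rewrite /dots /linr /dot Re_lin Im_lin; ring. Qed.

Lemma T4C u v w p : T4 u v w p = T4 w p u v.
Proof. exact: iprC. Qed.

Lemma T4_lin c u v w p h : H01 D u -> H01 D v -> H01 D w -> H01 D p -> H01 D h ->
  T4 (lin c u v) w p h = T4 u w p h + c * T4 v w p h.
Proof.
by move=> hu hv hw hp hh; rewrite /T4 dots_lin (ipr_linr oD)//; exact: dots_sq.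
Qed.

Lemma r4_ge0 u : 0 <= r4 u. Proof. exact: sqrtr_ge0. Qed.

Lemma r4_sqr u : r4 u ^+ 2 = T4 u u u u.
Proof. by rewrite sqr_sqrtr// ipr_ge0. Qed.

Lemma T4_uuvv u v : H01 D u -> H01 D v -> `|T4 u u v v| <= r4 u * r4 v.
Proof. by move=> hu hv; apply: (ipr_cs oD); exact: dots_sq. Qed.

Lemma ipr_dots_le u v : H01 D u -> H01 D v -> ipr D (dots u v) (dots u v) <= T4 u u v v.
Proof.
move=> hu hv; apply: Rint_ae_le => //; [by apply: sqM => //; exact: dots_sq..|].
by apply: aeW => x _; rewrite -expr2; exact: sqr_dots_le.
Qed.

(** Hoelder's inequality with four exponents 4, as Cauchy-Schwarz twice: once for the outer product,
    once for each [dots] pointwise and in the integral. *)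
Lemma T4_bound u v w p : H01 D u -> H01 D v -> H01 D w -> H01 D p ->
  `|T4 u v w p| <= Num.sqrt ((r4 u * r4 v) * (r4 w * r4 p)).
Proof.
move=> hu hv hw hp; apply: (le_trans (ipr_cs oD (dots_sq hu hv) (dots_sq hw hp))).
have h a b : H01 D a -> H01 D b -> Num.sqrt (ipr D (dots a b) (dots a b)) <= Num.sqrt (r4 a * r4 b).
  move=> ha hb; apply: ler_wsqrtr; apply: (le_trans (ipr_dots_le ha hb)).
  exact: le_trans (ler_norm _) (T4_uuvv ha hb).
rewrite sqrtrM; last by rewrite mulr_ge0 ?r4_ge0.
by apply: ler_pM; rewrite ?sqrtr_ge0//; apply: h.
Qed.

(** The first bound keeps a factor of the L^2 norm, the source of compactness; the second trades it
    for a gradient norm by Poincare. *)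
Lemma r4_bound : exists2 C, 0 <= C & forall u, H01 D u ->
  r4 u ^+ 2 <= C * nL u * nX u ^+ 3 /\ r4 u <= Num.sqrt (C * (4 * M)) * nX u ^+ 2.
Proof.
have [C C0 hC] := H01_l4 oD bD M0 DM hm; exists C => // u hu.
have h : r4 u ^+ 2 <= C * nL u * nX u ^+ 3.
  rewrite r4_sqr -lee_fin -(ipr_EFin oD (dots_sq hu hu)); apply: le_trans (hC u hu).
  rewrite le_eqVlt; apply/orP; left; apply/eqP.
  by apply: eq_integral => x _; rewrite /dots dot_sqmod.
split=> //; rewrite -(@ler_pXn2r _ 2)// ?nnegrE ?r4_ge0 ?mulr_ge0 ?sqrtr_ge0 ?sqr_ge0//.
apply: (le_trans h); rewrite exprMn sqr_sqrtr ?mulr_ge0// -exprM.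
have := poincare oD bD M0 DM hu => hp.
have -> : C * (4 * M) * nX u ^+ (2 * 2) = C * (4 * M * nX u) * nX u ^+ 3.
  by move: (nX u) => z; ring.
by apply: ler_wpM2r; [rewrite exprn_ge0 ?H01norm_ge0|exact: ler_wpM2l].
Qed.

End quartic_form.

Section arithmetic.
Context (R : realType).
Variables (k X Y r s : R).
Hypotheses (k0 : 0 <= k) (X0 : 0 <= X) (Y0 : 0 <= Y) (r0 : 0 <= r) (s0 : 0 <= s).
Hypotheses (hr : r <= k * X ^+ 2) (hs : s <= k * Y ^+ 2).

Lemma quartic_prod_le : r * s <= k ^+ 2 * X ^+ 2 * Y ^+ 2.
Proof.
have -> : k ^+ 2 * X ^+ 2 * Y ^+ 2 = (k * X ^+ 2) * (k * Y ^+ 2) by ring.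
exact: ler_pM.
Qed.

Lemma quartic_sqrt_le : Num.sqrt (r * r * (r * s)) <= k ^+ 2 * X ^+ 3 * Y.
Proof.
rewrite -[leRHS]ger0_norm; last by rewrite !mulr_ge0 ?exprn_ge0.
rewrite -sqrtr_sqr; apply: ler_wsqrtr.
have -> : (k ^+ 2 * X ^+ 3 * Y) ^+ 2 = (k * X ^+ 2) * (k * X ^+ 2) * ((k * X ^+ 2) * (k * Y ^+ 2)) by ring.
by apply: ler_pM; rewrite ?mulr_ge0//; apply: ler_pM.
Qed.

Lemma quartic_sqr_le : r ^+ 2 <= k ^+ 2 * (X ^+ 2) ^+ 2.
Proof.
have -> : k ^+ 2 * (X ^+ 2) ^+ 2 = (k * X ^+ 2) ^+ 2 by ring.
by rewrite lerXn2r ?nnegrE// mulr_ge0// exprn_ge0.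
Qed.

End arithmetic.

Lemma quartic_small_le (R : realType) (B e a b c d : R) : 0 <= B -> 0 <= e ->
  0 <= a -> 0 <= b -> 0 <= c -> 0 <= d -> a <= B -> b <= B -> c <= B -> d <= e ->
  a * b * (c * d) <= B ^+ 3 * e.
Proof.
move=> *; have -> : B ^+ 3 * e = B * B * (B * e) by ring.
by apply: ler_pM; rewrite ?mulr_ge0//; apply: ler_pM.
Qed.

Lemma le_twice_bound (R : realType) (B x z : R) : 0 <= B -> 0 <= z -> x <= B -> x <= 2 * `|B| + z.
Proof. by move=> B0 z0 h; rewrite ger0_norm//; lra. Qed.

Lemma add_le_twice_bound (R : realType) (B x y z : R) : 0 <= B -> 0 <= z -> x <= B -> y <= B ->
  x + y <= 2 * `|B| + z.
Proof. by move=> B0 z0 h1 h2; rewrite ger0_norm//; lra. Qed.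

(** * Estimates for the quartic form *)

Section quartic_estimates.
Context (R : realType) (m : nat) (D : set 'rV[R]_m.+2).
Hypotheses (oD : open D) (bD : bounded_set D).
Let mD := mD oD.
Implicit Types u v w p h : 'rV[R]_m.+2 -> R[i].
Local Notation lin := (@lin R m.+2).
Local Notation nL := (L2norm D).
Local Notation nX := (H01norm D).
Local Notation T4 := (T4 D).
Local Notation r4 := (r4 D).
Variables (M : R) (M0 : 0 <= M) (DM : D `<=` cube m.+2 M).
Hypothesis hm : m.+2 = 2%N \/ m.+2 = 3%N.
Let dsq := dots_sq oD bD M0 DM hm.
Let Tlin := T4_lin oD bD M0 DM hm.
Let Tbound := T4_bound oD bD M0 DM hm.

Lemma T4_lin4 c u v w p h : H01 D u -> H01 D v -> H01 D w -> H01 D p -> H01 D h ->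
  T4 w p h (lin c u v) = T4 w p h u + c * T4 w p h v.
Proof.
move=> hu hv hw hp hh; rewrite T4C /T4 (dotsC h) -/(T4 _ _ _ _) Tlin//.
by rewrite /T4 (dotsC _ h) (dotsC _ h) (iprC D) [X in _ + c * X](iprC D).
Qed.

Lemma T4_scale c u : H01 D u -> T4 (lin (c - 1) u u) (lin (c - 1) u u) (lin (c - 1) u u) (lin (c - 1) u u) =
  c ^+ 4 * T4 u u u u.
Proof.
move=> hu; have -> : T4 (lin (c - 1) u u) (lin (c - 1) u u) (lin (c - 1) u u) (lin (c - 1) u u) =
    ipr D (linr (c ^+ 2 - 1) (dots u u) (dots u u)) (linr (c ^+ 2 - 1) (dots u u) (dots u u)).
  have e : dots (lin (c - 1) u u) (lin (c - 1) u u) = linr (c ^+ 2 - 1) (dots u u) (dots u u).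
    by apply/funext => x; rewrite /dots /dot /linr !Re_lin !Im_lin; ring.
  by rewrite -e.
have s1 := dsq hu hu; have s2 := sq_linr oD (c ^+ 2 - 1) s1 s1.
rewrite (ipr_linr oD _ s1 s1 s2) (iprC D (dots u u)) (ipr_linr oD _ s1 s1 s1).
by rewrite /T4; move: (ipr _ _ _) => z; ring.
Qed.

Lemma quartic_step t u p : H01 D u -> H01 D p ->
  T4 (lin (- t) u p) (lin (- t) u p) (lin (- t) u p) (lin (- t) u p) <=
  T4 u u u u - 4 * t * T4 u u u p + 8 * t ^+ 2 * T4 u u p p + 3 * t ^+ 4 * T4 p p p p.
Proof.
move=> hu hp; have hl := H01_lin oD bD (- t) hu hp.
pose F x := (dots u u x * dots u u x + (- (4 * t)) * (dots u u x * dots u p x)) +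
  (8 * t ^+ 2 * (dots u u x * dots p p x) + 3 * t ^+ 4 * (dots p p x * dots p p x)).
have i1 := sqM oD (dsq hu hu) (dsq hu hu).
have i2 := sqM oD (dsq hu hu) (dsq hu hp).
have i3 := sqM oD (dsq hu hu) (dsq hp hp).
have i4 := sqM oD (dsq hp hp) (dsq hp hp).
have j2 := igZ oD (- (4 * t)) i2; have j3 := igZ oD (8 * t ^+ 2) i3; have j4 := igZ oD (3 * t ^+ 4) i4.
have iF : ig D F := igD oD (igD oD i1 j2) (igD oD j3 j4).
have -> : T4 u u u u - 4 * t * T4 u u u p + 8 * t ^+ 2 * T4 u u p p + 3 * t ^+ 4 * T4 p p p p =
  \int[leb]_(x in D) F x.
  rewrite /F (RintegralD mD (igD oD i1 j2) (igD oD j3 j4)) (RintegralD mD i1 j2) (RintegralD mD j3 j4).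
  rewrite (RintegralZl _ mD i2) (RintegralZl _ mD i3) (RintegralZl _ mD i4) mulNr addrA.
  by [].
apply: Rint_ae_le => //; first exact: (sqM oD (dsq hl hl) (dsq hl hl)).
apply: aeW => x _; rewrite /F.
have h := sqr_dots_le u p x; have u0 := dots_ge0 u x; have p0 := dots_ge0 p x.
have -> : dots (lin (- t) u p) (lin (- t) u p) x = dots u u x - 2 * t * dots u p x + t ^+ 2 * dots p p x.
  by rewrite /dots /dot !Re_lin !Im_lin; ring.
move: h u0 p0; move: (dots u u x) (dots p p x) (dots u p x) => s z d h s0 z0.
(* Writing s = |u|^2, z = |p|^2 and d = Re(conj(u) p), the cubic term - 4 t^3 d z is absorbed in the
   square - 2 (t d + t^2 z)^2, after which d^2 <= s z leaves 8 t^2 s z + 3 t^4 z^2. *)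
have t2 := sqr_ge0 t.
have h1 := ler_wpM2l t2 h.
have h2 := sqr_ge0 (t * d + t ^+ 2 * z).
have -> : (s - 2 * t * d + t ^+ 2 * z) * (s - 2 * t * d + t ^+ 2 * z) =
  s * s + - (4 * t) * (s * d) + 6 * (t ^+ 2 * d ^+ 2) + 2 * (t ^+ 2 * (s * z)) + 3 * (t ^+ 4 * (z * z)) -
  2 * (t * d + t ^+ 2 * z) ^+ 2 by ring.
by lra.
Qed.

Lemma quartic_bounds : exists2 K, 0 <= K & forall u v, H01 D u -> H01 D v ->
  [/\ `|T4 u u u v| <= K * nX u ^+ 3 * nX v, `|T4 u u v v| <= K * nX u ^+ 2 * nX v ^+ 2 &
    T4 u u u u <= K * (nX u ^+ 2) ^+ 2].
Proof.
have [C C0 hC] := r4_bound oD bD M0 DM hm.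
have K0 : 0 <= C * (4 * M) by rewrite !mulr_ge0.
exists (C * (4 * M)); first exact: K0.
move=> u v hu hv; set k := Num.sqrt _ in hC.
have k0 : 0 <= k := sqrtr_ge0 _.
have kk : k ^+ 2 = C * (4 * M) by rewrite sqr_sqrtr.
have X0 w : 0 <= nX w := H01norm_ge0 D w.
have [_ ru] := hC u hu; have [_ rv] := hC v hv.
rewrite -kk; split.
- apply: (le_trans (Tbound hu hu hu hv)).
  exact: (quartic_sqrt_le k0 (X0 u) (X0 v) (r4_ge0 D u) (r4_ge0 D v) ru rv).
- apply: (le_trans (T4_uuvv oD bD M0 DM hm hu hv)).
  exact: (quartic_prod_le (r4_ge0 D u) (r4_ge0 D v) ru rv).
rewrite -r4_sqr; exact: (quartic_sqr_le k0 (X0 u) (r4_ge0 D u) ru).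
Qed.

(** On bounded sets of H_0^1 the L^4 norm tends to 0 with the L^2 norm, and one small factor makes
    the whole form small. *)
Lemma T4_small B e : 0 < e -> exists2 d, 0 < d & forall u v w p,
  H01 D u -> H01 D v -> H01 D w -> H01 D p ->
  nX u <= B -> nX v <= B -> nX w <= B -> nX p <= B -> nL p <= d -> `|T4 u v w p| <= e.
Proof.
move=> e0; have [C C0 hC] := r4_bound oD bD M0 DM hm.
set k := Num.sqrt _ in hC; have k0 : 0 <= k := sqrtr_ge0 _.
have X0 w : 0 <= nX w := H01norm_ge0 D w.
pose Rb := k * B ^+ 2; have Rb0 : 0 <= Rb by rewrite mulr_ge0// sqr_ge0.
(* In [T4_bound] three factors are at most [Rb] and the last at most [eta]; their product has to
   stay below [e^2]. *)
pose eta := e ^+ 2 / (Rb ^+ 3 + 1).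
have R1 : 0 < Rb ^+ 3 + 1 by rewrite ltr_wpDl// exprn_ge0.
have eta0 : 0 < eta by rewrite divr_gt0// exprn_gt0.
have etaP : Rb ^+ 3 * eta <= e ^+ 2.
  rewrite /eta mulrCA ler_piMr ?sqr_ge0// ler_pdivrMr// mul1r.
  by rewrite lerDl.
have B1 : 0 < C * `|B| ^+ 3 + 1 by rewrite ltr_wpDl// mulr_ge0// exprn_ge0.
(* This forces [r4 p] below [eta] through the first part of [r4_bound]. The absolute value keeps it
   positive when [B] is negative, a case in which no function satisfies the bounds. *)
exists (eta ^+ 2 / (C * `|B| ^+ 3 + 1)); first by rewrite divr_gt0// exprn_gt0.
move=> u v w p hu hv hw hp uB vB wB pB pd.
have B0 : 0 <= B := le_trans (X0 u) uB.
have rR z : H01 D z -> nX z <= B -> r4 z <= Rb.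
  move=> hz zB; have [_ h] := hC z hz; apply: (le_trans h); apply: ler_wpM2l => //.
  by rewrite lerXn2r ?nnegrE.
have rp : r4 p <= eta.
  rewrite -(@ler_pXn2r _ 2)// ?nnegrE ?r4_ge0 ?(ltW eta0)//.
  have [h _] := hC p hp; apply: (le_trans h).
  rewrite ler_pdivlMr// in pd; apply: le_trans pd.
  have pB3 : C * nX p ^+ 3 <= C * `|B| ^+ 3 + 1.
    rewrite ger0_norm//; apply: (@le_trans _ _ (C * B ^+ 3)); last by rewrite lerDl.
    by apply: ler_wpM2l => //; rewrite lerXn2r ?nnegrE.
  by rewrite mulrAC mulrC; apply: ler_wpM2l => //; exact: L2norm_ge0.
apply: (le_trans (Tbound hu hv hw hp)).
rewrite -[leRHS]ger0_norm ?(ltW e0)// -sqrtr_sqr; apply: ler_wsqrtr; apply: le_trans etaP.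
exact: (quartic_small_le Rb0 (ltW eta0) (r4_ge0 D u) (r4_ge0 D v) (r4_ge0 D w) (r4_ge0 D p)
  (rR u hu uB) (rR v hv vB) (rR w hw wB) rp).
Qed.

Lemma T4_cont B h e : H01 D h -> 0 < e -> exists2 d, 0 < d & forall u v, H01 D u -> H01 D v ->
  nX u <= B -> nX v <= B -> nL (lin (-1) u v) <= d -> `|T4 u u u h - T4 v v v h| <= e.
Proof.
move=> hh e0; have X0 w : 0 <= nX w := H01norm_ge0 D w.
have [d d0 hd] := T4_small (2 * `|B| + nX h) (divr_gt0 e0 (ltr0Sn R 2)).
exists d; first exact: d0.
move=> u v hu hv uB vB wd; have hw := H01_lin oD bD (-1) hu hv.
set w := lin (-1) u v in wd hw.
have B0 : 0 <= B := le_trans (X0 u) uB.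
have hB : nX h <= 2 * `|B| + nX h by rewrite lerDr mulr_ge0.
have bB x : x <= B -> x <= 2 * `|B| + nX h.
  exact: (le_twice_bound B0 (X0 h)).
have wB : nX w <= 2 * `|B| + nX h.
  apply: (le_trans (H01norm_lin oD bD (-1) (H01_H1 hu) (H01_H1 hv))).
  rewrite normrN1 mul1r; exact: (add_le_twice_bound B0 (X0 h) uB vB).
have i1 := sqM oD (dsq hu hu) (dsq hh hw).
have i2 := sqM oD (dsq hv hh) (dsq hu hw).
have i3 := sqM oD (dsq hv hh) (dsq hv hw).
(* With w = u - v: (u,u)(u,h) - (v,v)(v,h) = (u,u)(w,h) + ((u,w) + (v,w))(v,h), each term having [w]
   in the last slot after reordering. *)
have -> : T4 u u u h - T4 v v v h = T4 u u h w + (T4 v h u w + T4 v h v w).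
  rewrite /T4 -(RintegralB mD (sqM oD (dsq hu hu) (dsq hu hh)) (sqM oD (dsq hv hv) (dsq hv hh))).
  rewrite -(RintegralD mD i2 i3) -(RintegralD mD i1 (igD oD i2 i3)).
  by apply: eq_Rintegral => x _; rewrite /dots /dot /w !Re_lin !Im_lin; ring.
have -> : e = e / 3 + (e / 3 + e / 3) by field.
have e1 := hd u u h w hu hu hh hw (bB _ uB) (bB _ uB) hB wB wd.
have e2 := hd v h u w hv hh hu hw (bB _ vB) hB (bB _ uB) wB wd.
have e3 := hd v h v w hv hh hv hw (bB _ vB) hB (bB _ vB) wB wd.
exact: (le_trans (ler_normD _ _) (lerD e1 (le_trans (ler_normD _ _) (lerD e2 e3)))).
Qed.

End quartic_estimates.

Section arithmetic.
Context (R : realType).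

(* (by - (c/2) W x p)^2 + (bx + (c/2) W y p)^2 + (ay + (c/2) W x q)^2 + (ax - (c/2) W y q)^2 >= 0 *)
Lemma rotation_dominated (c W x y ax bx ay by_ p q V : R) : 0 < c ->
  c / 4 * W ^+ 2 * (x ^+ 2 + y ^+ 2) <= V ->
  0 <= c^-1 * ((ax * ax + bx * bx) + (ay * ay + by_ * by_)) + (V * p * p + V * q * q) +
    - W * ((x * by_ - y * bx) * p + - (x * ay - y * ax) * q).
Proof.
move=> c0 hV; have pq : 0 <= p ^+ 2 + q ^+ 2 by rewrite addr_ge0 ?sqr_ge0.
have h := ler_wpM2r pq hV.
pose S := (by_ - c / 2 * W * x * p) ^+ 2 + (bx + c / 2 * W * y * p) ^+ 2 +
  (ay + c / 2 * W * x * q) ^+ 2 + (ax - c / 2 * W * y * q) ^+ 2.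
have S0 : 0 <= c^-1 * S by rewrite mulr_ge0 ?invr_ge0 ?(ltW c0)// !addr_ge0 ?sqr_ge0.
have e : c^-1 * S = c^-1 * ((ax * ax + bx * bx) + (ay * ay + by_ * by_)) +
   (c / 4 * W ^+ 2 * (x ^+ 2 + y ^+ 2)) * (p ^+ 2 + q ^+ 2) +
   - W * ((x * by_ - y * bx) * p + - (x * ay - y * ax) * q).
  by rewrite /S; field; rewrite gt_eqF.
rewrite e in S0; apply: (le_trans S0); rewrite lerD2r lerD2l; apply: (le_trans h).
by rewrite le_eqVlt; apply/orP; left; apply/eqP; ring.
Qed.

Lemma form_bound (x y z v w W Vb M X N : R) : 0 <= W -> `|v| <= Vb * (4 * M * X) * N ->
  `|w| <= 2 * M * X * N -> `|(x + v + - W * w) - x| <= (Vb * (4 * M) + W * (2 * M)) * X * N.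
Proof.
move=> W0 hv hw; have -> : (x + v + - W * w) - x = v + - (W * w) by ring.
apply: (le_trans (ler_normD _ _)); rewrite normrN normrM (ger0_norm W0).
apply: (le_trans (lerD hv (ler_wpM2l W0 hw))).
by rewrite le_eqVlt; apply/orP; left; apply/eqP; ring.
Qed.

End arithmetic.

(** * The quadratic form of the energy *)

Section energy_form.
Context (R : realType) (m : nat) (D : set 'rV[R]_m.+2).
Hypotheses (oD : open D) (bD : bounded_set D).
Let mD := mD oD.
Implicit Types u v w p h : 'rV[R]_m.+2 -> R[i].
Local Notation lin := (@lin R m.+2).
Local Notation nL := (L2norm D).
Local Notation nX := (H01norm D).
Variables (M : R) (M0 : 0 <= M) (DM : D `<=` cube m.+2 M).
Hypothesis hm : m.+2 = 2%N \/ m.+2 = 3%N.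
Variables (V : 'rV[R]_m.+2 -> R) (Vb Omega : R).
Hypotheses (mV : measurable_fun D V) (Vb0 : 0 <= Vb)
  (VVb : {ae leb, forall x, D x -> `|V x| <= Vb}) (Omega0 : 0 <= Omega).

Definition eform u v : R :=
  gradip D u v + dotL D (mulR V u) v + - Omega * dotL D (Lz D u) v.

Lemma eformC u v : H01 D u -> H01 D v -> eform u v = eform v u.
Proof.
move=> hu hv; rewrite /eform (gradipC D u v) (dotL_mulRC D V u v).
by rewrite (lip_sym oD bD M0 DM hu hv).
Qed.

Lemma eform_lin c u v w : H01 D u -> H01 D v -> H01 D w ->
  eform (lin c u v) w = eform u w + c * eform v w.
Proof.
move=> /H01_H1 hu /H01_H1 hv /H01_H1 hw; have lu := H1_L2 hu; have lv := H1_L2 hv; have lw := H1_L2 hw.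
rewrite /eform (gradip_lin oD bD c hu hv hw) mulR_lin.
rewrite (dotL_lin oD c (L2_mulR oD mV VVb lu) (L2_mulR oD mV VVb lv) lw).
rewrite (lip_lin oD bD DM c hu hv lw).
move: (gradip _ _ _) (gradip _ _ _) (dotL _ _ _) (dotL _ _ _) (dotL _ _ _) (dotL _ _ _) => x1 x2 x3 x4 x5 x6.
by ring.
Qed.

Lemma eform_low u w : H01 D u -> H01 D w ->
  `|eform u w - gradip D u w| <= (Vb * (4 * M) + Omega * (2 * M)) * nX u * nL w.
Proof.
move=> hu /H01_H1/H1_L2 lw; have h1 := H01_H1 hu; have lu := H1_L2 h1.
apply: form_bound => //; last exact: (lip_bound oD M0 DM h1 lw).
apply: (le_trans (dotL_cs oD (L2_mulR oD mV VVb lu) lw)).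
apply: ler_wpM2r; first exact: L2norm_ge0.
apply: (le_trans (L2norm_mulR oD Vb0 mV VVb lu)); apply: ler_wpM2l => //.
exact: (poincare oD bD M0 DM).
Qed.

Lemma eform_bound u v : H01 D u -> H01 D v ->
  `|eform u v| <= (1 + (Vb * (4 * M) + Omega * (2 * M)) * (4 * M)) * nX u * nX v.
Proof.
move=> hu hv; have h1 := gradip_cs oD bD (H01_H1 hu) (H01_H1 hv).
have C0 : 0 <= Vb * (4 * M) + Omega * (2 * M) by rewrite addr_ge0// !mulr_ge0.
have h2 := eform_low hu hv.
have h3 : (Vb * (4 * M) + Omega * (2 * M)) * nX u * nL v <=
    (Vb * (4 * M) + Omega * (2 * M)) * nX u * (4 * M * nX v).
  apply: ler_wpM2l; first by rewrite mulr_ge0// H01norm_ge0.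
  exact: (poincare oD bD M0 DM).
have -> : eform u v = gradip D u v + (eform u v - gradip D u v) by rewrite addrC subrK.
apply: (le_trans (ler_normD _ _)); apply: (le_trans (lerD h1 (le_trans h2 h3))).
move: (nX u) (nX v) => a b.
by rewrite le_eqVlt; apply/orP; left; apply/eqP; ring.
Qed.

Let ix : 'I_m.+2 := @Ordinal m.+2 0 isT.
Let iy : 'I_m.+2 := @Ordinal m.+2 1 isT.

(** The pointwise inequality [rotation_dominated] with [c = 1 + K] involves only the two derivatives
    in the plane of rotation; the full gradient dominates these. *)
Lemma eform_coercive K u : 0 < K -> trap_dominates_rotation D V Omega K -> H01 D u ->
  (1 - (1 + K)^-1) * gradip D u u <= eform u u.
Proof.
move=> K0 hK /H01_H1 hu; have lu := H1_L2 hu; have c0 : 0 < 1 + K by rewrite ltr_wpDl.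
have i0 : 0 <= (1 + K)^-1 by rewrite invr_ge0 ltW.
have lx := wgrad_L2 ix hu; have ly := wgrad_L2 iy hu.
have hg : dotL D (wgrad D u ix) (wgrad D u ix) + dotL D (wgrad D u iy) (wgrad D u iy) <= gradip D u u.
  rewrite /gradip (bigD1 ix)//= lerD2l (bigD1 iy)//= lerDl.
  by apply: sumr_ge0 => j _; exact: dotL_ge0.
suff h : 0 <= (1 + K)^-1 * (dotL D (wgrad D u ix) (wgrad D u ix) + dotL D (wgrad D u iy) (wgrad D u iy)) +
    dotL D (mulR V u) u + - Omega * dotL D (Lz D u) u.
  have h2 := ler_wpM2l i0 hg; rewrite /eform mulrBl mul1r.
  move: h h2; move: (gradip _ _ _) (dotL _ _ _) (dotL _ _ _) (_^-1 * _) (_^-1 * _) => *; lra.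
have j1 := ig_dot oD lx lx; have j2 := ig_dot oD ly ly.
have j3 := ig_dot oD (L2_mulR oD mV VVb lu) lu; have j4 := ig_dot oD (Lz_L2 oD DM hu) lu.
rewrite -(RintegralD mD j1 j2) -(RintegralZl _ mD (igD oD j1 j2)) -(RintegralZl _ mD j4).
have k1 := igZ oD (1 + K)^-1 (igD oD j1 j2); have k2 := igZ oD (- Omega) j4.
rewrite -(RintegralD mD k1 j3) -(RintegralD mD (igD oD k1 j3) k2).
apply: (Rint_ae_ge0 oD); first exact: (ig_meas (igD oD (igD oD k1 j3) k2)).
apply: filterS hK => x hx Dx; rewrite /dot Re_mulR Im_mulR Re_Lz Im_Lz /rot.
exact: (rotation_dominated _ _ _ _ _ _ c0 (hx Dx)).
Qed.

Lemma denergyE beta u v : H01 D u -> H01 D v ->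
  denergy D V beta Omega u v = eform u v + beta * T4 D u u u v.
Proof.
move=> hu hv; have h1 := H01_H1 hu; have lu := H1_L2 h1; have lv := H1_L2 (H01_H1 hv).
have dsq := dots_sq oD bD M0 DM hm.
rewrite /denergy Re_H01ip Re_L2ip /eform -!addrA; congr (_ + _).
have j3 := ig_dot oD (L2_mulR oD mV VVb lu) lv; have j4 := ig_dot oD (Lz_L2 oD DM h1) lv.
have j5 := sqM oD (dsq _ _ hu hu) (dsq _ _ hu hv).
have k4 := igZ oD (- Omega) j4; have k5 := igZ oD beta j5.
rewrite /T4 -(RintegralZl _ mD j4) -(RintegralZl _ mD j5).
rewrite -(RintegralD mD k4 k5) -(RintegralD mD j3 (igD oD k4 k5)).
apply: eq_Rintegral => x _; rewrite /dots /dot Re_mulR Im_mulR !partsE /= /sqmod.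
ring.
Qed.

End energy_form.

(** * Projected Sobolev gradient descent *)

Lemma subst2 (A B : Type) (P : A -> B -> Prop) a a' b b' : a = a' -> b = b' -> P a' b' -> P a b.
Proof. by move=> -> ->. Qed.

Lemma eq_le (R : realType) (x y : R) : x = y -> x <= y. Proof. by move=> ->. Qed.

Lemma quartic_step_le (R : realType) (s t p K a b y z : R) : 0 <= s -> 0 <= t ->
  y <= K * a * b -> z <= K * b ^+ 2 -> p + s * y + t * z <= p + s * K * a * b + t * K * b ^+ 2.
Proof.
move=> s0 t0 hy hz; have := ler_wpM2l s0 hy; have := ler_wpM2l t0 hz.
by rewrite !mulrA; lra.
Qed.

Section gross_pitaevskii.
Context (R : realType) (m : nat) (D : set 'rV[R]_m.+2).
Hypotheses (oD : open D) (bD : bounded_set D).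
Implicit Types u v w p h : 'rV[R]_m.+2 -> R[i].
Local Notation lin := (@lin R m.+2).
Local Notation nL := (L2norm D).
Local Notation nX := (H01norm D).
Variables (M : R) (M0 : 0 <= M) (DM : D `<=` cube m.+2 M).
Hypothesis hm : m.+2 = 2%N \/ m.+2 = 3%N.
Variables (V : 'rV[R]_m.+2 -> R) (Vb beta Omega : R).
Hypotheses (mV : measurable_fun D V) (Vb0 : 0 <= Vb)
  (VVb : {ae leb, forall x, D x -> `|V x| <= Vb}) (beta0 : 0 <= beta) (Omega0 : 0 <= Omega).
Local Notation eform := (eform D V Omega).

(** The derivative of the energy is a bounded real-linear functional on H_0^1; its Riesz
    representative witnesses that the choice in [sobolev_grad] is not the default value. *)
Lemma sobolev_grad_spec u : H01 D u -> H01 D (sobolev_grad D V beta Omega u) /\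
  forall h, H01 D h -> gradip D (sobolev_grad D V beta Omega u) h =
    eform u h + beta * T4 D u u u h.
Proof.
move=> hu; have [K K0 hK] := quartic_bounds oD bD M0 DM hm.
pose F h := eform u h + beta * T4 D u u u h.
pose CA := 1 + (Vb * (4 * M) + Omega * (2 * M)) * (4 * M).
have Fl c v w : H01 D v -> H01 D w -> F (lin c v w) = F v + c * F w.
  move=> hv hw; rewrite /F (T4_lin4 oD bD M0 DM hm c hv hw hu hu hu).
  rewrite (eformC oD bD M0 DM V Omega hu (H01_lin oD bD c hv hw)) (eform_lin oD bD DM Omega mV VVb c hv hw hu).
  rewrite (eformC oD bD M0 DM V Omega hv hu) (eformC oD bD M0 DM V Omega hw hu).
  by move: (eform _ _) (eform _ _) (T4 _ _ _ _ _) (T4 _ _ _ _ _) => x1 x2 x3 x4; ring.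
have Fb h : H01 D h -> `|F h| <= (CA * nX u + beta * (K * nX u ^+ 3)) * nX h.
  move=> hh; apply: (le_trans (ler_normD _ _)); rewrite mulrDl; apply: lerD.
    exact: (eform_bound oD bD M0 DM mV Vb0 VVb Omega0 hu hh).
  have [hN _ _] := hK u h hu hh.
  rewrite normrM (ger0_norm beta0) -(mulrA beta); exact: (ler_wpM2l beta0 hN).
have [g hg gE] := H01_riesz oD bD M0 DM Fl Fb.
pose Q g := H01 D g /\ forall h, H01 D h -> Re (H01ip D g h) = denergy D V beta Omega u h.
have Qg : Q g.
  split; first exact: hg.
  move=> h hh; rewrite Re_H01ip (gE h hh).
  exact: (esym (denergyE oD bD M0 DM hm Omega mV VVb beta hu hh)).
have [h1 h2] : Q (sobolev_grad D V beta Omega u) := xgetPex (fun=> 0) (ex_intro _ g Qg).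
split; first exact: h1.
move=> h hh; rewrite -Re_H01ip; apply: (etrans (h2 h hh)).
exact: (denergyE oD bD M0 DM hm Omega mV VVb beta hu hh).
Qed.

(** One step of the scheme in the form of the abstract descent: the complex-valued operations become
    [lin], and scaling by c becomes adding c - 1 times the function. *)
Lemma scheme_step u al : 
  retraction D (fun r => u r - al%:C%C * projected_grad D V beta Omega u r) =
  let S := sobolev_grad D V beta Omega u in let G := GX D u in
  let v := lin (- al) u (lin (- (gradip D S G / gradip D G G)) S G) in
  lin ((Num.sqrt (dotL D v v))^-1 - 1) v v.
Proof.
pose S := sobolev_grad D V beta Omega u; pose G := GX D u.
pose v := lin (- al) u (lin (- (gradip D S G / gradip D G G)) S G).
change (retraction D (fun r => u r - al%:C%C * projected_grad D V beta Omega u r) =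
  lin ((Num.sqrt (dotL D v v))^-1 - 1) v v).
have -> : (fun r => u r - al%:C%C * projected_grad D V beta Omega u r) = v.
  apply/funext => x; rewrite /v /projected_grad /tangent_proj -/S -/G Re_H01ip H01norm_sqr.
  move: (_ / _) => k; apply: complex_ext; rewrite ?Re_lin ?Im_lin ?Re_lin ?Im_lin !partsE /=; ring.
rewrite /retraction L2normE; move: (_^-1) => c; apply/funext => x.
by apply: complex_ext; rewrite ?Re_lin ?Im_lin !partsE /=; ring.
Qed.

(** The imaginary part of the inner product with [h] is the real one with [mulI h], so real test
    identities determine complex weak convergence. *)
Lemma weak_cvgE (v : nat -> 'rV[R]_m.+2 -> R[i]) w : (forall k, H01 D (v k)) -> H01 D w ->
  H01_weak_cvg D v w <->
  forall h, H01 D h -> (fun k => gradip D h (v k)) @ \oo --> gradip D h w.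
Proof.
move=> hv hw.
have eR h : (fun k => Re (H01ip D h (v k))) = (fun k => gradip D h (v k)).
  by apply/funext => k; exact: Re_H01ip.
split=> hc h hh.
  by rewrite -(eR h) -Re_H01ip; exact: (proj1 (hc h hh)).
split; first by rewrite (eR h) Re_H01ip; exact: hc.
have e k : Im (H01ip D h (v k)) = gradip D (mulI h) (v k).
  exact: (Im_H01ip oD bD (H01_H1 hh) (H01_H1 (hv k))).
have -> : (fun k => Im (H01ip D h (v k))) = (fun k => gradip D (mulI h) (v k)) by apply/funext.
rewrite (Im_H01ip oD bD (H01_H1 hh) (H01_H1 hw)); exact: (hc _ (H01_mulI oD bD hh)).
Qed.

Lemma increasing_cvg (k : nat -> nat) : increasing_seq k -> k @ \oo --> \oo.
Proof.
move=> hk; have kn j : (j <= k j)%N.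
  elim: j => // j ih; apply: (leq_ltn_trans ih).
  by rewrite ltnNge; have := hk j.+1 j; rewrite !leEnat ltnn => ->.
by apply/cvgnyPge => A; exists A => // j /= Aj; exact: leq_trans Aj (kn j).
Qed.

Lemma gradient_descent K n0 : 0 < K -> trap_dominates_rotation D V Omega K ->
  exists Ca, 0 < Ca <= 1 /\
  forall u0, manifold D u0 -> nX u0 = n0 ->
  forall amin alpha, 0 < amin -> (forall k, amin <= alpha k) -> (forall k, alpha k <= Ca) ->
  forall ustar, weak_limit_point D (H01_scheme D V beta Omega u0 alpha) ustar ->
    stationary D V beta Omega ustar /\
    exists2 k : nat -> nat, increasing_seq k &
      H01_strong_cvg D (H01_scheme D V beta Omega u0 alpha \o k) ustar.
Proof.
move=> K0 hK; have [K4 K40 hK4] := quartic_bounds oD bD M0 DM hm.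
pose CL := Vb * (4 * M) + Omega * (2 * M).
pose CA := 1 + CL * (4 * M).
have CL0 : 0 <= CL by rewrite addr_ge0// !mulr_ge0.
have CA0 : 0 <= CA by rewrite addr_ge0// !mulr_ge0.
have c1 : 0 < 1 + K by rewrite ltr_wpDl.
have c0 : 0 < 1 - (1 + K)^-1 by rewrite subr_gt0 (invf_lt1 c1) ltrDl.
have eX u : Num.sqrt (gradip D u u) = nX u := esym (H01normE D u).
have eL u : Num.sqrt (dotL D u u) = nL u := esym (L2normE D u).
have hlinH c u v : H01 D u -> H01 D v -> H01 D (lin c u v) := @H01_lin _ _ _ oD bD c u v.
have hlC u v : H01 D u -> H01 D v -> dotL D u v = dotL D v u by move=> _ _; exact: dotLC.
have hllin c u v w : H01 D u -> H01 D v -> H01 D w ->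
    dotL D (lin c u v) w = dotL D u w + c * dotL D v w.
  by move=> /H01_H1/H1_L2 h1 /H01_H1/H1_L2 h2 /H01_H1/H1_L2 h3; exact: (dotL_lin oD).
have hl0 u : H01 D u -> 0 <= dotL D u u by move=> _; exact: dotL_ge0.
have hgC u v : H01 D u -> H01 D v -> gradip D u v = gradip D v u by move=> _ _; exact: gradipC.
have hglin c u v w : H01 D u -> H01 D v -> H01 D w ->
    gradip D (lin c u v) w = gradip D u w + c * gradip D v w.
  by move=> /H01_H1 h1 /H01_H1 h2 /H01_H1 h3; exact: (gradip_lin oD bD).
have hg0 u : H01 D u -> 0 <= gradip D u u by move=> _; exact: gradip_ge0.
have haC u v : H01 D u -> H01 D v -> eform u v = eform v u.
  by move=> h1 h2; exact: (eformC oD bD M0 DM V Omega h1 h2).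
have halin c u v w : H01 D u -> H01 D v -> H01 D w -> eform (lin c u v) w = eform u w + c * eform v w.
  by move=> h1 h2 h3; exact: (eform_lin oD bD DM Omega mV VVb c h1 h2 h3).
have hcoer u : H01 D u -> (1 - (1 + K)^-1) * gradip D u u <= eform u u.
  by move=> h1; exact: (eform_coercive oD DM mV VVb K0 hK h1).
have hbnd u v : H01 D u -> H01 D v ->
    `|eform u v| <= CA * Num.sqrt (gradip D u u) * Num.sqrt (gradip D v v).
  move=> h1 h2; have h := eform_bound oD bD M0 DM mV Vb0 VVb Omega0 h1 h2.
  exact: (subst2 (P := fun x y => `|eform u v| <= CA * x * y) (eX u) (eX v) h).
have hlow u w : H01 D u -> H01 D w ->
    `|eform u w - gradip D u w| <= CL * Num.sqrt (gradip D u u) * Num.sqrt (dotL D w w).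
  move=> h1 h2; have h := eform_low oD bD M0 DM mV Vb0 VVb Omega0 h1 h2.
  exact: (subst2 (P := fun x y => `|eform u w - gradip D u w| <= CL * x * y) (eX u) (eL w) h).
have hq0 u : H01 D u -> 0 <= T4 D u u u u by move=> _; exact: ipr_ge0.
have hN u v : H01 D u -> H01 D v ->
    `|T4 D u u u v| <= K4 * Num.sqrt (gradip D u u) ^+ 3 * Num.sqrt (gradip D v v).
  move=> h1 h2; have [h _ _] := hK4 u v h1 h2.
  exact: (subst2 (P := fun x y => `|T4 D u u u v| <= K4 * x ^+ 3 * y) (eX u) (eX v) h).
have hNq u : H01 D u -> T4 D u u u u = T4 D u u u u by [].
have hscale c u : H01 D u -> T4 D (lin (c - 1) u u) (lin (c - 1) u u) (lin (c - 1) u u) (lin (c - 1) u u) =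
    c ^+ 4 * T4 D u u u u.
  by move=> h1; exact: (T4_scale oD bD M0 DM hm c h1).
have hstep t u p : H01 D u -> H01 D p ->
    T4 D (lin (- t) u p) (lin (- t) u p) (lin (- t) u p) (lin (- t) u p) <=
    T4 D u u u u - 4 * t * T4 D u u u p + 8 * t ^+ 2 * K4 * Num.sqrt (gradip D u u) ^+ 2 *
     Num.sqrt (gradip D p p) ^+ 2 + 3 * t ^+ 4 * K4 * (Num.sqrt (gradip D p p) ^+ 2) ^+ 2.
  move=> h1 h2; apply: (le_trans (quartic_step oD bD M0 DM hm t h1 h2)).
  have [_ b1 _] := hK4 u p h1 h2; have [_ _ b2] := hK4 p p h2 h2.
  have t2 : 0 <= 8 * t ^+ 2 by rewrite mulr_ge0// sqr_ge0.
  have t4 : 0 <= 3 * t ^+ 4 by rewrite mulr_ge0// exprn_even_ge0.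
  have h := quartic_step_le (T4 D u u u u - 4 * t * T4 D u u u p) t2 t4 (le_trans (ler_norm _) b1) b2.
  exact: (subst2 (P := fun x y => _ <= T4 D u u u u - 4 * t * T4 D u u u p +
    8 * t ^+ 2 * K4 * x ^+ 2 * y ^+ 2 + 3 * t ^+ 4 * K4 * (y ^+ 2) ^+ 2) (eX u) (eX p) h).
have hsmall B e : 0 < e -> exists2 d, 0 < d & forall u w, H01 D u -> H01 D w ->
    Num.sqrt (gradip D u u) <= B -> Num.sqrt (gradip D w w) <= B -> Num.sqrt (dotL D w w) <= d ->
    `|T4 D u u u w| <= e.
  move=> e0; have [d d0 hd] := T4_small oD bD M0 DM hm B e0; exists d; first exact: d0.
  move=> u w h1 h2 b1 b2 b3.
  have {}b1 : nX u <= B := le_trans (eq_le (esym (eX u))) b1.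
  have {}b2 : nX w <= B := le_trans (eq_le (esym (eX w))) b2.
  have {}b3 : nL w <= d := le_trans (eq_le (esym (eL w))) b3.
  exact: (hd u u u w h1 h1 h1 h2 b1 b1 b1 b2 b3).
have hcont B h e : H01 D h -> 0 < e -> exists2 d, 0 < d & forall u v, H01 D u -> H01 D v ->
    Num.sqrt (gradip D u u) <= B -> Num.sqrt (gradip D v v) <= B ->
    Num.sqrt (dotL D (lin (-1) u v) (lin (-1) u v)) <= d -> `|T4 D u u u h - T4 D v v v h| <= e.
  move=> hh e0; have [d d0 hd] := T4_cont oD bD M0 DM hm B hh e0; exists d; first exact: d0.
  move=> u v h1 h2 b1 b2 b3.
  have {}b1 : nX u <= B := le_trans (eq_le (esym (eX u))) b1.
  have {}b2 : nX v <= B := le_trans (eq_le (esym (eX v))) b2.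
  have {}b3 : nL (lin (-1) u v) <= d := le_trans (eq_le (esym (eL _))) b3.
  exact: (hd u v h1 h2 b1 b2 b3).
have hcpt (v : nat -> 'rV[R]_m.+2 -> R[i]) w B : (forall k, H01 D (v k)) -> H01 D w ->
    (forall k, Num.sqrt (gradip D (v k) (v k)) <= B) ->
    (forall h, H01 D h -> (fun k => gradip D h (v k)) @ \oo --> gradip D h w) ->
    (fun k => Num.sqrt (dotL D (lin (-1) (v k) w) (lin (-1) (v k) w))) @ \oo --> (0 : R).
  move=> h1 h2 b hc.
  have -> : (fun k => Num.sqrt (dotL D (lin (-1) (v k) w) (lin (-1) (v k) w))) =
      (fun k => nL (lin (-1) (v k) w)) by apply/funext => k; exact: eL.
  apply: (weak_cvg_L2 oD bD M0 DM h1 h2 (B := B)).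
    by move=> k; exact: (le_trans (eq_le (esym (eX (v k)))) (b k)).
  exact: (proj2 (weak_cvgE h1 h2) hc).
have hS u (hu : H01 D u) := sobolev_grad_spec hu.
have hG u (hu : H01 D u) := GX_spec oD bD M0 DM (H1_L2 (H01_H1 hu)).
have [Ca [Ca01 main]] := descent hlinH hlC hllin hl0 hgC hglin hg0 haC halin c0 CA0 CL0 K40 beta0
  hcoer hbnd hlow hq0 hN hNq hscale hstep hsmall hcont hcpt hS hG n0.
exists Ca; split; first exact: Ca01.
move=> u0 [hu0 Lu0] Xu0 amin alpha amin0 al1 al2 ustar [hs [k kinc weak]].
pose u := H01_scheme D V beta Omega u0 alpha.
have Lu0' : Num.sqrt (dotL D (u 0%N) (u 0%N)) = 1 := etrans (eL u0) Lu0.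
have Xu0' : Num.sqrt (gradip D (u 0%N) (u 0%N)) = n0 := etrans (eX u0) Xu0.
(* The recursion of [H01_scheme] unfolds to a retraction, which [scheme_step] rewrites as the
   recursion that [descent] expects. *)
have [hu lim] := main u alpha amin hu0 Lu0' Xu0' amin0 al1 al2 (fun k => scheme_step (u k) (alpha k)).
have huk j : H01 D ((u \o k) j) := hu (k j).
have [Ls [lambda hl] hX] := lim k ustar (increasing_cvg kinc) hs (proj1 (weak_cvgE huk hs) weak).
split.
  split; first by split; [exact: hs|exact: (etrans (esym (eL ustar)) Ls)].
  exists lambda => v hv; rewrite Re_L2ip (denergyE oD bD M0 DM hm Omega mV VVb beta hs hv).
  exact: hl.
exists k; first exact: kinc.
rewrite /H01_strong_cvg.
have -> : (fun j => nX (fun x => (u \o k) j x - ustar x)) =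
    (fun j => Num.sqrt (gradip D (lin (-1) (u (k j)) ustar) (lin (-1) (u (k j)) ustar))).
  apply/funext => j; exact: (etrans (congr1 nX (sub_lin (u (k j)) ustar)) (esym (eX (lin (-1) (u (k j)) ustar)))).
exact: hX.
Qed.

End gross_pitaevskii.

Theorem theorem3p4 (R : realType) (m : nat) (hd : m.+2 = 2%N \/ m.+2 = 3%N)
  (D : set 'rV[R]_m.+2) (hD : bounded_domain D)
  (V : 'rV[R]_m.+2 -> R) (hV : Linfty D V)
  (hV0 : {ae leb, forall r, D r -> 0 <= V r})
  (beta Omega : R) (hbeta : 0 < beta) (hOmega : 0 <= Omega)
  (hK : exists2 K : R, 0 < K & trap_dominates_rotation D V Omega K)
  (N0 : R) :
  exists C_alpha : R, (0 < C_alpha <= 1) /\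
    forall u0 : 'rV[R]_m.+2 -> R[i], manifold D u0 -> H01norm D u0 = N0 ->
    forall (alpha_min alpha_max : R) (alpha : nat -> R),
      0 < alpha_min ->
      (forall n, alpha_min <= alpha n <= alpha_max) ->
      alpha_max <= C_alpha ->
    forall ustar : 'rV[R]_m.+2 -> R[i],
      weak_limit_point D (H01_scheme D V beta Omega u0 alpha) ustar ->
      stationary D V beta Omega ustar /\
      exists2 k : nat -> nat, increasing_seq k &
        H01_strong_cvg D (H01_scheme D V beta Omega u0 alpha \o k) ustar.
Proof.
have [_ oD _ bD] := hD; have [M M0 DM] := bounded_cube bD.
have [mV [Mv VMv]] := hV.
(* The bound of [V] is made nonnegative, since it also serves as the operator norm of multiplication
   by [V]. *)
have Vb0 : 0 <= Num.max 0 Mv by rewrite le_max lexx.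
have VVb : {ae leb, forall x, D x -> `|V x| <= Num.max 0 Mv}.
  by apply: filterS VMv => x h Dx; rewrite le_max h ?orbT.
have [K K0 hK'] := hK.
have [Ca [Ca01 main]] := gradient_descent oD bD (ltW M0) DM hd mV Vb0 VVb (ltW hbeta) hOmega N0 K0 hK'.
exists Ca; split=> // u0 hu0 Xu0 amin amax alpha amin0 al amax_le ustar hs.
apply: (main u0 hu0 Xu0 amin alpha amin0 _ _ ustar hs) => k; have /andP[h1 h2] := al k => //.
exact: le_trans h2 amax_le.
Qed.
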